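(* For every $(\beta,\mathfrak e)\in(0,1)\times(0,1)$ satisfying $\beta^2+\mathfrak e^2<1$, the systolic ratio of $\mathfrak M=\mathfrak M_{\beta,\mathfrak e}$ satisfies $$\rho_{\rm sys}(\mathfrak M)<\sqrt{1+7\beta}<2\sqrt2 .$$
   Context: For $\alpha,\varpi>0$ let $$H(p_r,p_z,r,z)=\frac{p_r^2+p_z^2}{2}+\frac{\varpi^2}{2r^2}-\frac1r-\frac{4}{\alpha\sqrt{r^2+(1+2\alpha)z^2}},\quad (r,z)\in(0,\infty)\times\mathbb R,\ (p_r,p_z)\in\mathbb R^2.$$ Put $\beta=1/(1+4/\alpha)$, $\mathfrak e=\sqrt{1-2\varpi^2\beta^2}$; thus $(\beta,\mathfrak e)\in(0,1)\times(0,1)$ determines $\alpha=4\beta/(1-\beta)$ and $\varpi=\sqrt{1-\mathfrak e^2}/(\sqrt2\beta)$. Let $\mathfrak M_{\beta,\mathfrak e}=H^{-1}(-1)$; for $\beta^2+\mathfrak e^2<1$ it is a regular compact energy surface diffeomorphic to $S^3$. There is a contact form $\lambda$ on $\mathfrak M$ with $d\lambda=(dp_r\wedge dr+dp_z\wedge dz)|_{\mathfrak M}$ whose Reeb vector field is parallel to the Hamiltonian vector field. The contact volume is $\mathrm{vol}(\mathfrak M)=\int_{\mathfrak M}\lambda\wedge d\lambda>0$, and the action of a periodic orbit $\zeta$ is $\int_\zeta\lambda>0$. Let $T_{\min}(\mathfrak M)$ be the smallest action among the periodic orbits of $\mathfrak M$ (this minimum is attained). None of these quantities depends on the choice of $\lambda$.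 The systolic ratio is $$\rho_{\rm sys}(\mathfrak M)=\frac{(T_{\min}(\mathfrak M))^2}{\mathrm{vol}(\mathfrak M)}.$$ *)

(* Defs.v *)
From HB Require Import structures.
From mathcomp Require Import all_boot all_order all_algebra.
From mathcomp Require Import all_classical all_reals all_analysis.
Set Implicit Arguments.
Unset Strict Implicit.
Unset Printing Implicit Defensive.
Import Order.TTheory GRing.Theory Num.Theory.
Import numFieldNormedType.Exports.
Local Open Scope classical_set_scope.
Local Open Scope ring_scope.

Section PhaseSpace.
Variable R : realType.

(* A phase space point is the row vector (p_r, p_z, r, z); tangent vectors and
   the coefficient vectors of 1-forms use the same coordinates. *)
Definition ipr : 'I_4 := @Ordinal 4 0 isT.
Definition ipz : 'I_4 := @Ordinal 4 1 isT.
Definition ir : 'I_4 := @Ordinal 4 2 isT.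
Definition iz : 'I_4 := @Ordinal 4 3 isT.

Definition vec4 (a b c d : R) : 'rV[R]_4 := \row_(i < 4) [:: a; b; c; d]`_i.

Definition partial (f : 'rV[R]_4 -> R) (i : 'I_4) (x : 'rV[R]_4) : R :=
  'D_(delta_mx 0 i) f x.

Definition pairing (a v : 'rV[R]_4) : R := \sum_(i < 4) a 0 i * v 0 i.

(* omega = dp_r /\ dr + dp_z /\ dz *)
Definition omega (u v : 'rV[R]_4) : R :=
  (u 0 ipr * v 0 ir - u 0 ir * v 0 ipr) +
  (u 0 ipz * v 0 iz - u 0 iz * v 0 ipz).

(* d lam_x (u, v) for lam = \sum_i lam_i dx_i *)
Definition ext_d (lam : 'rV[R]_4 -> 'rV[R]_4) (x u v : 'rV[R]_4) : R :=
  pairing ('D_u lam x) v - pairing ('D_v lam x) u.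

(* (lam /\ d lam)_x (u, v, w) *)
Definition wedge_d (lam : 'rV[R]_4 -> 'rV[R]_4) (x u v w : 'rV[R]_4) : R :=
  pairing (lam x) u * ext_d lam x v w +
  pairing (lam x) v * ext_d lam x w u +
  pairing (lam x) w * ext_d lam x u v.

Fixpoint Ck (k : nat) (U : set 'rV[R]_4) (f : 'rV[R]_4 -> 'rV[R]_4) : Prop :=
  match k with
  | 0%N => forall x, U x -> {for x, continuous f}
  | k'.+1 => (forall x, U x -> differentiable f x) /\
             (forall v, Ck k' U (fun x => 'D_v f x))
  end.

Definition smooth_on (U : set 'rV[R]_4) (f : 'rV[R]_4 -> 'rV[R]_4) : Prop :=
  forall k, Ck k U f.

Definition potential (alpha varpi r z : R) : R :=
  varpi ^+ 2 / (2 * r ^+ 2) - 1 / r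
  - 4 / (alpha * Num.sqrt (r ^+ 2 + (1 + 2 * alpha) * z ^+ 2)).

Definition hamiltonian (alpha varpi : R) (x : 'rV[R]_4) : R :=
  (x 0 ipr ^+ 2 + x 0 ipz ^+ 2) / 2 + potential alpha varpi (x 0 ir) (x 0 iz).

(* The vector field X with omega (X, .) = - dH. *)
Definition ham_field (H : 'rV[R]_4 -> R) (x : 'rV[R]_4) : 'rV[R]_4 :=
  vec4 (- partial H ir x) (- partial H iz x) (partial H ipr x) (partial H ipz x).

Section EnergySurface.
Variables beta ecc : R.

(* The inverse of beta = 1 / (1 + 4 / alpha),
   ecc = sqrt (1 - 2 * varpi ^ 2 * beta ^ 2). *)
Definition alpha_of : R := 4 * beta / (1 - beta).
Definition varpi_of : R := Num.sqrt (1 - ecc ^+ 2) / (Num.sqrt 2 * beta).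

Definition Ham : 'rV[R]_4 -> R := hamiltonian alpha_of varpi_of.

(* [Ham] is a total function; r > 0 restricts it to the actual phase space. *)
Definition surface : set 'rV[R]_4 := [set x : 'rV[R]_4 | 0 < x 0 ir /\ Ham x = -1].

Definition tangent (x : 'rV[R]_4) : set 'rV[R]_4 := [set v : 'rV[R]_4 | 'D_v Ham x = 0].

Definition is_reeb (lam : 'rV[R]_4 -> 'rV[R]_4) (x v : 'rV[R]_4) : Prop :=
  [/\ tangent x v, pairing (lam x) v = 1 &
      forall w, tangent x w -> ext_d lam x v w = 0].

(* A contact form on the surface is represented by a smooth extension to some
   open neighbourhood; every condition only involves its restriction to the
   surface. *)
Definition adapted_contact_form (lam : 'rV[R]_4 -> 'rV[R]_4) : Prop :=
  [/\ exists U : set 'rV[R]_4, [/\ open U, surface `<=` U & smooth_on U lam],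
      forall x u v w, surface x -> tangent x u -> tangent x v -> tangent x w ->
        free [:: u; v; w] -> wedge_d lam x u v w != 0,
      forall x u v, surface x -> tangent x u -> tangent x v ->
        ext_d lam x u v = omega u v &
      forall x v, surface x -> is_reeb lam x v ->
        exists c : R, v = c *: ham_field Ham x].

(* [T] is any period, not only the minimal one: iterates of an orbit have a
   larger action, so that they do not change the least action. *)
Definition periodic_orbit (g : R -> 'rV[R]_4) (T : R) : Prop :=
  [/\ 0 < T,
      forall t, surface (g t),
      forall t : R, is_derive t (1 : R) g (ham_field Ham (g t)) &
      forall t, g (t + T) = g t].

Definition action (lam : 'rV[R]_4 -> 'rV[R]_4) (g : R -> 'rV[R]_4) (T : R) : R :=
  \int[lebesgue_measure]_(t in `[0, T]) pairing (lam (g t)) (derive1 g t).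

Definition actions (lam : 'rV[R]_4 -> 'rV[R]_4) : set R :=
  [set a | exists g T, periodic_orbit g T /\ a = action lam g T].

(* The infimum is attained, hence it is the smallest action; all actions are
   positive because lam pairs positively with the Hamiltonian vector field. *)
Definition Tmin (lam : 'rV[R]_4 -> 'rV[R]_4) : R := inf (actions lam).

(* The integral over the surface is computed in the injective parametrization
   (theta, r, z) |-> (rho cos theta, rho sin theta, r, z), where rho = |p| is
   given by the energy relation. It covers the surface up to the zero velocity
   curve p = 0 and the piece theta = 0, which have measure zero. *)
Definition chart (theta r z : R) : 'rV[R]_4 :=
  let rho := Num.sqrt (2 * (- 1 - potential alpha_of varpi_of r z)) in
  vec4 (rho * cos theta) (rho * sin theta) r z.

Definition chart_dom : set (R * R * R) :=
  [set y : R * R * R | [/\ 0 < y.1.1 < 2 * pi, 0 < y.1.2 &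
               potential alpha_of varpi_of y.1.2 y.2 < -1]].

(* The absolute value expresses that the surface is oriented by the volume form
   lam /\ d lam itself. *)
Definition contact_volume (lam : 'rV[R]_4 -> 'rV[R]_4) : R :=
  \int[((lebesgue_measure \x lebesgue_measure) \x lebesgue_measure)%E]_(y in
    chart_dom)
    `| wedge_d lam (chart y.1.1 y.1.2 y.2)
         (derive1 (fun t : R => chart t y.1.2 y.2) y.1.1)
         (derive1 (fun r : R => chart y.1.1 r y.2) y.1.2)
         (derive1 (fun z : R => chart y.1.1 y.1.2 z) y.2) |.

Definition systolic_ratio (lam : 'rV[R]_4 -> 'rV[R]_4) : R :=
  Tmin lam ^+ 2 / contact_volume lam.

End EnergySurface.
End PhaseSpace.

(* Main.v *)
(* On the surface the kinetic energy is [w(r, z) = -1 - V(r, z)], so the surface is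
   fibred over [w >= 0] by the circles [|p|^2 = 2 w], parametrized by an angle [t].
   In the coordinates [(t, r, z)] the density of [lam /\ d lam] differs from [2 w]
   by a sum of derivatives that integrate to 0 along each coordinate, hence the
   volume is at least the integral of [2 w], whatever the form [lam] is. Integrating
   over [t] and [z] leaves the function [cap] of a variable that depends affinely on
   [1 / (1 - beta)]; a scaling inequality for [cap] compares it with the limit case
   [beta = 0], in which the integral over [r] is elementary. With
   [kap = sqrt (1 - ecc^2)] this gives
     [vol > 2 pi^2 (1 - kap)^2 / (beta^2 sqrt (1 + 7 beta))].
   On the other hand the plane [z = 0] carries a periodic orbit that is a Kepler
   ellipse with semi-major axis [1 / (2 beta)] and eccentricity [ecc]. Stokes'
   theorem on the disc obtained by rotating its momentum by angles in [[0, pi]]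
   shows that its action is the integral of [p_r^2], that is
   [T = sqrt 2 pi (1 - kap) / beta]. The actions are stable under doubling, so that
   [0 <= Tmin <= T], and [T^2 < sqrt (1 + 7 beta) vol]. *)

Require Import Defs.
From HB Require Import structures.
From mathcomp Require Import all_boot all_order all_algebra.
From mathcomp Require Import all_classical all_reals all_analysis.
From mathcomp Require Import measurable_realfun ring lra.
Import Order.TTheory GRing.Theory Num.Theory.
Import numFieldNormedType.Exports.
Set Implicit Arguments.
Unset Strict Implicit.
Unset Printing Implicit Defensive.
Local Open Scope classical_set_scope.
Local Open Scope ring_scope.

(** * Derivatives and continuity of real functions *)

Section Calculus.
Variable R : realType.
Implicit Types (f g : R -> R) (t a b : R).

(** The form [lam] is known only through d lam = omega on tangent vectors, so neither the volume nor
    the action is computed from an explicit primitive of omega; both come from Stokes' theorem, with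
    d lam replaced by omega inside. For the volume the forms are weighted by the momenta [p_r] and
    [p_z]: the weights cancel the factor 1 / |p| in the derivatives of the chart and leave boundary
    terms proportional to |p|^2, which vanish on the zero velocity curve. The absolute value in the
    volume then costs only an inequality, in the required direction. The constant comes from 1 + 2
    alpha = (1 + 7 beta) / (1 - beta). The powers of 1 - beta that remain combine to the exponent
    3/2, exactly the one in the scaling inequality for [cap] with u = 1 - beta. After that step T^2
    equals sqrt (1 + 7 beta) times the lower bound of the volume, so strictness comes from the
    scaling inequality alone. The condition beta^2 + ecc^2 < 1 says beta < kap. It keeps the
    arguments of [cap] positive and bounds the region in the z direction. *)

Lemma derive_const t a : is_derive t (1 : R) (fun=> a) 0.
Proof. exact: is_derive_cst. Qed.

Lemma derive_idfun t : is_derive t (1 : R) (fun x : R => x) 1.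
Proof. exact: is_derive_id. Qed.

Lemma derive_add t f g a b : is_derive t (1 : R) f a -> is_derive t (1 : R) g b ->
  is_derive t (1 : R) (fun x => f x + g x) (a + b).
Proof. by move=> *; apply: is_deriveD. Qed.

Lemma derive_opp t f a : is_derive t (1 : R) f a ->
  is_derive t (1 : R) (fun x => - f x) (- a).
Proof. by move=> *; apply: is_deriveN. Qed.

Lemma derive_mul t f g a b : is_derive t (1 : R) f a -> is_derive t (1 : R) g b ->
  is_derive t (1 : R) (fun x => f x * g x) (a * g t + f t * b).
Proof.
move=> fa gb; have -> : (fun x => f x * g x) = f * g by [].
refine (is_derive_eq (is_deriveM fa gb) _).
by rewrite /GRing.scale/= addrC mulrC.
Qed.

Lemma derive_sqr t f a : is_derive t (1 : R) f a ->
  is_derive t (1 : R) (fun x => f x ^+ 2) (2 * f t * a).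
Proof.
move=> fa; have -> : (fun x => f x ^+ 2) = (fun x => f x * f x).
  by apply/funext => x; rewrite expr2.
by apply: (is_derive_eq (derive_mul fa fa)); ring.
Qed.

Lemma derive_inv t f a : f t != 0 -> is_derive t (1 : R) f a ->
  is_derive t (1 : R) (fun x => (f x)^-1) (- (f t ^- 2 * a)).
Proof.
move=> f0 fa; apply: (is_derive_eq (is_deriveV f0 fa)).
by rewrite /GRing.scale/= mulNr.
Qed.

Lemma derive_comp1 t f g a b : is_derive (g t) (1 : R) f a ->
  is_derive t (1 : R) g b -> is_derive t (1 : R) (fun x => f (g x)) (a * b).
Proof. by move=> fa gb; exact: is_derive1_comp. Qed.

Lemma derive_sqrt1 t f a : 0 < f t -> is_derive t (1 : R) f a ->
  is_derive t (1 : R) (fun x => Num.sqrt (f x)) ((2 * Num.sqrt (f t))^-1 * a).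
Proof. by move=> f0 fa; apply: derive_comp1 => //; exact: is_derive1_sqrt. Qed.

Lemma derive_ln1 t f a : 0 < f t -> is_derive t (1 : R) f a ->
  is_derive t (1 : R) (fun x => ln (f x)) ((f t)^-1 * a).
Proof. by move=> f0 fa; apply: derive_comp1 => //; exact: is_derive1_ln. Qed.

Lemma derive_cos1 t f a : is_derive t (1 : R) f a ->
  is_derive t (1 : R) (fun x => cos (f x)) (- sin (f t) * a).
Proof. by move=> fa; apply: derive_comp1 => //; exact: is_derive_cos. Qed.

Lemma derive_sin1 t f a : is_derive t (1 : R) f a ->
  is_derive t (1 : R) (fun x => sin (f x)) (cos (f t) * a).
Proof. by move=> fa; apply: derive_comp1 => //; exact: is_derive_sin. Qed.

Lemma derive_atan1 t f a : is_derive t (1 : R) f a ->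
  is_derive t (1 : R) (fun x => atan (f x)) ((1 + f t ^+ 2)^-1 * a).
Proof. by move=> fa; apply: derive_comp1 => //; exact: is_derive1_atan. Qed.

Lemma is_derive_continuous t f a : is_derive t (1 : R) f a -> {for t, continuous f}.
Proof.
by case=> fd _; apply/differentiable_continuous; rewrite -derivable1_diffP.
Qed.

Lemma Rintegral_FTC f F a b : a < b ->
  (forall t, a <= t <= b -> {for t, continuous f}) ->
  (forall t, a < t < b -> is_derive t (1 : R) F (f t)) ->
  {for a, continuous F} -> {for b, continuous F} ->
  \int[lebesgue_measure]_(t in `[a, b]) f t = F b - F a.
Proof.
move=> ab fc Ff Fa Fb; rewrite /Rintegral (@continuous_FTC2 _ f F)//.
- by apply/continuous_in_subspaceT => x; rewrite inE/= in_itv/=; exact: fc.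
- split; last 2 first.
  + exact: cvg_at_right_filter.
  + exact: cvg_at_left_filter.
  by move=> x; rewrite in_itv/= => /Ff [].
- by move=> x; rewrite in_itv/= => /Ff [_]; rewrite derive1E.
Qed.

Lemma derive_gt0_lt (f df : R -> R) a b : a < b ->
  (forall t, a <= t <= b -> {for t, continuous f}) ->
  (forall t, a < t < b -> is_derive t (1 : R) f (df t)) ->
  (forall t, a < t < b -> 0 < df t) -> f a < f b.
Proof.
move=> ab fc fd df0; have fd' x : x \in `]a, b[ -> is_derive x (1 : R) f (df x).
  by rewrite in_itv/=; exact: fd.
have fw : {within `[a, b], continuous f}.
  by apply/continuous_in_subspaceT => x; rewrite inE/= in_itv/=; exact: fc.
have [c] := MVT ab fd' fw; rewrite in_itv/= => /df0 c0 fE.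
by rewrite -subr_gt0 fE mulr_gt0// subr_gt0.
Qed.

Lemma cst_continuous_for (T : topologicalType) (x : T) (a : R) : {for x, continuous (fun=> a)}.
Proof. exact: cvg_cst. Qed.

Section Continuity.
Variables (T : topologicalType) (x : T).
Implicit Types u v : T -> R.

Lemma continuous_add u v : {for x, continuous u} -> {for x, continuous v} ->
  {for x, continuous (fun y => u y + v y)}.
Proof. by move=> *; apply: cvgD. Qed.

Lemma continuous_opp u : {for x, continuous u} -> {for x, continuous (fun y => - u y)}.
Proof. by move=> *; apply: cvgN. Qed.

Lemma continuous_mul u v : {for x, continuous u} -> {for x, continuous v} ->
  {for x, continuous (fun y => u y * v y)}.
Proof. by move=> *; apply: cvgM. Qed.

Lemma continuous_sqr u : {for x, continuous u} -> {for x, continuous (fun y => u y ^+ 2)}.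
Proof. by move=> *; apply: continuous_mul. Qed.

Lemma continuous_inv u : u x != 0 -> {for x, continuous u} ->
  {for x, continuous (fun y => (u y)^-1)}.
Proof. by move=> *; apply: cvgV. Qed.

Lemma continuous_comp1 (f : R -> R) u : {for u x, continuous f} ->
  {for x, continuous u} -> {for x, continuous (fun y => f (u y))}.
Proof. by move=> *; apply: continuous_comp. Qed.

Lemma continuous_sqrt1 u : {for x, continuous u} ->
  {for x, continuous (fun y => Num.sqrt (u y))}.
Proof. by move=> *; apply: continuous_comp1 => //; exact: sqrt_continuous. Qed.

Lemma continuous_cos1 u : {for x, continuous u} -> {for x, continuous (fun y => cos (u y))}.
Proof. by move=> *; apply: continuous_comp1 => //; exact: continuous_cos. Qed.

Lemma continuous_sin1 u : {for x, continuous u} -> {for x, continuous (fun y => sin (u y))}.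
Proof. by move=> *; apply: continuous_comp1 => //; exact: continuous_sin. Qed.

Lemma continuous_atan1 u : {for x, continuous u} -> {for x, continuous (fun y => atan (u y))}.
Proof. by move=> *; apply: continuous_comp1 => //; exact: continuous_atan. Qed.

Lemma continuous_ln1 u : 0 < u x -> {for x, continuous u} ->
  {for x, continuous (fun y => ln (u y))}.
Proof. by move=> *; apply: continuous_comp1 => //; exact: continuous_ln. Qed.

Lemma continuous_fst1 (A B : topologicalType) (u : T -> A * B) :
  {for x, continuous u} -> {for x, continuous (fun y => (u y).1)}.
Proof. by move=> ux; apply: continuous_comp => //; exact: cvg_fst. Qed.

Lemma continuous_snd1 (A B : topologicalType) (u : T -> A * B) :
  {for x, continuous u} -> {for x, continuous (fun y => (u y).2)}.
Proof. by move=> ux; apply: continuous_comp => //; exact: cvg_snd. Qed.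

End Continuity.

End Calculus.

(** The rule is chosen by the syntax of the function body, which is why the rules above are stated
    for explicit lambda terms. Class resolution is bypassed; derivatives of atoms are taken from the
    context, after eta-expansion if necessary. *)
Ltac derive_step := first
  [ lazymatch goal with
    | |- is_derive _ _ (fun _ => ?c) _ => notypeclasses refine (derive_const _ _)
    | |- is_derive _ _ (fun x => x) _ => notypeclasses refine (derive_idfun _)
    | |- is_derive _ _ (fun x => _ + _) _ => notypeclasses refine (derive_add _ _)
    | |- is_derive _ _ (fun x => - _) _ => notypeclasses refine (derive_opp _)
    | |- is_derive _ _ (fun x => _ * _) _ => notypeclasses refine (derive_mul _ _)
    | |- is_derive _ _ (fun x => _ ^+ 2) _ => notypeclasses refine (derive_sqr _)
    | |- is_derive _ _ (fun x => _^-1) _ => notypeclasses refine (derive_inv _ _)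
    | |- is_derive _ _ (fun x => Num.sqrt _) _ => notypeclasses refine (derive_sqrt1 _ _)
    | |- is_derive _ _ (fun x => ln _) _ => notypeclasses refine (derive_ln1 _ _)
    | |- is_derive _ _ (fun x => cos _) _ => notypeclasses refine (derive_cos1 _)
    | |- is_derive _ _ (fun x => sin _) _ => notypeclasses refine (derive_sin1 _)
    | |- is_derive _ _ (fun x => atan _) _ => notypeclasses refine (derive_atan1 _)
    | |- is_derive ?t ?v ?f ?d => lazymatch f with
        | (fun _ => _) => fail
        | _ => change (is_derive t v (fun x => f x) d)
        end
    end
  | eassumption ].

(** The rules build some derivative; what remains, after side conditions such as non-zero
    denominators, is an algebraic identity between it and the claimed one. *)
Ltac derive_tac := notypeclasses refine (is_derive_eq _ _); [repeat derive_step|cbv beta].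

Ltac continuous_step := first
  [ lazymatch goal with
    | |- {for _, continuous (fun _ => ?c)} => exact: cst_continuous_for
    | |- {for _, continuous (fun x => x)} => exact: cvg_id
    | |- {for ?t, continuous (fun x => @?f x + @?g x)} =>
        refine (@continuous_add _ _ t f g _ _)
    | |- {for ?t, continuous (fun x => - @?f x)} => refine (@continuous_opp _ _ t f _)
    | |- {for ?t, continuous (fun x => @?f x * @?g x)} =>
        refine (@continuous_mul _ _ t f g _ _)
    | |- {for ?t, continuous (fun x => @?f x ^+ 2)} => refine (@continuous_sqr _ _ t f _)
    | |- {for ?t, continuous (fun x => (@?f x)^-1)} => refine (@continuous_inv _ _ t f _ _)
    | |- {for ?t, continuous (fun x => Num.sqrt (@?f x))} =>
        refine (@continuous_sqrt1 _ _ t f _)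
    | |- {for ?t, continuous (fun x => ln (@?f x))} => refine (@continuous_ln1 _ _ t f _ _)
    | |- {for ?t, continuous (fun x => cos (@?f x))} => refine (@continuous_cos1 _ _ t f _)
    | |- {for ?t, continuous (fun x => sin (@?f x))} => refine (@continuous_sin1 _ _ t f _)
    | |- {for ?t, continuous (fun x => fst (@?f x))} => refine (@continuous_fst1 _ t _ _ f _)
    | |- {for ?t, continuous (fun x => snd (@?f x))} => refine (@continuous_snd1 _ t _ _ f _)
    | |- {for ?t, continuous (fun x => atan (@?f x))} => refine (@continuous_atan1 _ _ t f _)
    | |- {for ?t, continuous ?f} => lazymatch f with
        | (fun _ => _) => fail
        | _ => change {for t, continuous (fun x => f x)}
        end
    end; cbv beta
  | eassumption ].

Ltac continuous_tac := repeat continuous_step.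

(** Product topologies and product sigma-algebras are built independently. A countable base of open
    sets that also belong to [M] links them: every open set is then a countable union of members of
    [M]. *)
Definition countable_base (T : topologicalType) (M : set (set T)) :=
  exists2 B : nat -> set T, forall n, open (B n) /\ M (B n) &
    forall x U, nbhs x U -> exists2 n, B n x & B n `<=` U.

Lemma countable_base_open (T : topologicalType) (M : set (set T)) (U : set T) :
  countable_base M -> (forall F : (set T)^nat, (forall n, M (F n)) -> M (\bigcup_n F n)) ->
  M set0 -> open U -> M U.
Proof.
move=> [B BM nB] Mcup M0 oU.
have -> : U = \bigcup_n (if `[< B n `<=` U >] then B n else set0).
  apply/seteqP; split => [x Ux|x [n _]]; last by case: asboolP => // /(_ x) + Bx; exact.
  have [n Bnx BnU] := nB _ _ (open_nbhs_nbhs (conj oU Ux)).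
  by exists n => //; case: asboolP.
by apply: Mcup => n; case: asboolP => // _; case: (BM n).
Qed.

Lemma countable_base_prod (S T : topologicalType) (M : set (set S)) (N : set (set T))
    (MN : set (set (S * T))) :
  countable_base M -> countable_base N ->
  (forall A B, M A -> N B -> MN (A `*` B)) -> countable_base MN.
Proof.
move=> [B BM nB] [C CN nC] MNX.
(* Pairs of indices are enumerated by [unpickle]; the default (0, 0) is itself a valid pair, so
   numbers that code nothing are harmless. *)
exists (fun n => let p := odflt (0%N, 0%N) (unpickle n) in B p.1 `*` C p.2).
  move=> n /=; case: (odflt _ _) => i j /=; have [oB MB] := BM i; have [oC NC] := CN j.
  split; last exact: MNX.
  rewrite openE => -[x y] [/= Bx Cy]; exists (B i, C j) => //.
  by split; apply: open_nbhs_nbhs.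
move=> [x y] U [[V W] [/= xV yW] VWU].
have [i Bx BV] := nB _ _ xV; have [j Cy CW] := nC _ _ yW.
exists (pickle (i, j)); rewrite pickleK//= => z [Bz Cz].
by apply: VWU; split; [exact: BV|exact: CW].
Qed.

(** * Measurability and iterated integrals *)

Section MeasurableOpen.
Variable R : realType.
Notation RM := (measurableTypeR R).

Lemma countable_base_R : countable_base (@measurable _ RM : set (set R)).
Proof.
exists (fun n => let p := odflt (0, 0) (unpickle n : option (rat * rat)) in
        [set` `](ratr p.1 : R), ratr p.2[]).
  by move=> n; split; [exact: interval_open|exact: measurable_itv].
move=> x U /nbhs_ballP[e /= e0 xU].
have /rat_in_itvoo[p] : x - e < x by rewrite ltrBlDr ltrDl.
have /rat_in_itvoo[q] : x < x + e by rewrite ltrDl.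
rewrite !in_itv/= => /andP[xq qe] /andP[ep px].
exists (pickle (p, q)); rewrite pickleK/= ?in_itv/= ?px//.
move=> y; rewrite /= in_itv/= => /andP[py yq]; apply: xU.
rewrite /ball/= ltr_distlC; apply/andP; split; lra.
Qed.

Lemma countable_base_R2 : countable_base (@measurable _ (RM * RM)%type : set (set (R * R))).
Proof.
apply: (countable_base_prod countable_base_R countable_base_R) => A B mA mB.
exact: measurableX.
Qed.

Lemma countable_base_R3 :
  countable_base (@measurable _ (RM * RM * RM)%type : set (set (R * R * R))).
Proof.
apply: (countable_base_prod countable_base_R2 countable_base_R) => A B mA mB.
exact: measurableX.
Qed.

Lemma open_measurable2 (U : set (R * R)) : open U -> measurable (U : set (RM * RM)).
Proof.
move=> oU; apply: (countable_base_open countable_base_R2) => //.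
exact: bigcupT_measurable.
Qed.

Lemma open_measurable3 (U : set (R * R * R)) :
  open U -> measurable (U : set (RM * RM * RM)).
Proof.
move=> oU; apply: (countable_base_open countable_base_R3) => //.
exact: bigcupT_measurable.
Qed.

Lemma open_continuous_preimage (T : topologicalType) (U : set T) (f : T -> R) (A : set R) :
  open U -> open A -> (forall x, U x -> {for x, continuous f}) -> open (U `&` f @^-1` A).
Proof.
move=> oU oA fc; rewrite openE => x [Ux Ax].
apply: filterI; first exact: (open_nbhs_nbhs (conj oU Ux)).
exact: (fc _ Ux _ (open_nbhs_nbhs (conj oA Ax))).
Qed.

Lemma continuous_measurable2 (U : set (R * R)) (f : R * R -> R) : open U ->
  (forall x, U x -> {for x, continuous f}) -> measurable_fun (U : set (RM * RM)) f.
Proof.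
move=> oU fc; apply: (measurability _ (measurable_realfun.RGenOpens.measurableE R)).
move=> _ [_ [a [b ->] <-]]; apply: open_measurable2.
exact/open_continuous_preimage/fc/interval_open.
Qed.

Lemma continuous_measurable3 (U : set (R * R * R)) (f : R * R * R -> R) : open U ->
  (forall x, U x -> {for x, continuous f}) -> measurable_fun (U : set (RM * RM * RM)) f.
Proof.
move=> oU fc; apply: (measurability _ (measurable_realfun.RGenOpens.measurableE R)).
move=> _ [_ [a [b ->] <-]]; apply: open_measurable3.
exact/open_continuous_preimage/fc/interval_open.
Qed.

End MeasurableOpen.

Lemma bounded_support_integrable d (T : measurableType d) (R : realType)
    (mu : {measure set T -> \bar R}) (A : set T) (f : T -> R) (C : R) :
  measurable A -> (mu A < +oo)%E -> measurable_fun setT f ->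
  (forall x, `|f x| <= C) -> (forall x, ~ A x -> f x = 0) ->
  mu.-integrable setT (EFin \o f).
Proof.
move=> mA A_fin mf fC fA.
have -> : EFin \o f = (EFin \o f) \_ A.
  apply/funext => x; rewrite patchE/=; case: ifPn => // /negP.
  by rewrite inE => /fA ->.
apply/(integrable_mkcond _ mA)/measurable_bounded_integrable => //.
- exact: measurable_funS mf.
- by exists C; split; rewrite ?num_real // => ? ? ? ?; exact: le_trans (ltW _).
Qed.

(* An alias of the product measure on the plane, on which the canonical
   sigma-finite structure needed by Fubini's theorem is found by unification. *)
Definition plane_measure (R : realType) : set (measurableTypeR R * measurableTypeR R) -> \bar R :=
  (@lebesgue_measure R \x @lebesgue_measure R)%E.

Section PlaneMeasure.
Variable R : realType.
Local Notation mu2 := (@plane_measure R).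
Local Open Scope ereal_scope.

Let plane_measure0 : mu2 set0 = 0. Proof. exact: measure0. Qed.
Let plane_measure_ge0 A : 0 <= mu2 A. Proof. exact: measure_ge0. Qed.
Let plane_measure_additive : semi_sigma_additive mu2.
Proof. exact: measure_semi_sigma_additive. Qed.

HB.instance Definition _ := isMeasure.Build _ _ _ mu2
  plane_measure0 plane_measure_ge0 plane_measure_additive.

Let plane_measure_sigma_finite : sigma_finite setT mu2.
Proof.
pose I n : set (measurableTypeR R) := [set` `](- n%:R : R)%R, n%:R[].
have mI n : measurable (I n) by exact: measurable_itv.
exists (fun n => I n `*` I n).
  apply/esym; rewrite -subTset => -[x y] _; exists (Num.truncn (`|x| + `|y|)).+1 => //=.
  rewrite /I/= !in_itv/= -!ltr_norml.
  have := truncnS_gt (`|x| + `|y|)%R; have := normr_ge0 x; have := normr_ge0 y.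
  by move=> y0 x0 n; split; apply: le_lt_trans n; [rewrite lerDl|rewrite lerDr].
move=> n; split; first exact: measurableX.
have fin : lebesgue_measure (I n) < +oo.
  by rewrite lebesgue_measure_itv/= -EFinD; case: ifP; rewrite ltry.
by rewrite /plane_measure product_measure1E//; apply: lte_mul_pinfty => //;
  rewrite ge0_fin_numE.
Qed.

HB.instance Definition _ := Measure_isSigmaFinite.Build _ _ _ mu2
  plane_measure_sigma_finite.

End PlaneMeasure.

Section Slices.
Variable R : realType.
Notation RM := (measurableTypeR R).
Notation mu := (@lebesgue_measure R).
Notation mu2 := (@plane_measure R).
Notation mu3 := ((mu \x mu) \x mu)%E.
Variables (D : set (R * R * R)) (B C : R) (g : R * R * R -> R).
Hypothesis D_open : open D.
Hypothesis D_box : forall x, D x -> [/\ `|x.1.1| <= B, `|x.1.2| <= B & `|x.2| <= B].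
Hypothesis g_cont : forall x, D x -> {for x, continuous g}.
Hypothesis g_bound : forall x, D x -> `|g x| <= C.

Let I : set R := `[- B, B].
Let G : RM * RM * RM -> R := g \_ D.

Let mG : measurable_fun setT G.
Proof.
apply/(measurable_restrictT _ (open_measurable3 D_open)).
exact: continuous_measurable3.
Qed.

(** [D] may be empty, and then [C] may be negative; hence the maximum with 0. *)
Let G_le x : `|G x| <= Num.max C 0.
Proof.
rewrite /G patchE; case: ifPn => [|_]; last by rewrite normr0 le_max lexx orbT.
by rewrite inE => /g_bound h; rewrite le_max h.
Qed.

Let G_out x y z : ~ (I x /\ I y /\ I z) -> G (x, y, z) = 0.
Proof.
rewrite /G patchE; case: ifPn => //; rewrite inE => /D_box[/=].
by rewrite /I/= !in_itv/= !ler_norml => -> -> -> [].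
Qed.

Let I_fin : (mu I < +oo)%E.
Proof. by rewrite /I lebesgue_measure_itv/= -EFinD; case: ifP; rewrite ltry. Qed.

Let mI : measurable (I : set RM).
Proof. exact: measurable_itv. Qed.

Let mI2 : measurable (I `*` I : set (RM * RM)).
Proof. exact: measurableX. Qed.

Let I2_fin : (mu2 (I `*` I) < +oo)%E.
Proof.
by rewrite /plane_measure product_measure1E//; apply: lte_mul_pinfty => //; rewrite ge0_fin_numE.
Qed.

Let I3_fin : ((mu2 \x mu)%E (I `*` I `*` I) < +oo)%E.
Proof.
rewrite product_measure1E//; apply: lte_mul_pinfty => //.
by rewrite ge0_fin_numE// measure_ge0.
Qed.

Let iG : (mu2 \x mu)%E.-integrable setT (EFin \o G).
Proof.
apply: (@bounded_support_integrable _ (RM * RM * RM)%type R (mu2 \x mu)%E (I `*` I `*` I) G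
  (Num.max C 0)) => //.
  exact: measurableX.
by move=> [[x y] z] /= h; apply: G_out => -[? [? ?]]; apply: h.
Qed.

Let iG2 z : mu2.-integrable setT (EFin \o (fun p => G (p, z))).
Proof.
apply: (@bounded_support_integrable _ (RM * RM)%type R mu2 (I `*` I) (fun p => G (p, z))
  (Num.max C 0)) => //.
- exact: (measurableT_comp mG (pair2_measurable z)).
- by move=> [x y] /= h; apply: G_out => -[? [? ?]]; apply: h.
Qed.

Lemma box_integrable : mu3.-integrable D (EFin \o g).
Proof.
apply/(integrable_mkcond _ (open_measurable3 D_open)).
by rewrite -/(EFin \o g) restrict_EFin.
Qed.

Let patch_slice (A : Type) (h : A -> R * R * R) a :
  ((fun x => (g (h x))%:E) \_ [set x | D (h x)]) a = (G (h a))%:E.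
Proof.
rewrite /G !patchE; have -> : (a \in [set x | D (h x)]) = (h a \in D).
  by apply/idP/idP; rewrite !inE.
by case: ifP.
Qed.

Let int_G : (\int[mu3]_(x in D) (g x)%:E = \int[mu3]_x (EFin \o G) x)%E.
Proof.
by rewrite integral_mkcond; apply: eq_integral => x _; rewrite /= /G !patchE; case: ifP.
Qed.

(** Each flux below is a derivative in a single coordinate and must be integrated in that one first.
    This lemma and the next two put [z], [r] and [t] innermost in turn, by Fubini's theorem for the
    extension of [g] by zero. *)
Lemma integral_box_z : (\int[mu3]_(x in D) (g x)%:E =
  \int[mu2]_p \int[mu]_(z in [set z | D (p, z)]) (g (p, z))%:E)%E.
Proof.
refine (eq_trans int_G (eq_trans (esym (integral12_prod_meas1 iG)) _)).
apply: eq_integral => p _; rewrite [RHS]integral_mkcond.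
by apply: eq_integral => z _; rewrite (patch_slice (fun z => (p, z))).
Qed.

Lemma integral_box_r : (\int[mu3]_(x in D) (g x)%:E =
  \int[mu]_z \int[mu]_t \int[mu]_(r in [set r | D (t, r, z)]) (g (t, r, z))%:E)%E.
Proof.
refine (eq_trans int_G (eq_trans (esym (integral21_prod_meas1 iG)) _)).
apply: eq_integral => z _; refine (eq_trans (esym (integral12_prod_meas1 (iG2 z))) _).
apply: eq_integral => t _; rewrite [RHS]integral_mkcond.
by apply: eq_integral => r _; rewrite (patch_slice (fun r => (t, r, z))).
Qed.

Lemma integral_box_t : (\int[mu3]_(x in D) (g x)%:E =
  \int[mu]_z \int[mu]_r \int[mu]_(t in [set t | D (t, r, z)]) (g (t, r, z))%:E)%E.
Proof.
refine (eq_trans int_G (eq_trans (esym (integral21_prod_meas1 iG)) _)).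
apply: eq_integral => z _; refine (eq_trans (esym (integral21_prod_meas1 (iG2 z))) _).
apply: eq_integral => r _; rewrite [RHS]integral_mkcond.
by apply: eq_integral => t _; rewrite (patch_slice (fun t => (t, r, z))).
Qed.

End Slices.

(** * The function cap *)

Section Cap.
Variable R : realType.
Implicit Types q t u e k r : R.

(** This is arcosh (1 / q) - sqrt (1 - q^2), the profile of the tractrix, that is the integral of
    sqrt (1 - x^2) / x from [q] to 1. *)
Definition cap q : R := ln ((1 + Num.sqrt (1 - q ^+ 2)) / q) - Num.sqrt (1 - q ^+ 2).

Lemma cap1 : cap 1 = 0.
Proof. by rewrite /cap expr1n subrr sqrtr0 addr0 divr1 ln1 subr0. Qed.

Lemma cap_arg_gt0 q : 0 < q -> 0 < (1 + Num.sqrt (1 - q ^+ 2)) / q.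
Proof. by move=> q0; rewrite divr_gt0// ltr_pwDl// sqrtr_ge0. Qed.

Lemma continuous_cap q : 0 < q -> {for q, continuous cap}.
Proof.
by move=> q0; rewrite /cap; continuous_tac; rewrite ?gt_eqF ?cap_arg_gt0.
Qed.

Lemma derive_cap q : 0 < q < 1 ->
  is_derive q (1 : R) cap (- (Num.sqrt (1 - q ^+ 2) / q)).
Proof.
move=> /andP[q0 q1]; have s0 : 0 < 1 - q ^+ 2 by nra.
have := cap_arg_gt0 q0; rewrite /cap => a0.
derive_tac => //; first by rewrite gt_eqF.
have := sqr_sqrtr (ltW s0); have : 0 < Num.sqrt (1 - q ^+ 2) by rewrite sqrtr_gt0.
move: (Num.sqrt (1 - q ^+ 2)) => s sp s2.
by field: s2; rewrite !gt_eqF// addr_gt0.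
Qed.

(* [half_angle X Y N] is the polar angle of [(X, Y)] when [N] is its norm; unlike
   [atan (X / Y)] it is smooth across [Y = 0]. *)
Definition half_angle (X Y N : R) : R := 2 * atan (X / (N + Y)).

(** The classical derivative of a polar angle. The norm is a separate function tied to [X] and [Y]
    only at [t], so that it can be supplied without square roots; in the uses below it is a constant
    or a multiple of [apex]. *)
Lemma derive_half_angle (X Y N : R -> R) t (X' Y' N' : R) :
  is_derive t (1 : R) X X' -> is_derive t (1 : R) Y Y' -> is_derive t (1 : R) N N' ->
  0 < N t -> 0 < N t + Y t -> N t ^+ 2 = X t ^+ 2 + Y t ^+ 2 ->
  N t * N' = X t * X' + Y t * Y' ->
  is_derive t (1 : R) (fun s => half_angle (X s) (Y s) (N s))
    ((X' * Y t - X t * Y') / N t ^+ 2).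
Proof.
move=> dX dY dN N0 NY0 NXY NN'; rewrite /half_angle.
derive_tac; first by rewrite gt_eqF.
move: (X t) (Y t) (N t) N0 NY0 NXY NN' => x y n n0 ny0 nxy nn'.
have -> : N' = (x * X' + y * Y') / n by rewrite -nn' mulrC mulKf// gt_eqF.
have {}nxy : x ^+ 2 = n ^+ 2 - y ^+ 2 by rewrite nxy; ring.
have d0 : (n + y) ^+ 2 + x ^+ 2 = 2 * n * (n + y) by rewrite nxy; ring.
have -> : (1 + (x / (n + y)) ^+ 2)^-1 = (n + y) / (2 * n).
  have -> : 1 + (x / (n + y)) ^+ 2 = 2 * n / (n + y).
    by field: nxy; rewrite !gt_eqF.
  by rewrite invf_div.
by field: nxy; rewrite !gt_eqF.
Qed.

(** The primitive is strictly increasing, because positivity of [f] inside the interval makes its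
    derivative positive there. *)
Lemma strict_Rintegral_gt0 (f : R -> R) (a b : R) : a < b ->
  (forall t, a <= t <= b -> {for t, continuous f}) -> (forall t, a < t < b -> 0 < f t) ->
  0 < \int[lebesgue_measure]_(t in `[a, b]) f t.
Proof.
move=> ab fc f0.
have fw : {within `[a, b], continuous f}.
  by apply/continuous_in_subspaceT => x; rewrite inE/= in_itv/=; exact: fc.
have fi : lebesgue_measure.-integrable `[a, b] (EFin \o f).
  by apply: continuous_compact_integrable => //; exact: segment_compact.
pose F := parameterized_integral (@lebesgue_measure R) a ^~ f.
have Fa : F a = 0 by rewrite /F /parameterized_integral set_itv1 Rintegral_set1.
have dF x : x \in `]a, b[ -> derivable F x 1 /\ derive1 F x = f x.
  rewrite in_itv/= => /andP[ax xb].
  by apply: (continuous_FTC1_closed xb) => //; apply: fc; rewrite !ltW.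
rewrite -[X in X < _]Fa -/(F b).
apply: (@gtr0_derive1_lt_cc _ F a b) => //.
- by move=> x /dF[].
- by move=> x xab; have [_ ->] := dF x xab; apply: f0; move: xab; rewrite in_itv.
- exact: parameterized_integral_continuous (ltW ab) fi.
- by rewrite in_itv/= lexx ltW.
- by rewrite in_itv/= lexx ltW.
Qed.

End Cap.

(** * The scaling inequality for [cap] *)

Section CapScaling.
Variable R : realType.
Implicit Types q t u e k r : R.

Lemma derive_capE (f : R -> R) t a : 0 < f t < 1 -> is_derive t (1 : R) f a ->
  is_derive t (1 : R) (fun x => cap (f x)) (- (Num.sqrt (1 - f t ^+ 2) / f t) * a).
Proof. by move=> f01 fa; apply: derive_comp1 => //; exact: derive_cap. Qed.

Lemma continuous_capE (T : topologicalType) (x : T) (f : T -> R) : 0 < f x ->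
  {for x, continuous f} -> {for x, continuous (fun y => cap (f y))}.
Proof. by move=> f0 fx; apply: (@continuous_comp1 _ _ _ (@cap R)) => //; exact: continuous_cap. Qed.

(* With [cap (1 - x) = x * sqrt x * c x], the function [c] is increasing, and the
   claim reads [c t < c (t / u)]. *)
Lemma cap_scale_lt u t : 0 < u < 1 -> 0 < t < u ->
  cap (1 - t) < u * Num.sqrt u * cap (1 - t / u).
Proof.
move=> /andP[u0 u1] /andP[t0 tu].
(* [phi] vanishes at 0 because [cap 1 = 0], so it suffices that its derivative is positive; there
   the factor u sqrt u loses 1 / u to the inner derivative. *)
pose phi x := u * Num.sqrt u * cap (1 - x / u) - cap (1 - x).
have dphi x : 0 < x < t -> is_derive x (1 : R) phi
    (Num.sqrt u * (Num.sqrt (1 - (1 - x / u) ^+ 2) / (1 - x / u))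
     - Num.sqrt (1 - (1 - x) ^+ 2) / (1 - x)).
  move=> /andP[x0 xt]; rewrite /phi.
  have xu : x / u < 1 by rewrite ltr_pdivrMr// mul1r (lt_trans xt).
  have xu0 : 0 < x / u by rewrite divr_gt0.
  notypeclasses refine (is_derive_eq _ _).
    by repeat first [derive_step | notypeclasses refine (derive_capE _ _)];
      apply/andP; split; lra.
  cbv beta; field; lra.
have : phi 0 < phi t.
  apply: (derive_gt0_lt t0 _ dphi).
  - move=> x /andP[x0 xt].
    rewrite /phi; have xu : x / u < 1 by rewrite ltr_pdivrMr// mul1r (le_lt_trans xt).
    by repeat first [continuous_step | match goal with |- {for ?t, continuous (fun x => cap (@?f x))} =>
      refine (@continuous_capE _ t f _ _) end]; lra.
  - move=> x xt.
    move: xt => /andP[x0 xt].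
    have xu : x / u < 1 by rewrite ltr_pdivrMr// mul1r (lt_trans xt).
    have xu0 : 0 < x / u by rewrite divr_gt0.
    have xxu : x < x / u by rewrite ltr_pdivlMr// gtr_pMr.
    (* Both terms become square roots of rational functions, so that only the radicands have to be
       compared. *)
    have -> : Num.sqrt (1 - (1 - x) ^+ 2) / (1 - x)
        = Num.sqrt ((1 - (1 - x) ^+ 2) / (1 - x) ^+ 2).
      by rewrite sqrtrM ?sqrtrV ?sqr_ge0 ?sqrtr_sqr ?ger0_norm//; nra.
    rewrite mulrA -sqrtrM ?ltW//.
    have -> : Num.sqrt (u * (1 - (1 - x / u) ^+ 2)) / (1 - x / u)
        = Num.sqrt ((u * (1 - (1 - x / u) ^+ 2)) / (1 - x / u) ^+ 2).
      rewrite [RHS]sqrtrM ?sqrtrV ?sqr_ge0 ?sqrtr_sqr ?ger0_norm//; first lra.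
      by rewrite mulr_ge0 ?ltW//; nra.
    rewrite subr_gt0 ltr_sqrt; last first.
      by rewrite divr_gt0 ?exprn_gt0 ?mulr_gt0//; nra.
    rewrite ltr_pdivrMr ?exprn_gt0//; last lra.
    rewrite mulrAC ltr_pdivlMr ?exprn_gt0//; last lra.
    have uv : u * (x / u) = x by rewrite mulrC divfK// gt_eqF.
    move: (x / u) xu xu0 xxu uv => v v1 v0 xv uv.
    have -> : u * (1 - (1 - v) ^+ 2) = x * (2 - v) by rewrite -uv; ring.
    have -> : 1 - (1 - x) ^+ 2 = x * (2 - x) by ring.
    rewrite -!mulrA ltr_pM2l// -subr_gt0.
    (* The difference carries the factor [v - x], which is positive since v = x / u with u < 1. *)
    have -> : (2 - v) * (1 - x) ^+ 2 - (2 - x) * (1 - v) ^+ 2 =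
        (v - x) * ((1 - x) + (1 - v) + (1 - x) * (1 - v)) by ring.
    by rewrite mulr_gt0 ?subr_gt0// addr_gt0 ?mulr_gt0//; lra.
by rewrite /phi mul0r subr0 cap1 mulr0 subrr subr_gt0.
Qed.

End CapScaling.

(** * The integral of [cap] in the limit case *)

Section CapIntegral.
Variable R : realType.
Implicit Types r : R.
Variables k e : R.
Hypotheses (k0 : 0 < k) (e0 : 0 < e) (ke : k ^+ 2 + e ^+ 2 = 1).

Let k2 : k ^+ 2 = 1 - e ^+ 2. Proof. by rewrite -ke; ring. Qed.

Let k1 : k < 1. Proof.
by rewrite -(@ltr_pXn2r _ 2) ?nnegrE ?ltW// expr1n -ke ltrDl exprn_gt0.
Qed.
Let e1 : e < 1. Proof.
by rewrite -(@ltr_pXn2r _ 2) ?nnegrE ?ltW// expr1n -ke ltrDr exprn_gt0.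
Qed.

(** The limit of [aperture] as beta tends to 0, in a unit of length that makes the semi-major axis
    1/2. It equals 1 at the turning points (1 - e) / 2 and (1 + e) / 2, and its minimum, at r = k /
    2, is [k]. *)
Definition apex r : R := r + k ^+ 2 / (4 * r).

Lemma apex_ge r : 0 < r -> k <= apex r.
Proof.
move=> r0; rewrite -subr_ge0 /apex.
have -> : r + k ^+ 2 / (4 * r) - k = (2 * r - k) ^+ 2 / (4 * r) by field; lra.
by rewrite divr_ge0 ?sqr_ge0// mulr_ge0// ltW.
Qed.

Lemma apex_complement r : 0 < r ->
  1 - apex r = (e ^+ 2 / 4 - (r - 1 / 2) ^+ 2) / r.
Proof. by move=> r0; rewrite /apex; field: k2; lra. Qed.

Lemma apex_lt1 r : (1 - e) / 2 < r < (1 + e) / 2 -> apex r < 1.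
Proof.
move=> /andP[r1 r2]; have r0 : 0 < r by have := e1; lra.
rewrite -subr_gt0 apex_complement// divr_gt0//.
have -> : e ^+ 2 / 4 - (r - 1 / 2) ^+ 2 = (r - (1 - e) / 2) * ((1 + e) / 2 - r) by field.
by rewrite mulr_gt0 ?subr_gt0.
Qed.

Lemma apex_ends : apex ((1 - e) / 2) = 1 /\ apex ((1 + e) / 2) = 1.
Proof.
have e1' := e1; have e0' := e0.
have apexE r : 0 < r -> (r - 1 / 2) ^+ 2 = e ^+ 2 / 4 -> apex r = 1.
  move=> r0 re; apply/eqP; rewrite eq_sym -subr_eq0 apex_complement//.
  by rewrite re subrr mul0r.
by split; apply: apexE; [lra|field|lra|field].
Qed.

(** With 2 r = k exp(sigma), [y] and [x] are k cosh(sigma) and k sinh(sigma): each is r times the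
    derivative of the other, and y^2 - x^2 = k^2. Hence [s] is also sqrt (e^2 - x^2), and (y, s),
    (x, s), (x, k s) have norms 1, e and e y, the three radii used in [A]. *)
Let y r : R := apex r.
Let x r : R := r - k ^+ 2 / (4 * r).
Let s r : R := Num.sqrt (1 - y r ^+ 2).

(* An antiderivative of [cap (apex r)]: integrating by parts twice leaves
   [x ^+ 2 * sqrt (e ^+ 2 - x ^+ 2) / (x ^+ 2 + k ^+ 2)] in the variable [x]. *)
Let A r : R := r * cap (y r) + (y r * s r + half_angle (y r) (s r) 1) / 4
  + (x r * s r / 2 + (e ^+ 2 / 2 + k ^+ 2) * half_angle (x r) (s r) e
     - k * half_angle (x r) (k * s r) (e * y r)) / 2.

Let dy r : 0 < r -> is_derive r (1 : R) y (x r / r).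
Proof.
move=> r0; rewrite /y /x /apex; derive_tac; first by rewrite gt_eqF// mulr_gt0.
by field; lra.
Qed.

Let dx r : 0 < r -> is_derive r (1 : R) x (y r / r).
Proof.
move=> r0; rewrite /y /x /apex; derive_tac; first by rewrite gt_eqF// mulr_gt0.
by field; lra.
Qed.

Let cy r : 0 < r -> {for r, continuous y}.
Proof. by move=> /dy; exact: is_derive_continuous. Qed.

Let cx r : 0 < r -> {for r, continuous x}.
Proof. by move=> /dx; exact: is_derive_continuous. Qed.

Let y_gt0 r : 0 < r -> 0 < y r.
Proof. by move=> r0; apply: lt_le_trans (apex_ge r0). Qed.

Let cA r : 0 < r -> {for r, continuous A}.
Proof.
move=> r0; have cyr := cy r0; have cxr := cx r0; have y0 := y_gt0 r0.
have s_ge0 : 0 <= s r by rewrite sqrtr_ge0.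
have cs : {for r, continuous s} by rewrite /s; continuous_tac.
have cc : {for r, continuous (fun r => cap (y r))} by exact: continuous_capE.
rewrite /A /half_angle; continuous_tac.
- by rewrite gt_eqF// ltr_pwDl.
- by rewrite gt_eqF// ltr_pwDl.
- by rewrite gt_eqF// ltr_pwDl ?mulr_gt0// mulr_ge0// ltW.
Qed.

Let xy r : 0 < r -> x r ^+ 2 = y r ^+ 2 - k ^+ 2.
Proof. by move=> r0; rewrite /x /y /apex; field; lra. Qed.

Let dA r : (1 - e) / 2 < r < (1 + e) / 2 -> is_derive r (1 : R) A (cap (y r)).
Proof.
move=> hr; have r0 : 0 < r by have := e1; lra.
have y1 := apex_lt1 hr; have y0 := y_gt0 r0; have yk := apex_ge r0.
have dyr := dy r0; have dxr := dx r0; have xyr := xy r0.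
have s2 : 0 < 1 - y r ^+ 2 by rewrite subr_gt0 exprn_ilt1 ?ltW.
have s0 : 0 < s r by rewrite sqrtr_gt0.
have sE : s r ^+ 2 = 1 - y r ^+ 2 by rewrite sqr_sqrtr ?ltW.
have ds : is_derive r (1 : R) s (- (x r * y r) / (r * s r)).
  rewrite /s; derive_tac => //; rewrite -/(s r).
  by field; rewrite !gt_eqF.
have dc : is_derive r (1 : R) (fun r => cap (y r)) (- (s r / y r) * (x r / r)).
  by apply: derive_capE => //; rewrite y0.
have dh1 : is_derive r (1 : R) (fun r => half_angle (y r) (s r) 1)
    (x r / r * s r - y r * (- (x r * y r) / (r * s r))).
  have d1 := derive_const r (1 : R).
  have := derive_half_angle dyr ds d1; rewrite expr1n divr1; apply => //.
  - by rewrite addr_gt0.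
  - by rewrite sE; ring.
  - by field; rewrite !gt_eqF.
have dh2 : is_derive r (1 : R) (fun r => half_angle (x r) (s r) e)
    ((y r / r * s r - x r * (- (x r * y r) / (r * s r))) / e ^+ 2).
  have d1 := derive_const r e.
  apply: (derive_half_angle dxr ds d1) => //.
  - by rewrite addr_gt0.
  - by rewrite sE xyr -[1]ke; ring.
  - by field; rewrite !gt_eqF.
have dh3 : is_derive r (1 : R) (fun r => half_angle (x r) (k * s r) (e * y r))
    ((y r / r * (k * s r) - x r * (k * (- (x r * y r) / (r * s r)))) / (e * y r) ^+ 2).
  have d1 : is_derive r (1 : R) (fun r => e * y r) (e * (x r / r)).
    by derive_tac; ring.
  have d2 : is_derive r (1 : R) (fun r => k * s r) (k * (- (x r * y r) / (r * s r))).
    by derive_tac; ring.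
  have e2 : e ^+ 2 = 1 - k ^+ 2 by rewrite -ke; ring.
  apply: (derive_half_angle dxr d2 d1) => //.
  - by rewrite mulr_gt0.
  - by rewrite addr_gt0// mulr_gt0.
  - by rewrite !exprMn sE xyr e2; ring.
  - have -> : e * y r * (e * (x r / r)) = e ^+ 2 * y r * x r / r by ring.
    by rewrite e2; field; rewrite !gt_eqF.
rewrite /A; derive_tac.
have e2 : e ^+ 2 = 1 - k ^+ 2 by rewrite -ke; ring.
have ene : 1 - k ^+ 2 != 0 by rewrite -e2 gt_eqF// exprn_gt0.
(* Eliminating [x] and k^2 leaves a rational identity in [r], [y] and [s], modulo the quadratic
   relation [sE]. *)
have xE : x r = 2 * r - y r by rewrite /x /y /apex; field; rewrite gt_eqF.
have kE : k ^+ 2 = 4 * r * y r - 4 * r ^+ 2 by rewrite /y /apex; field; rewrite gt_eqF.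
generalize (half_angle (y r) (s r) 1) (half_angle (x r) (s r) e).
generalize (half_angle (x r) (k * s r) (e * y r)) (cap (y r)) => h1 c h2 h3.
rewrite !exprMn e2.
rewrite xE; move: sE ene kE s0 y0.
generalize (y r) (s r) => Y S sE ene kE S0 Y0.
by field: kE sE; rewrite ene !gt_eqF.
Qed.

Lemma integral_cap_apex :
  \int[lebesgue_measure]_(r in `[(1 - e) / 2, (1 + e) / 2]) cap (apex r)
  = pi * (1 - k) ^+ 2 / 4.
Proof.
have e1' := e1; have e0' := e0.
refine (etrans (@Rintegral_FTC _ (fun r => cap (apex r)) A _ _ _ _ _ _ _) _).
- lra.
- by move=> r /andP[r1 r2]; apply: continuous_capE; [apply: y_gt0|apply: cy]; lra.
- exact: dA.
- by apply: cA; lra.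
- by apply: cA; lra.
(* At both ends y = 1 and s = 0, so the terms in [cap] and in [y] cancel; since x = -e and x = e,
   the other two angles each increase by pi. *)
have [y1 y2] := apex_ends; rewrite /A /s /y y1 y2 cap1 expr1n subrr sqrtr0.
have -> : x ((1 - e) / 2) = - e.
  by move: y1; rewrite /x /apex => /(canRL (addKr _)) ->; field.
have -> : x ((1 + e) / 2) = e.
  by move: y2; rewrite /x /apex => /(canRL (addKr _)) ->; field.
rewrite /half_angle !mulr0 !addr0 !mulr1 mulNr !divff ?oner_eq0 ?gt_eqF// !atanN !atan1.
by field: k2.
Qed.

End CapIntegral.

Section CapComparison.
Variable R : realType.

Lemma continuous_itv_integrable (f : R -> R) (a b : R) :
  (forall t, a <= t <= b -> {for t, continuous f}) ->
  lebesgue_measure.-integrable `[a, b] (EFin \o f).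
Proof.
move=> fc; apply: continuous_compact_integrable; first exact: segment_compact.
by apply/continuous_in_subspaceT => x; rewrite inE/= in_itv/=; exact: fc.
Qed.

Lemma continuous_apex (k r : R) : 0 < r -> {for r, continuous (apex k)}.
Proof.
by move=> r0; rewrite /apex; continuous_tac; rewrite gt_eqF// mulr_gt0.
Qed.

(** The scaling inequality with t = 1 - apex, integrated between the turning points. As [apex] is at
    least [k], the hypothesis 1 - u < k ensures t < u, so the argument of the scaled [cap] stays
    positive. *)
Lemma integral_cap_scaled_gt (k e u : R) : 0 < k -> 0 < e -> k ^+ 2 + e ^+ 2 = 1 ->
  0 < u < 1 -> 1 - u < k ->
  pi * (1 - k) ^+ 2 / 4 < u * Num.sqrt u *
    \int[lebesgue_measure]_(r in `[(1 - e) / 2, (1 + e) / 2]) cap (1 - (1 - apex k r) / u).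
Proof.
move=> k0 e0 ke /[dup] u01 /andP[u0 u1] uk; rewrite -(integral_cap_apex k0 e0 ke).
have e1 : e < 1.
  by rewrite -(@ltr_pXn2r _ 2) ?nnegrE ?ltW// expr1n -ke ltrDr exprn_gt0.
have r_gt0 r : (1 - e) / 2 <= r <= (1 + e) / 2 -> 0 < r by move=> /andP[]; lra.
have t_lt r : 0 < r -> 1 - apex k r < u by move=> /(@apex_ge R k); lra.
pose f r := cap (1 - (1 - apex k r) / u).
have cf r : 0 < r -> {for r, continuous f}.
  move=> r0; have ca := @continuous_apex k r r0.
  apply: continuous_capE; last by continuous_tac.
  by rewrite subr_gt0 ltr_pdivrMr// mul1r t_lt.
have cg r : 0 < r -> {for r, continuous (fun r => cap (apex k r))}.
  move=> r0; apply: continuous_capE; last exact: continuous_apex.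
  exact: lt_le_trans (apex_ge _ r0).
have If := continuous_itv_integrable (fun r hr => cf r (r_gt0 r hr)).
have Ig := continuous_itv_integrable (fun r hr => cg r (r_gt0 r hr)).
rewrite -RintegralZl// -subr_gt0 -RintegralB//; last first.
  have /= := integrableZl _ (u * Num.sqrt u) If; apply => //.
apply: strict_Rintegral_gt0; first lra.
  move=> r hr; apply: continuous_add; last exact/continuous_opp/cg/r_gt0.
  by apply: continuous_mul; [exact: cst_continuous_for|exact/cf/r_gt0].
move=> r hr; rewrite subr_gt0.
have r0 : 0 < r by case/andP: hr; lra.
rewrite -{1}(subKr 1 (apex k r)); apply: cap_scale_lt => //.
by rewrite subr_gt0 (apex_lt1 k0 e0)//= t_lt.
Qed.

End CapComparison.

(** * Curves in phase space and the Hamiltonian *)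

Section Curves.
Variable R : realType.
Implicit Types x u v : 'rV[R]_4.

Lemma vec4E (a b c d : R) :
  (vec4 a b c d 0 ipr = a) * (vec4 a b c d 0 ipz = b) *
  (vec4 a b c d 0 ir = c) * (vec4 a b c d 0 iz = d).
Proof. by rewrite !mxE. Qed.

Lemma ord4P (P : 'I_4 -> Prop) : P ipr -> P ipz -> P ir -> P iz -> forall i, P i.
Proof.
move=> P0 P1 P2 P3 [[|[|[|[|n]]]] hn] //.
- by rewrite (_ : Ordinal hn = ipr) //; exact: val_inj.
- by rewrite (_ : Ordinal hn = ipz) //; exact: val_inj.
- by rewrite (_ : Ordinal hn = ir) //; exact: val_inj.
- by rewrite (_ : Ordinal hn = iz) //; exact: val_inj.
Qed.

Lemma sum_ord4 (V : nmodType) (F : 'I_4 -> V) :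
  \sum_(i < 4) F i = F ipr + F ipz + F ir + F iz.
Proof.
rewrite !big_ord_recl big_ord0 addr0 !addrA.
by congr (_ + _ + _ + _); congr F; exact: val_inj.
Qed.

Lemma pairingE u v : pairing u v =
  u 0 ipr * v 0 ipr + u 0 ipz * v 0 ipz + u 0 ir * v 0 ir + u 0 iz * v 0 iz.
Proof. exact: sum_ord4. Qed.

Lemma derive_rowP (c : R -> 'rV[R]_4) t v :
  (forall i, is_derive t (1 : R) (fun s => c s 0 i) (v 0 i)) -> is_derive t (1 : R) c v.
Proof.
move=> cv; have cd : derivable c t 1.
  by apply/derivable_mxP => i j; rewrite ord1; have [] := cv j.
split => //; apply/rowP => i; rewrite derive_mx// mxE.
by have [_ ->] := cv i.
Qed.

Lemma derive_row_coord (c : R -> 'rV[R]_4) t v i :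
  is_derive t (1 : R) c v -> is_derive t (1 : R) (fun s => c s 0 i) (v 0 i).
Proof.
move=> [cd cv]; split; first by move/derivable_mxP : cd; exact.
by rewrite -cv derive_mx// mxE.
Qed.

Lemma derive_vec4 (a b c d : R -> R) t (a' b' c' d' : R) :
  is_derive t (1 : R) a a' -> is_derive t (1 : R) b b' ->
  is_derive t (1 : R) c c' -> is_derive t (1 : R) d d' ->
  is_derive t (1 : R) (fun s => vec4 (a s) (b s) (c s) (d s)) (vec4 a' b' c' d').
Proof.
move=> da db dc dd; apply: derive_rowP; apply: ord4P; rewrite vec4E.
- by rewrite (_ : (fun s => _) = a)//; apply/funext => s; rewrite vec4E.
- by rewrite (_ : (fun s => _) = b)//; apply/funext => s; rewrite vec4E.
- by rewrite (_ : (fun s => _) = c)//; apply/funext => s; rewrite vec4E.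
- by rewrite (_ : (fun s => _) = d)//; apply/funext => s; rewrite vec4E.
Qed.

Lemma continuous_rowP (T : topologicalType) (c : T -> 'rV[R]_4) t :
  (forall i, {for t, continuous (fun s => c s 0 i)}) -> {for t, continuous c}.
Proof.
move=> cc; apply/cvgrPdist_lt => e e0; near=> s.
rewrite /Num.Def.normr/= mx_normrE; apply/bigmax_ltP; split => // -[i j] _.
rewrite !mxE ord1 /=; move: j; near: s; apply: filter_forall => j.
exact: ((cvgrPdist_lt _ _).1 (cc j)).
Unshelve. all: by end_near. Qed.

Lemma continuous_vec4 (T : topologicalType) (a b c d : T -> R) t :
  {for t, continuous a} -> {for t, continuous b} -> {for t, continuous c} ->
  {for t, continuous d} ->
  {for t, continuous (fun s => vec4 (a s) (b s) (c s) (d s))}.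
Proof.
move=> ca cb cc cd; apply: continuous_rowP; apply: ord4P.
- by rewrite (_ : (fun s => _) = a)//; apply/funext => s; rewrite vec4E.
- by rewrite (_ : (fun s => _) = b)//; apply/funext => s; rewrite vec4E.
- by rewrite (_ : (fun s => _) = c)//; apply/funext => s; rewrite vec4E.
- by rewrite (_ : (fun s => _) = d)//; apply/funext => s; rewrite vec4E.
Qed.

(** Restriction to a line turns a directional derivative into one of a real variable, to which
    [derive_tac] applies. *)
Lemma derive_line (W : normedModType R) (f : 'rV[R]_4 -> W) x v :
  'D_v f x = 'D_(1 : R) (fun h : R => f (h *: v + x)) 0.
Proof.
rewrite /derive; apply: (congr1 (fun F : R -> W => lim (F @ 0^'))); apply/funext => h /=.
by rewrite scale0r add0r addr0 /GRing.scale/= mulr1.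
Qed.

Lemma derive_linear_combination (f : 'rV[R]_4 -> 'rV[R]_4) x v : differentiable f x ->
  'D_v f x = \sum_(j < 4) v 0 j *: 'D_(delta_mx 0 j) f x.
Proof.
move=> fd; rewrite deriveE// [v in LHS]row_sum_delta linear_sum.
by apply: eq_bigr => j _; rewrite linearZ/= deriveE.
Qed.

Lemma derive_along (f : 'rV[R]_4 -> 'rV[R]_4) (c : R -> 'rV[R]_4) t v i :
  differentiable f (c t) -> is_derive t (1 : R) c v ->
  is_derive t (1 : R) (fun s => f (c s) 0 i)
    (v 0 ipr * ('D_(delta_mx 0 ipr) f (c t)) 0 i + v 0 ipz * ('D_(delta_mx 0 ipz) f (c t)) 0 i
   + v 0 ir * ('D_(delta_mx 0 ir) f (c t)) 0 i + v 0 iz * ('D_(delta_mx 0 iz) f (c t)) 0 i).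
Proof.
move=> fd [cd cv]; have cdiff : differentiable c t by apply/derivable1_diffP.
have fcd : differentiable (f \o c) t by exact: differentiable_comp.
have dfc : is_derive t (1 : R) (f \o c) ('D_v f (c t)).
  split; first exact/derivable1_diffP.
  have cv' : 'd c t (1 : R) = v by rewrite -deriveE.
  rewrite deriveE// (diff_comp cdiff fd) [LHS]/= cv'; exact/esym/deriveE.
apply: (is_derive_eq (derive_row_coord i dfc)).
rewrite derive_linear_combination// summxE sum_ord4.
have scaleE (a : R) (M : 'rV[R]_4) : (a *: M) 0 i = a * M 0 i by rewrite mxE.
by congr (_ + _ + _ + _); exact: scaleE.
Qed.

End Curves.

Section Hamiltonian.
Variable R : realType.
Variables beta ecc : R.
Hypotheses (hbeta : 0 < beta < 1) (hecc : 0 < ecc < 1).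

Local Notation alpha := (alpha_of beta).
Local Notation varpi := (varpi_of beta ecc).
Local Notation H := (@Ham R beta ecc).

Definition stretch : R := 1 + 2 * alpha.
Definition pull : R := (1 - beta) / beta.
Definition dist (r z : R) : R := Num.sqrt (r ^+ 2 + stretch * z ^+ 2).
Definition kinetic (r z : R) : R := - 1 - potential alpha varpi r z.
(** The two partial derivatives of [kinetic]; by Hamilton's equations they are the time derivatives
    of the momenta. *)
Definition force_r (r z : R) : R :=
  - (pull * r / dist r z ^+ 3) - (1 / r ^+ 2 - varpi ^+ 2 / r ^+ 3).
Definition force_z (r z : R) : R := - (pull * stretch * z / dist r z ^+ 3).

Lemma alpha_gt0 : 0 < alpha.
Proof.
by have /andP[b0 b1] := hbeta; rewrite /alpha_of divr_gt0 ?mulr_gt0// subr_gt0.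
Qed.

Lemma stretchE : stretch = (1 + 7 * beta) / (1 - beta).
Proof. by have /andP[b0 b1] := hbeta; rewrite /stretch /alpha_of; field; lra. Qed.

Lemma stretch_gt0 : 0 < stretch.
Proof. by have := alpha_gt0; rewrite /stretch; lra. Qed.

Lemma pull_gt0 : 0 < pull.
Proof. by have /andP[b0 b1] := hbeta; rewrite /pull divr_gt0// subr_gt0. Qed.

Lemma pullE : 4 / alpha = pull.
Proof. by have /andP[b0 b1] := hbeta; rewrite /pull /alpha_of; field; lra. Qed.

Lemma varpi_sqr : varpi ^+ 2 = (1 - ecc ^+ 2) / (2 * beta ^+ 2).
Proof.
have /andP[e0 e1] := hecc; have /andP[b0 b1] := hbeta.
rewrite /varpi_of expr_div_n exprMn !sqr_sqrtr//.
by rewrite subr_ge0 exprn_ile1 ?ltW.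
Qed.

Lemma dist_arg_gt0 (r z : R) : 0 < r -> 0 < r ^+ 2 + stretch * z ^+ 2.
Proof.
by move=> r0; rewrite ltr_pwDl ?exprn_gt0// mulr_ge0 ?sqr_ge0 ?ltW ?stretch_gt0.
Qed.

Lemma dist_gt0 (r z : R) : 0 < r -> 0 < dist r z.
Proof. by move=> r0; rewrite sqrtr_gt0 dist_arg_gt0. Qed.

Lemma dist_sqr (r z : R) : 0 < r -> dist r z ^+ 2 = r ^+ 2 + stretch * z ^+ 2.
Proof. by move=> r0; rewrite sqr_sqrtr// ltW// dist_arg_gt0. Qed.

Definition barrier (r : R) : R := 1 + varpi ^+ 2 / (2 * r ^+ 2) - 1 / r.

Lemma kineticE (r z : R) : kinetic r z = pull / dist r z - barrier r.
Proof.
rewrite /kinetic /potential /barrier -/stretch -/(dist r z) -pullE.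
have -> : 4 / alpha / dist r z = 4 / (alpha * dist r z) by rewrite -mulrA -invfM.
ring.
Qed.

Lemma derive_kinetic (r z : R -> R) t (r' z' : R) : 0 < r t ->
  is_derive t (1 : R) r r' -> is_derive t (1 : R) z z' ->
  is_derive t (1 : R) (fun s => kinetic (r s) (z s))
    (force_r (r t) (z t) * r' + force_z (r t) (z t) * z').
Proof.
move=> r0 dr dz; have a0 := alpha_gt0; have q0 := dist_arg_gt0 (z t) r0.
have d0 := dist_gt0 (z t) r0.
rewrite /kinetic /potential; derive_tac => //; rewrite -?/stretch -?/(dist _ _).
- by rewrite gt_eqF// mulr_gt0// exprn_gt0.
- by rewrite gt_eqF.
- by rewrite gt_eqF// mulr_gt0.
rewrite /force_r /force_z -pullE -!/(dist _ _).
by field; rewrite !gt_eqF.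
Qed.

Lemma continuous_dist (T : topologicalType) (r z : T -> R) t :
  {for t, continuous r} -> {for t, continuous z} ->
  {for t, continuous (fun s => dist (r s) (z s))}.
Proof. by move=> cr cz; rewrite /dist; continuous_tac. Qed.

Lemma continuous_kinetic (T : topologicalType) (r z : T -> R) t : 0 < r t ->
  {for t, continuous r} -> {for t, continuous z} ->
  {for t, continuous (fun s => kinetic (r s) (z s))}.
Proof.
move=> r0 cr cz; have d0 := dist_gt0 (z t) r0; have cd := continuous_dist cr cz.
rewrite (_ : (fun s => _) = fun s => pull * (dist (r s) (z s))^-1 -
  (1 + varpi ^+ 2 * (2 * r s ^+ 2)^-1 - (r s)^-1)); last first.
  by apply/funext => s; rewrite kineticE /barrier div1r.
by continuous_tac; rewrite ?mulf_neq0 ?expf_neq0 ?pnatr_eq0 ?gt_eqF.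
Qed.

Lemma continuous_force_r (T : topologicalType) (r z : T -> R) t : 0 < r t ->
  {for t, continuous r} -> {for t, continuous z} ->
  {for t, continuous (fun s => force_r (r s) (z s))}.
Proof.
move=> r0 cr cz; have d0 := dist_gt0 (z t) r0; have cd := continuous_dist cr cz.
rewrite /force_r (_ : (fun s => _) = fun s => - (pull * r s * (dist (r s) (z s) ^+ 2
  * dist (r s) (z s))^-1) - ((r s ^+ 2)^-1 - varpi ^+ 2 * (r s ^+ 2 * r s)^-1)).
  by continuous_tac; rewrite ?mulf_neq0 ?expf_neq0 ?gt_eqF.
by apply/funext => s; rewrite -!exprSr div1r.
Qed.

Lemma continuous_force_z (T : topologicalType) (r z : T -> R) t : 0 < r t ->
  {for t, continuous r} -> {for t, continuous z} ->
  {for t, continuous (fun s => force_z (r s) (z s))}.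
Proof.
move=> r0 cr cz; have d0 := dist_gt0 (z t) r0; have cd := continuous_dist cr cz.
rewrite /force_z (_ : (fun s => _) = fun s => - (pull * stretch * z s *
  (dist (r s) (z s) ^+ 2 * dist (r s) (z s))^-1)).
  by continuous_tac; rewrite ?mulf_neq0 ?expf_neq0 ?gt_eqF.
by apply/funext => s; rewrite -!exprSr.
Qed.

Lemma HamE (x : 'rV[R]_4) :
  H x = (x 0 ipr ^+ 2 + x 0 ipz ^+ 2) / 2 - 1 - kinetic (x 0 ir) (x 0 iz).
Proof. by rewrite /Ham /hamiltonian /kinetic; ring. Qed.

Lemma derive_Ham (x v : 'rV[R]_4) : 0 < x 0 ir ->
  'D_v H x = x 0 ipr * v 0 ipr + x 0 ipz * v 0 ipz
    - force_r (x 0 ir) (x 0 iz) * v 0 ir - force_z (x 0 ir) (x 0 iz) * v 0 iz.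
Proof.
move=> r0; rewrite derive_line.
rewrite (_ : (fun h : R => _) = fun h : R =>
  ((h * v 0 ipr + x 0 ipr) ^+ 2 + (h * v 0 ipz + x 0 ipz) ^+ 2) / 2 - 1
  - kinetic (h * v 0 ir + x 0 ir) (h * v 0 iz + x 0 iz)); last first.
  by apply/funext => h; rewrite HamE !mxE.
have d1 i : is_derive (0 : R) (1 : R) (fun h => h * v 0 i + x 0 i) (v 0 i).
  by derive_tac; ring.
have r0' : 0 < (fun h => h * v 0 ir + x 0 ir) 0 by rewrite mul0r add0r.
have dk := @derive_kinetic (fun h => h * v 0 ir + x 0 ir) (fun h => h * v 0 iz + x 0 iz)
  0 _ _ r0' (d1 ir) (d1 iz).
have [d2 d3 ] := (d1 ipr, d1 ipz).
have D : is_derive (0 : R) (1 : R) (fun h : R =>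
  ((h * v 0 ipr + x 0 ipr) ^+ 2 + (h * v 0 ipz + x 0 ipz) ^+ 2) / 2 - 1
  - kinetic (h * v 0 ir + x 0 ir) (h * v 0 iz + x 0 iz))
  (x 0 ipr * v 0 ipr + x 0 ipz * v 0 ipz
    - force_r (x 0 ir) (x 0 iz) * v 0 ir - force_z (x 0 ir) (x 0 iz) * v 0 iz).
  by derive_tac; rewrite !mul0r !add0r; field.
by have [_ ->] := D.
Qed.

Lemma ham_fieldE (x : 'rV[R]_4) : 0 < x 0 ir ->
  ham_field H x =
  vec4 (force_r (x 0 ir) (x 0 iz)) (force_z (x 0 ir) (x 0 iz)) (x 0 ipr) (x 0 ipz).
Proof.
move=> r0; rewrite /ham_field /partial !derive_Ham// !mxE/= !mulr0 !mulr1.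
by congr vec4; ring.
Qed.

Lemma surfaceE (x : 'rV[R]_4) : surface beta ecc x <->
  0 < x 0 ir /\ x 0 ipr ^+ 2 + x 0 ipz ^+ 2 = 2 * kinetic (x 0 ir) (x 0 iz).
Proof. by rewrite /surface/= HamE; split=> -[-> h]; split => //; lra. Qed.

End Hamiltonian.

(** * Coordinates of the adapted contact form *)

Section AdaptedForm.
Variable R : realType.
Variables beta ecc : R.
Variable lam : 'rV[R]_4 -> 'rV[R]_4.
Hypotheses (hbeta : 0 < beta < 1) (hecc : 0 < ecc < 1).
Hypothesis hlam : adapted_contact_form beta ecc lam.

Local Notation M := (surface beta ecc).

Definition jac (j i : 'I_4) (x : 'rV[R]_4) : R := ('D_(delta_mx 0 j) lam x) 0 i.

Lemma adapted_C1 x : M x -> differentiable lam x /\ forall v, {for x, continuous ('D_v lam)}.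
Proof.
move=> Mx; have [[U [oU MU Us]] _ _ _] := hlam.
have [Ud _] := Us 1%N; split; first exact/Ud/MU.
by move=> v; have [_ /(_ v)/(_ x (MU _ Mx))] := Us 1%N.
Qed.

Lemma continuous_form_comp (T : topologicalType) (c : T -> 'rV[R]_4) t i :
  M (c t) -> {for t, continuous c} -> {for t, continuous (fun s => lam (c s) 0 i)}.
Proof.
move=> Mc cc; have [ld _] := adapted_C1 Mc.
have cl : {for t, continuous (fun s => lam (c s))}.
  by apply: (@continuous_comp _ _ _ c lam) => //; exact: differentiable_continuous.
by apply: (@continuous_comp _ _ _ (fun s => lam (c s)) (fun N : 'rV[R]_4 => N 0 i)) => //;
  exact: coord_continuous.
Qed.

Lemma continuous_jac_comp (T : topologicalType) (c : T -> 'rV[R]_4) t j i :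
  M (c t) -> {for t, continuous c} -> {for t, continuous (fun s => jac j i (c s))}.
Proof.
move=> Mc cc; have [_ ld] := adapted_C1 Mc.
have cl : {for t, continuous (fun s => 'D_(delta_mx 0 j) lam (c s))}.
  by apply: (@continuous_comp _ _ _ c ('D_(delta_mx 0 j) lam)) => //; exact: ld.
by apply: (@continuous_comp _ _ _ (fun s => 'D_(delta_mx 0 j) lam (c s))
  (fun N : 'rV[R]_4 => N 0 i)) => //; exact: coord_continuous.
Qed.

Lemma derive_form_comp (c : R -> 'rV[R]_4) t (a b p q : R) i :
  M (c t) -> is_derive t (1 : R) c (vec4 a b p q) ->
  is_derive t (1 : R) (fun s => lam (c s) 0 i)
    (a * jac ipr i (c t) + b * jac ipz i (c t) + p * jac ir i (c t) + q * jac iz i (c t)).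
Proof.
move=> Mc dc; have [ld _] := adapted_C1 Mc.
by apply: (is_derive_eq (derive_along i ld dc)); rewrite !vec4E.
Qed.

Lemma derive_form_coord x v i : M x -> ('D_v lam x) 0 i =
  v 0 ipr * jac ipr i x + v 0 ipz * jac ipz i x + v 0 ir * jac ir i x + v 0 iz * jac iz i x.
Proof.
move=> Mx; have [ld _] := adapted_C1 Mx.
rewrite derive_linear_combination// summxE sum_ord4.
have scaleE (a : R) (B : 'rV[R]_4) : (a *: B) 0 i = a * B 0 i by rewrite mxE.
by congr (_ + _ + _ + _); exact: scaleE.
Qed.

(** The condition d lam = omega, written with the six antisymmetrized first derivatives of [lam] for
    two vectors given by coordinates. The two equations are the tangency of these vectors; in this
    shape the condition can be fed to [ring] and [field]. *)
Lemma adapted_closed_coord x (a b c d a' b' c' d' : R) : M x ->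
  x 0 ipr * a + x 0 ipz * b - force_r beta ecc (x 0 ir) (x 0 iz) * c
    - force_z beta (x 0 ir) (x 0 iz) * d = 0 ->
  x 0 ipr * a' + x 0 ipz * b' - force_r beta ecc (x 0 ir) (x 0 iz) * c'
    - force_z beta (x 0 ir) (x 0 iz) * d' = 0 ->
  (a * b' - b * a') * (jac ipr ipz x - jac ipz ipr x)
  + (a * c' - c * a') * (jac ipr ir x - jac ir ipr x)
  + (a * d' - d * a') * (jac ipr iz x - jac iz ipr x)
  + (b * c' - c * b') * (jac ipz ir x - jac ir ipz x)
  + (b * d' - d * b') * (jac ipz iz x - jac iz ipz x)
  + (c * d' - d * c') * (jac ir iz x - jac iz ir x)
  = (a * c' - c * a') + (b * d' - d * b').
Proof.
move=> Mx E1 E2.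
have [_ _ closed _] := hlam; have r0 : 0 < x 0 ir by case: Mx.
have tangentP (w : 'rV[R]_4) : x 0 ipr * w 0 ipr + x 0 ipz * w 0 ipz
    - force_r beta ecc (x 0 ir) (x 0 iz) * w 0 ir
    - force_z beta (x 0 ir) (x 0 iz) * w 0 iz = 0 -> tangent beta ecc x w.
  by move=> E; exact: etrans (derive_Ham ecc hbeta w r0) E.
have {closed} := closed x (vec4 a b c d) (vec4 a' b' c' d') Mx.
have tu : tangent beta ecc x (vec4 a b c d) by apply: tangentP; rewrite !vec4E.
have tv : tangent beta ecc x (vec4 a' b' c' d') by apply: tangentP; rewrite !vec4E.
move=> /(_ tu tv); rewrite /ext_d.
have := fun i => derive_form_coord (vec4 a b c d) i Mx.
have := fun i => derive_form_coord (vec4 a' b' c' d') i Mx.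
generalize ('D_(vec4 a b c d) lam x) ('D_(vec4 a' b' c' d') lam x) => P Q QE PE.
rewrite /omega !pairingE !PE !QE !vec4E => <-.
generalize (jac ipr ipr x) (jac ipr ipz x) (jac ipr ir x) (jac ipr iz x)
  (jac ipz ipr x) (jac ipz ipz x) (jac ipz ir x) (jac ipz iz x)
  (jac ir ipr x) (jac ir ipz x) (jac ir ir x) (jac ir iz x)
  (jac iz ipr x) (jac iz ipz x) (jac iz ir x) (jac iz iz x).
by move=> *; ring.
Qed.

End AdaptedForm.

(** * The contact volume *)

Section IntervalSections.
Variable R : realType.
Local Notation mu := (@lebesgue_measure R).

Lemma closure_inf (A : set R) : A !=set0 -> has_lbound A -> closure A (inf A).
Proof.
move=> A0 lA; rewrite -[inf A]opprK => U /nbhs_ballP[e /= e0 eU].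
have [x Ax xe] : exists2 x, A x & x < inf A + e.
  by apply: inf_lt => //; rewrite ltrDl.
exists x; split => //; apply: eU; rewrite /ball/= opprK distrC ger0_norm; first lra.
by rewrite subr_ge0 (ge_inf lA).
Qed.

Lemma open_interval_bounded (O : set R) (B : R) : open O -> is_interval O ->
  (forall x, O x -> `|x| <= B) -> O !=set0 ->
  exists a b : R, [/\ a < b, O = `]a, b[%classic, closure O a & closure O b].
Proof.
move=> oO iO bO O0.
have ubO : has_ubound O by exists B => x /bO; rewrite ler_norml => /andP[].
have lbO : has_lbound O by exists (- B) => x /bO; rewrite ler_norml => /andP[].
have clinf : closure O (inf O) by exact: closure_inf.
have clsup : closure O (sup O) by exact: closure_sup.
have notinf : ~ O (inf O).
  move=> Oi; have /nbhs_ballP[e /= e0 be] := open_nbhs_nbhs (conj oO Oi).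
  have : O (inf O - e / 2).
    by apply: be; rewrite /ball/= opprB addrCA subrr addr0 gtr0_norm; lra.
  move=> /(ge_inf lbO); lra.
have notsup : ~ O (sup O).
  move=> Os; have /nbhs_ballP[e /= e0 be] := open_nbhs_nbhs (conj oO Os).
  have : O (sup O + e / 2).
    by apply: be; rewrite /ball/= opprD addrA subrr add0r normrN gtr0_norm; lra.
  move=> /(ub_le_sup ubO); lra.
have OE : O = `]inf O, sup O[%classic.
  apply/seteqP; split => x /=; rewrite in_itv/=.
    move=> Ox; rewrite !lt_neqAle (ge_inf lbO Ox) (ub_le_sup ubO Ox) !andbT.
    by apply/andP; split; apply/eqP => E; [apply: notinf; rewrite E|apply: notsup; rewrite -E].
  move=> /andP[ix xs].
  have [y Oy yx] := inf_lt O0 ix; have [z Oz xz] := sup_gt O0 xs.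
  by apply: (iO y z) => //; rewrite !ltW.
exists (inf O), (sup O); split => //.
have [x] := O0; rewrite {1}OE/= in_itv/= => /andP[]; exact: lt_trans.
Qed.

Lemma integral_FTC_oo (f F : R -> R) (a b : R) : a < b ->
  (forall t, a <= t <= b -> {for t, continuous f}) ->
  (forall t, a < t < b -> is_derive t (1 : R) F (f t)) ->
  {for a, continuous F} -> {for b, continuous F} ->
  (\int[mu]_(x in `]a, b[) (f x)%:E = (F b - F a)%:E)%E.
Proof.
move=> ab fc Ff Fa Fb.
have fw : {within `[a, b], continuous f}.
  by apply/continuous_in_subspaceT => x; rewrite inE/= in_itv/=; exact: fc.
rewrite -(@integral_itv_bndoo _ _ _ _ true false); last first.
  apply/measurable_EFinP; apply: open_continuous_measurable_fun.
    exact: interval_open.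
  by move=> x; rewrite inE/= in_itv/= => /andP[ax xb]; apply: fc; rewrite !ltW.
rewrite (continuous_FTC2 ab fw (F := F)) ?EFinB//.
- split; [|exact: cvg_at_right_filter|exact: cvg_at_left_filter].
  by move=> x; rewrite in_itv/= => /Ff [].
- by move=> x; rewrite in_itv/= => /Ff [_]; rewrite derive1E.
Qed.

(** The endpoints of the interval [O] are closure points outside [O], where [Q] vanishes. Conditions
    imposed on the whole closure make it unnecessary to know the endpoints. *)
Lemma integral_section_derivative (O : set R) (B : R) (f Q : R -> R) :
  open O -> is_interval O -> (forall x, O x -> `|x| <= B) ->
  (forall a, closure O a ->
    [/\ {for a, continuous f}, {for a, continuous Q} & (~ O a -> Q a = 0)]) ->
  (forall x, O x -> is_derive x (1 : R) Q (f x)) ->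
  (\int[mu]_(x in O) (f x)%:E = 0)%E.
Proof.
move=> oO iO bO cO dO; have [ne|/set0P/negP/negPn/eqP ->] := pselect (O !=set0); last first.
  by rewrite integral_set0.
have [a [b [ab OE cla clb]]] := open_interval_bounded oO iO bO ne.
have [fa Qa Q0a] := cO a cla; have [fb Qb Q0b] := cO b clb.
have in_O x : a < x < b -> O x by move=> h; rewrite OE/= in_itv.
have cf x : a <= x <= b -> {for x, continuous f}.
  move=> /andP[]; rewrite le_eqVlt => /predU1P[<- _ //|ax].
  rewrite le_eqVlt => /predU1P[-> //|xb].
  by have [] := cO x (subset_closure (in_O _ (introT andP (conj ax xb)))).
rewrite [X in integral _ X]OE; have dQ x (h : a < x < b) := dO x (in_O x h).
refine (etrans (integral_FTC_oo ab cf dQ Qa Qb) _).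
have nO x : ~ (a < x < b) -> ~ O x by rewrite OE/= in_itv.
by rewrite Q0a ?Q0b ?subrr//; apply: nO; rewrite ltxx ?andbF.
Qed.

End IntervalSections.

(** * The volume density in the chart *)

Section Chart.
Variable R : realType.
Variables beta ecc : R.
Variable lam : 'rV[R]_4 -> 'rV[R]_4.
Hypotheses (hbeta : 0 < beta < 1) (hecc : 0 < ecc < 1).
Hypothesis hlam : adapted_contact_form beta ecc lam.

Local Notation M := (surface beta ecc).
Local Notation w := (kinetic beta ecc).
Local Notation wr := (force_r beta ecc).
Local Notation wz := (force_z beta).
Local Notation X := (chart beta ecc).

Definition speed (r z : R) : R := Num.sqrt (2 * w r z).

Lemma chartE t r z : X t r z = vec4 (speed r z * cos t) (speed r z * sin t) r z.
Proof. by []. Qed.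

Lemma speed_sqr r z : 0 <= w r z -> speed r z ^+ 2 = 2 * w r z.
Proof. by move=> w0; rewrite sqr_sqrtr// mulr_ge0. Qed.

Lemma chart_surface t r z : 0 < r -> 0 <= w r z -> M (X t r z).
Proof.
move=> r0 w0; apply/surfaceE; rewrite chartE !vec4E; split => //.
by rewrite !exprMn -mulrDr cos2Dsin2 mulr1 speed_sqr.
Qed.

Lemma continuous_speed (T : topologicalType) (r z : T -> R) s : 0 < r s ->
  {for s, continuous r} -> {for s, continuous z} ->
  {for s, continuous (fun x => speed (r x) (z x))}.
Proof.
move=> r0 cr cz; have cw : {for s, continuous (fun x => w (r x) (z x))} by exact: continuous_kinetic.
by rewrite /speed; continuous_tac.
Qed.

Lemma continuous_chart (T : topologicalType) (t r z : T -> R) s : 0 < r s ->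
  {for s, continuous t} -> {for s, continuous r} -> {for s, continuous z} ->
  {for s, continuous (fun x => X (t x) (r x) (z x))}.
Proof.
move=> r0 ct cr cz; have cs := continuous_speed r0 cr cz.
rewrite (_ : (fun x => X _ _ _) = fun x => vec4 (speed (r x) (z x) * cos (t x))
  (speed (r x) (z x) * sin (t x)) (r x) (z x))//.
by apply: continuous_vec4; continuous_tac.
Qed.

Lemma derive_speed (r z : R -> R) s (r' z' : R) : 0 < r s -> 0 < w (r s) (z s) ->
  is_derive s (1 : R) r r' -> is_derive s (1 : R) z z' ->
  is_derive s (1 : R) (fun x => speed (r x) (z x))
    ((wr (r s) (z s) * r' + wz (r s) (z s) * z') / speed (r s) (z s)).
Proof.
move=> r0 w0 dr dz; have dw : is_derive s (1 : R) (fun x => w (r x) (z x)) _ := derive_kinetic ecc hbeta r0 dr dz.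
have s0 : 0 < speed (r s) (z s) by rewrite sqrtr_gt0 mulr_gt0.
rewrite /speed; derive_tac; first by rewrite mulr_gt0.
rewrite -/(speed _ _); move: (speed _ _) s0 => v v0.
by field; rewrite gt_eqF.
Qed.

Lemma derive_chart_t t r z : is_derive t (1 : R) (fun x => X x r z)
  (vec4 (- (speed r z * sin t)) (speed r z * cos t) 0 0).
Proof.
rewrite (_ : (fun x => X x r z) = fun x => vec4 (speed r z * cos x) (speed r z * sin x) r z)//.
notypeclasses refine (derive_vec4 _ _ _ _); [derive_tac; ring|derive_tac; ring|exact: derive_const|exact: derive_const].
Qed.

Lemma derive_chart_r t r z : 0 < r -> 0 < w r z -> is_derive r (1 : R) (fun x => X t x z)
  (vec4 (wr r z / speed r z * cos t) (wr r z / speed r z * sin t) 1 0).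
Proof.
move=> r0 w0; have := @derive_speed (fun x => x) (fun=> z) r 1 0 r0 w0 (derive_idfun r)
  (derive_const r z); rewrite mulr1 mulr0 addr0 => ds.
rewrite (_ : (fun x => X t x z) = fun x => vec4 (speed x z * cos t) (speed x z * sin t) x z)//.
notypeclasses refine (derive_vec4 _ _ _ _); [derive_tac; ring|derive_tac; ring|exact: derive_idfun|exact: derive_const].
Qed.

Lemma derive_chart_z t r z : 0 < r -> 0 < w r z -> is_derive z (1 : R) (fun x => X t r x)
  (vec4 (wz r z / speed r z * cos t) (wz r z / speed r z * sin t) 0 1).
Proof.
move=> r0 w0; have := @derive_speed (fun=> r) (fun x => x) z 0 1 r0 w0 (derive_const z r)
  (derive_idfun z); rewrite mulr1 mulr0 add0r => ds.
rewrite (_ : (fun x => X t r x) = fun x => vec4 (speed r x * cos t) (speed r x * sin t) r x)//.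
notypeclasses refine (derive_vec4 _ _ _ _); [derive_tac; ring|derive_tac; ring|exact: derive_const|exact: derive_idfun].
Qed.

Local Notation l i t r z := (lam (X t r z) 0 i).
Local Notation g j i t r z := (jac lam j i (X t r z)).

(* The value of the form on the Hamiltonian vector field. *)
Definition form_flow t r z : R :=
  wr r z * l ipr t r z + wz r z * l ipz t r z
  + speed r z * (cos t * l ir t r z + sin t * l iz t r z).

(** On the three-dimensional tangent space omega is degenerate exactly along the Hamiltonian field,
    so lam /\ omega sees [lam] only through its value on that field. *)
Lemma wedge_chart t r z : 0 < r -> 0 < w r z ->
  wedge_d lam (X t r z) (derive1 (fun x => X x r z) t) (derive1 (fun x => X t x z) r)
    (derive1 (fun x => X t r x) z) = - form_flow t r z.
Proof.
move=> r0 w0; rewrite !derive1E.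
have [_ ->] := derive_chart_t t r z; have [_ ->] := derive_chart_r t r0 w0.
have [_ ->] := derive_chart_z t r0 w0.
have MX := chart_surface t r0 (ltW w0).
have s0 : 0 < speed r z by rewrite sqrtr_gt0 mulr_gt0.
have [_ _ closed _] := hlam.
have tangentP a b c d : speed r z * cos t * a + speed r z * sin t * b - wr r z * c
    - wz r z * d = 0 -> tangent beta ecc (X t r z) (vec4 a b c d).
  move=> E; have r0' : 0 < X t r z 0 ir by rewrite chartE !vec4E.
  apply: (etrans (derive_Ham ecc hbeta (vec4 a b c d) r0')).
  by rewrite chartE !vec4E.
have c2 : cos t ^+ 2 = 1 - sin t ^+ 2 by rewrite -(cos2Dsin2 t) addrK.
have tt : tangent beta ecc (X t r z) (vec4 (- (speed r z * sin t)) (speed r z * cos t) 0 0).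
  by apply: tangentP; ring.
have tr : tangent beta ecc (X t r z)
    (vec4 (wr r z / speed r z * cos t) (wr r z / speed r z * sin t) 1 0).
  by apply: tangentP; field: c2; rewrite gt_eqF.
have tz : tangent beta ecc (X t r z)
    (vec4 (wz r z / speed r z * cos t) (wz r z / speed r z * sin t) 0 1).
  by apply: tangentP; field: c2; rewrite gt_eqF.
rewrite /wedge_d (closed _ _ _ MX tr tz) (closed _ _ _ MX tz tt) (closed _ _ _ MX tt tr).
rewrite /omega !pairingE !vec4E /form_flow.
generalize (l ipr t r z) (l ipz t r z) (l ir t r z) (l iz t r z) => l1 l2 l3 l4.
by field: c2; rewrite gt_eqF.
Qed.

End Chart.

(** * The density as an energy term plus a divergence *)

Section Flux.
Variable R : realType.
Variables beta ecc : R.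
Variable lam : 'rV[R]_4 -> 'rV[R]_4.
Hypotheses (hbeta : 0 < beta < 1) (hecc : 0 < ecc < 1).
Hypothesis hlam : adapted_contact_form beta ecc lam.

Local Notation M := (surface beta ecc).
Local Notation w := (kinetic beta ecc).
Local Notation wr := (force_r beta ecc).
Local Notation wz := (force_z beta).
Local Notation X := (chart beta ecc).
Local Notation v := (speed beta ecc).
Local Notation l i t r z := (lam (X t r z) 0 i).
Local Notation g j i t r z := (jac lam j i (X t r z)).

(** The momentum part of [lam] in polar form. Here [v * angular] is [lam] on the chart vector of
    [t], [angular_jac i] is the derivative of the coefficient [i] along that vector, and
    [radial_jac i] its derivative in the direction of the momentum. *)
Definition angular t r z : R := cos t * l ipz t r z - sin t * l ipr t r z.
Definition radial t r z : R := cos t * l ipr t r z + sin t * l ipz t r z.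
Definition angular_jac i t r z : R := v r z * (cos t * g ipz i t r z - sin t * g ipr i t r z).
Definition radial_jac i t r z : R := cos t * g ipr i t r z + sin t * g ipz i t r z.

(** With p_r = v cos t and p_z = v sin t, [pot_t] is p_z lam(d/dr) - p_r lam(d/dz), while [pot_r]
    and [pot_z] are p_z lam(d/dt) and p_r lam(d/dt). The last two contain v^2 = 2 w and hence vanish
    on the zero velocity curve. *)
Definition pot_t t r z : R :=
  sin t * (wr r z * radial t r z + v r z * l ir t r z)
  - cos t * (wz r z * radial t r z + v r z * l iz t r z).
Definition pot_r t r z : R := 2 * w r z * (sin t * angular t r z).
Definition pot_z t r z : R := 2 * w r z * (cos t * angular t r z).

(** The derivatives of the three potentials in expanded form. The quotients [wr / v] and [wz / v] of
    the chart derivatives have been multiplied out with v^2 = 2 w, so that no division by [v]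
    remains and the fluxes extend continuously to w = 0. *)
Definition flux_t t r z : R :=
  cos t * (wr r z * radial t r z + v r z * l ir t r z)
  + sin t * (wr r z * (angular t r z + (cos t * angular_jac ipr t r z + sin t * angular_jac ipz t r z))
             + v r z * angular_jac ir t r z)
  + sin t * (wz r z * radial t r z + v r z * l iz t r z)
  - cos t * (wz r z * (angular t r z + (cos t * angular_jac ipr t r z + sin t * angular_jac ipz t r z))
             + v r z * angular_jac iz t r z).
Definition flux_r t r z : R := 2 * wr r z * (sin t * angular t r z) + sin t *
  (cos t * (v r z * wr r z * radial_jac ipz t r z + 2 * w r z * g ir ipz t r z)
   - sin t * (v r z * wr r z * radial_jac ipr t r z + 2 * w r z * g ir ipr t r z)).
Definition flux_z t r z : R := 2 * wz r z * (cos t * angular t r z) + cos t *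
  (cos t * (v r z * wz r z * radial_jac ipz t r z + 2 * w r z * g iz ipz t r z)
   - sin t * (v r z * wz r z * radial_jac ipr t r z + 2 * w r z * g iz ipr t r z)).

Lemma derive_pot_t t r z : 0 < r -> 0 <= w r z ->
  is_derive t (1 : R) (fun x => pot_t x r z) (flux_t t r z).
Proof.
move=> r0 w0; have MX : M (X t r z) := chart_surface t r0 w0.
have dl i := @derive_form_comp R beta ecc lam hlam (fun x => X x r z) t _ _ _ _ i MX
  (derive_chart_t beta ecc t r z).
have := dl iz; have := dl ir; have := dl ipz; have := dl ipr; move=> {dl}.
rewrite /flux_t /angular /radial /angular_jac.
set l1 : R -> R := fun x => l ipr x r z; set l2 : R -> R := fun x => l ipz x r z.
set l3 : R -> R := fun x => l ir x r z; set l4 : R -> R := fun x => l iz x r z.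
rewrite (_ : (fun x => pot_t x r z) = fun x =>
  sin x * (wr r z * (cos x * l1 x + sin x * l2 x) + v r z * l3 x)
  - cos x * (wz r z * (cos x * l1 x + sin x * l2 x) + v r z * l4 x))//.
rewrite -/(l1 t) -/(l2 t) -/(l3 t) -/(l4 t).
generalize (g ipr ipr t r z) (g ipr ipz t r z) (g ipr ir t r z) (g ipr iz t r z)
  (g ipz ipr t r z) (g ipz ipz t r z) (g ipz ir t r z) (g ipz iz t r z)
  (g ir ipr t r z) (g ir ipz t r z) (g ir ir t r z) (g ir iz t r z)
  (g iz ipr t r z) (g iz ipz t r z) (g iz ir t r z) (g iz iz t r z).
move=> a1 a2 a3 a4 b1 b2 b3 b4 c1 c2 c3 c4 d1 d2 d3 d4.
clearbody l1 l2 l3 l4; generalize (v r z) (wr r z) (wz r z) => V Wr Wz D1 D2 D3 D4.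
by derive_tac; ring.
Qed.

Lemma derive_pot_r t r z : 0 < r -> 0 < w r z ->
  is_derive r (1 : R) (fun x => pot_r t x z) (flux_r t r z).
Proof.
move=> r0 w0; have MX : M (X t r z) := chart_surface t r0 (ltW w0).
have v0 : 0 < v r z by rewrite sqrtr_gt0 mulr_gt0.
have v2 := speed_sqr (ltW w0).
have dl i := @derive_form_comp R beta ecc lam hlam (fun x => X t x z) r _ _ _ _ i MX
  (derive_chart_r hbeta t r0 w0).
have := dl ipz; have := dl ipr; move=> {dl}.
have := @derive_kinetic R beta ecc hbeta (fun x => x) (fun=> z) r 1 0 r0 (derive_idfun r)
  (derive_const r z); rewrite mulr1 mulr0 addr0.
rewrite /flux_r /angular /radial_jac.
set l1 : R -> R := fun x => l ipr t x z; set l2 : R -> R := fun x => l ipz t x z.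
set W : R -> R := fun x => w x z.
rewrite (_ : (fun x => pot_r t x z) = fun x =>
  2 * W x * (sin t * (cos t * l2 x - sin t * l1 x)))//.
rewrite -/(l1 r) -/(l2 r) -/(W r) in v2 *.
generalize (g ipr ipr t r z) (g ipr ipz t r z) (g ipz ipr t r z) (g ipz ipz t r z)
  (g ir ipr t r z) (g ir ipz t r z) (g iz ipr t r z) (g iz ipz t r z).
move=> a1 a2 b1 b2 c1 c2 d1 d2; move: v0 v2.
clearbody l1 l2 W; generalize (v r z) (wr r z) => V Wr V0 V2 D1 D2 D3.
have V2' : W r = V ^+ 2 / 2 by rewrite V2; field.
by derive_tac; rewrite V2'; field; rewrite gt_eqF.
Qed.

Lemma derive_pot_z t r z : 0 < r -> 0 < w r z ->
  is_derive z (1 : R) (fun x => pot_z t r x) (flux_z t r z).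
Proof.
move=> r0 w0; have MX : M (X t r z) := chart_surface t r0 (ltW w0).
have v0 : 0 < v r z by rewrite sqrtr_gt0 mulr_gt0.
have v2 := speed_sqr (ltW w0).
have dl i := @derive_form_comp R beta ecc lam hlam (fun x => X t r x) z _ _ _ _ i MX
  (derive_chart_z hbeta t r0 w0).
have := dl ipz; have := dl ipr; move=> {dl}.
have := @derive_kinetic R beta ecc hbeta (fun=> r) (fun x => x) z 0 1 r0 (derive_const z r)
  (derive_idfun z); rewrite mulr1 mulr0 add0r.
rewrite /flux_z /angular /radial_jac.
set l1 : R -> R := fun x => l ipr t r x; set l2 : R -> R := fun x => l ipz t r x.
set W : R -> R := fun x => w r x.
rewrite (_ : (fun x => pot_z t r x) = fun x =>
  2 * W x * (cos t * (cos t * l2 x - sin t * l1 x)))//.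
rewrite -/(l1 z) -/(l2 z) -/(W z) in v2 *.
generalize (g ipr ipr t r z) (g ipr ipz t r z) (g ipz ipr t r z) (g ipz ipz t r z)
  (g ir ipr t r z) (g ir ipz t r z) (g iz ipr t r z) (g iz ipz t r z).
move=> a1 a2 b1 b2 c1 c2 d1 d2; move: v0 v2.
clearbody l1 l2 W; generalize (v r z) (wz r z) => V Wz V0 V2 D1 D2 D3.
have V2' : W z = V ^+ 2 / 2 by rewrite V2; field.
by derive_tac; rewrite V2'; field; rewrite gt_eqF.
Qed.

(* On the slices [z = const] and [r = const] this is Stokes' theorem for the forms
   [p_z lam] and [p_r lam]; there [d lam = omega] contributes the term [2 w]. *)
Lemma form_flow_divergence t r z : 0 < r -> 0 <= w r z ->
  form_flow beta ecc lam t r z - 2 * w r z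
  = flux_t t r z + flux_z t r z - flux_r t r z.
Proof.
move=> r0 w0; have MX : M (X t r z) := chart_surface t r0 w0.
have c2 : cos t ^+ 2 = 1 - sin t ^+ 2 by rewrite -(cos2Dsin2 t) addrK.
(* The chart vectors of [z] and [r] are multiplied by [v], that of [t] is divided by it; these
   vectors make sense also where v = 0. *)
have := @adapted_closed_coord R beta ecc lam hbeta hlam (X t r z)
  (wz r z * cos t) (wz r z * sin t) 0 (v r z) (- sin t) (cos t) 0 0 MX.
have := @adapted_closed_coord R beta ecc lam hbeta hlam (X t r z)
  (wr r z * cos t) (wr r z * sin t) (v r z) 0 (- sin t) (cos t) 0 0 MX.
have -> : X t r z 0 ipr = v r z * cos t by rewrite chartE vec4E.
have -> : X t r z 0 ipz = v r z * sin t by rewrite chartE vec4E.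
have -> : X t r z 0 ir = r by rewrite chartE vec4E.
have -> : X t r z 0 iz = z by rewrite chartE vec4E.
move: (speed_sqr w0).
rewrite /flux_t /flux_r /flux_z /form_flow /angular /radial /angular_jac /radial_jac.
generalize (g ipr ipr t r z) (g ipr ipz t r z) (g ipr ir t r z) (g ipr iz t r z)
  (g ipz ipr t r z) (g ipz ipz t r z) (g ipz ir t r z) (g ipz iz t r z)
  (g ir ipr t r z) (g ir ipz t r z) (g ir ir t r z) (g ir iz t r z)
  (g iz ipr t r z) (g iz ipz t r z) (g iz ir t r z) (g iz iz t r z)
  (l ipr t r z) (l ipz t r z) (l ir t r z) (l iz t r z).
generalize (v r z) (wr r z) (wz r z) (w r z) => V Wr Wz W.
move=> a1 a2 a3 a4 b1 b2 b3 b4 c1 c2' c3 c4 d1 d2 d3 d4 l1 l2 l3 l4 V2 Er Ez.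
have {V2} WE : W = V ^+ 2 / 2 by rewrite V2; field.
have {}Er := Er ltac:(ring: c2) ltac:(ring).
have {}Ez := Ez ltac:(ring: c2) ltac:(ring).
move/eqP: Er; rewrite -subr_eq0 => /eqP Er; move/eqP: Ez; rewrite -subr_eq0 => /eqP Ez.
apply/eqP; rewrite -subr_eq0; apply/eqP.
(* The identity is the combination of the two closedness relations with the weights p_z and -p_r. *)
match type of Er with ?a = 0 => match type of Ez with ?b = 0 =>
  transitivity (cos t * V * (- b) + sin t * V * a) end end.
  by rewrite WE; field: c2.
by rewrite Er Ez oppr0 !mulr0 addr0.
Qed.

End Flux.

(** * The region of positive kinetic energy *)

Section Region.
Variable R : realType.
Variables beta ecc : R.
Hypotheses (hbeta : 0 < beta < 1) (hecc : 0 < ecc < 1).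
Hypothesis hreg : beta ^+ 2 + ecc ^+ 2 < 1.

Local Notation w := (kinetic beta ecc).
Local Notation varpi := (varpi_of beta ecc).

Definition r_min : R := (1 - ecc) / (2 * beta).
Definition r_max : R := (1 + ecc) / (2 * beta).
(** The minimum of [barrier], attained at r = varpi^2. Since 2 varpi^2 = (1 - ecc^2) / beta^2, it is
    positive exactly when beta^2 + ecc^2 < 1, and then [pull / gap] bounds [dist] on the region. *)
Definition gap : R := 1 - 1 / (2 * varpi ^+ 2).
Definition z_max : R := pull beta / gap.

Lemma r_min_gt0 : 0 < r_min.
Proof.
have /andP[b0 b1] := hbeta; have /andP[e0 e1] := hecc.
by rewrite /r_min divr_gt0 ?mulr_gt0// subr_gt0.
Qed.

Lemma varpi_sqr_gt : 1 < 2 * varpi ^+ 2.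
Proof.
have /andP[b0 b1] := hbeta; have h := hreg; have b2 : 0 < beta ^+ 2 by rewrite exprn_gt0.
have -> : 2 * varpi ^+ 2 = (1 - ecc ^+ 2) / beta ^+ 2.
  by rewrite varpi_sqr//; field; rewrite gt_eqF.
by rewrite ltr_pdivlMr// mul1r; lra.
Qed.

Lemma gap_gt0 : 0 < gap.
Proof.
have h := varpi_sqr_gt; rewrite /gap subr_gt0 ltr_pdivrMr ?mul1r//.
exact: lt_trans h.
Qed.

Lemma gap_le_barrier r : 0 < r -> gap <= barrier beta ecc r.
Proof.
move=> r0; have h := varpi_sqr_gt; have v0 : varpi ^+ 2 != 0 by rewrite gt_eqF//; lra.
rewrite -subr_ge0 /barrier /gap.
have -> : 1 + varpi ^+ 2 / (2 * r ^+ 2) - 1 / r - (1 - 1 / (2 * varpi ^+ 2))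
    = (r - varpi ^+ 2) ^+ 2 / (2 * varpi ^+ 2 * r ^+ 2).
  by move: (varpi ^+ 2) v0 => q q0; field; rewrite q0 gt_eqF.
by rewrite divr_ge0 ?sqr_ge0// mulr_ge0 ?sqr_ge0//; lra.
Qed.

Lemma dist_ge r z : 0 < r -> r <= dist beta r z /\ `|z| <= dist beta r z.
Proof.
move=> r0; have s0 := stretch_gt0 hbeta; have a0 := alpha_gt0 hbeta.
have s1 : 1 <= stretch beta by rewrite /stretch; lra.
have d0 := dist_gt0 hbeta z r0.
have sqr_le (a b : R) : 0 <= a -> 0 <= b -> a ^+ 2 <= b ^+ 2 -> a <= b.
  by move=> a0' b0; rewrite ler_pXn2r.
split; apply: sqr_le; rewrite ?(ltW d0) ?(ltW r0) ?dist_sqr//.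
  by rewrite lerDl mulr_ge0 ?sqr_ge0// ltW.
by rewrite real_normK ?num_real//; have := sqr_ge0 r; have := sqr_ge0 z; nra.
Qed.

Lemma barrier_factor r : 0 < r ->
  pull beta / r - barrier beta ecc r = (r - r_min) * (r_max - r) / r ^+ 2.
Proof.
move=> r0; have /andP[b0 b1] := hbeta.
rewrite /pull /barrier /r_min /r_max varpi_sqr//; field; rewrite !gt_eqF//.
Qed.

Lemma kinetic_le r z : 0 < r -> w r z <= (r - r_min) * (r_max - r) / r ^+ 2.
Proof.
move=> r0; rewrite kineticE// -barrier_factor// lerD2r.
have [rd _] := dist_ge z r0; have p0 := pull_gt0 hbeta.
by rewrite ler_pM2l// lef_pV2// posrE dist_gt0.
Qed.

Lemma region_r r z : 0 < r -> 0 < w r z -> r_min < r < r_max.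
Proof.
move=> r0 w0; have := lt_le_trans w0 (kinetic_le z r0).
rewrite pmulr_lgt0 ?invr_gt0 ?exprn_gt0// => h.
have b0 : 0 < r_max by rewrite /r_max; have := hbeta; have := hecc; move=> /andP[? ?] /andP[? ?]; rewrite divr_gt0 ?addr_gt0 ?mulr_gt0.
have m0 := r_min_gt0.
have mm : r_min < r_max.
  have := hbeta; have := hecc; move=> /andP[? ?] /andP[? ?].
  by rewrite /r_min /r_max ltr_pM2r ?invr_gt0 ?mulr_gt0//; lra.
by apply/andP; split; nra.
Qed.

Lemma region_r_closed r z : 0 < r -> 0 <= w r z -> r_min <= r <= r_max.
Proof.
move=> r0 w0; have := le_trans w0 (kinetic_le z r0).
rewrite pmulr_lge0 ?invr_gt0 ?exprn_gt0// => h.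
have mm : r_min < r_max.
  have := hbeta; have := hecc; move=> /andP[? ?] /andP[? ?].
  by rewrite /r_min /r_max ltr_pM2r ?invr_gt0 ?mulr_gt0//; lra.
by apply/andP; split; nra.
Qed.

Lemma region_z r z : 0 < r -> 0 <= w r z -> `|z| <= z_max.
Proof.
move=> r0; rewrite kineticE// subr_ge0 => h; have [_ zd] := dist_ge z r0.
apply: le_trans zd _; have d0 := dist_gt0 hbeta z r0; have g0 := gap_gt0.
rewrite /z_max ler_pdivlMr// mulrC -ler_pdivlMr//.
exact: le_trans (gap_le_barrier r0) h.
Qed.

Lemma kinetic_reciprocal (u z : R) : 0 < u -> w u^-1 z =
  pull beta * (u / Num.sqrt (1 + stretch beta * z ^+ 2 * u ^+ 2))
  - (1 + varpi ^+ 2 * u ^+ 2 / 2 - u).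
Proof.
move=> u0; rewrite kineticE// /barrier div1r invrK; congr (_ - _); last first.
  by field; rewrite gt_eqF.
have -> : dist beta u^-1 z = Num.sqrt (1 + stretch beta * z ^+ 2 * u ^+ 2) / u.
  rewrite /dist; have -> : u^-1 ^+ 2 + stretch beta * z ^+ 2 =
      (1 + stretch beta * z ^+ 2 * u ^+ 2) / u ^+ 2 by field; rewrite gt_eqF.
  rewrite sqrtrM ?sqrtrV ?sqrtr_sqr ?ger0_norm ?exprn_ge0 ?ltW//.
  by rewrite ltr_pwDl// mulr_ge0 ?sqr_ge0// mulr_ge0 ?sqr_ge0// ltW// stretch_gt0.
by rewrite invfM invrK [u / _]mulrC.
Qed.

(* [w] is a concave function of [u = 1 / r]. *)
Lemma reciprocal_tangent (z b : R) : 0 < b ->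
  exists c, forall u, 0 < u -> w u^-1 z <= w b^-1 z + c * (u - b).
Proof.
move=> b0; pose m := stretch beta * z ^+ 2.
have m0 : 0 <= m by rewrite mulr_ge0 ?sqr_ge0// ltW// stretch_gt0.
have pos (x : R) : 0 < 1 + m * x ^+ 2 by rewrite ltr_pwDl// mulr_ge0 ?sqr_ge0.
pose s := Num.sqrt (1 + m * b ^+ 2).
(* The derivative at [b]: the function u / sqrt (1 + m u^2) has derivative (1 + m u^2)^(-3/2). *)
exists (pull beta * s ^- 3 + 1 - varpi ^+ 2 * b) => u u0.
rewrite !kinetic_reciprocal// -/m -/s; set t := Num.sqrt (1 + m * u ^+ 2).
have s0 : 0 < s by rewrite sqrtr_gt0. have t0 : 0 < t by rewrite sqrtr_gt0.
have s2 : s ^+ 2 = 1 + m * b ^+ 2 by rewrite sqr_sqrtr// ltW.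
have t2 : t ^+ 2 = 1 + m * u ^+ 2 by rewrite sqr_sqrtr// ltW.
have key : u / t <= b / s + s ^- 3 * (u - b).
  have -> : b / s + s ^- 3 * (u - b) = (u + m * b ^+ 3) / s ^+ 3.
    have -> : b / s = b * s ^+ 2 / s ^+ 3 by field; rewrite gt_eqF.
    by rewrite s2; field; rewrite gt_eqF.
  rewrite ler_pdivlMr ?exprn_gt0// mulrAC ler_pdivrMr//.
  have sqr_le (x y : R) : 0 <= x -> 0 <= y -> x ^+ 2 <= y ^+ 2 -> x <= y.
    by move=> x0 y0; rewrite ler_pXn2r.
  apply: sqr_le; first by rewrite mulr_ge0 ?exprn_ge0 ?ltW.
    by rewrite mulr_ge0 ?(ltW t0)// addr_ge0 ?(ltW u0)// mulr_ge0// exprn_ge0 ?(ltW b0).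
  have -> : (u * s ^+ 3) ^+ 2 = u ^+ 2 * (s ^+ 2) ^+ 3 by ring.
  have -> : ((u + m * b ^+ 3) * t) ^+ 2 = (u + m * b ^+ 3) ^+ 2 * t ^+ 2 by ring.
  rewrite t2 s2 -subr_ge0.
  (* The squared tangent inequality has a double zero at u = b, and the cofactor is non-negative. *)
  have -> : (u + m * b ^+ 3) ^+ 2 * (1 + m * u ^+ 2) - u ^+ 2 * (1 + m * b ^+ 2) ^+ 3
    = m * (u - b) ^+ 2 * (u * (u + 2 * b) + m * b ^+ 3 * (2 * u + b)) by ring.
  by rewrite mulr_ge0 ?(mulr_ge0 m0) ?sqr_ge0// addr_ge0// mulr_ge0 ?(mulr_ge0 m0)
    ?exprn_ge0 ?(ltW b0)//; lra.
have vp : 0 <= varpi ^+ 2 * (u - b) ^+ 2 by rewrite mulr_ge0 ?sqr_ge0.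
have := ler_wpM2l (ltW (pull_gt0 hbeta)) key; lra.
Qed.

(** The positivity set of a concave function of 1 / r is an interval in 1 / r, hence in r. *)
Lemma region_r_convex z x y r : 0 < x -> 0 < w x z -> 0 < y -> 0 < w y z ->
  x <= r <= y -> 0 < w r z.
Proof.
move=> x0 wx y0 wy /andP[xr ry]; have r0 : 0 < r by exact: lt_le_trans xr.
rewrite ltNge; apply/negP => wr.
have [ix ir iy] : [/\ 0 < x^-1, 0 < r^-1 & 0 < y^-1] by rewrite !invr_gt0.
have [c Hc] := reciprocal_tangent z ir.
have := Hc _ ix; have := Hc _ iy; rewrite !invrK => Hy Hx.
have xr' : r^-1 <= x^-1 by rewrite lef_pV2.
have yr' : y^-1 <= r^-1 by rewrite lef_pV2.
move: (x^-1) (r^-1) (y^-1) xr' yr' Hx Hy {ix ir iy Hc} => p q s qp sq Hx Hy.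
(* If [w] were non-positive at [r], the supporting line there would be positive on both sides of its
   base point, whatever the sign of [c]. *)
have cp : 0 < c * (p - q) by lra.
have cs : 0 < c * (s - q) by lra.
have c0 : 0 < c by rewrite ltNge; apply/negP => c0; nra.
by nra.
Qed.

Lemma region_z_convex r x y z : 0 < r -> 0 < w r x -> 0 < w r y -> x <= z <= y -> 0 < w r z.
Proof.
move=> r0 wx wy /andP[xz zy].
have mono (a b : R) : a ^+ 2 <= b ^+ 2 -> 0 < w r b -> 0 < w r a.
  move=> ab; rewrite !kineticE// => /lt_le_trans; apply; rewrite lerD2r.
  rewrite ler_pM2l ?pull_gt0// lef_pV2 ?posrE ?dist_gt0//.
  by apply: ler_wsqrtr; rewrite lerD2l ler_pM2l// stretch_gt0.
have [zx|zx] := leP (z ^+ 2) (x ^+ 2); first exact: mono zx wx.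
(* For fixed [r] the energy decreases with z^2. Now z^2 > x^2 and x <= z force z > 0, so z <= y
   gives z^2 <= y^2. *)
have z0 : 0 < z by rewrite ltNge; apply/negP => z0; nra.
by apply: mono wy; nra.
Qed.

End Region.

Section FluxContinuity.
Variable R : realType.
Variables beta ecc : R.
Variable lam : 'rV[R]_4 -> 'rV[R]_4.
Hypotheses (hbeta : 0 < beta < 1) (hecc : 0 < ecc < 1).
Hypothesis hlam : adapted_contact_form beta ecc lam.

Local Notation M := (surface beta ecc).
Local Notation w := (kinetic beta ecc).
Local Notation X := (chart beta ecc).

(** Continuity is proved along maps from an arbitrary space, to serve both for functions of the
    triple, which yields bounds, and along coordinate lines, where the fundamental theorem is
    applied. *)
Variables (T : topologicalType) (t r z : T -> R) (s : T).
Hypotheses (r0 : 0 < r s) (w0 : 0 <= w (r s) (z s)).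
Hypotheses (ct : {for s, continuous t}) (cr : {for s, continuous r})
  (cz : {for s, continuous z}).

Let cX : {for s, continuous (fun x => X (t x) (r x) (z x))}.
Proof. exact: continuous_chart. Qed.

Let MX : M (X (t s) (r s) (z s)) := chart_surface (t s) r0 w0.

Let cl i : {for s, continuous (fun x => lam (X (t x) (r x) (z x)) 0 i)}.
Proof. exact: (@continuous_form_comp _ _ _ _ hlam T (fun x => X (t x) (r x) (z x)) s i MX cX). Qed.

Let cg j i : {for s, continuous (fun x => jac lam j i (X (t x) (r x) (z x)))}.
Proof. exact: (@continuous_jac_comp _ _ _ _ hlam T (fun x => X (t x) (r x) (z x)) s j i MX cX). Qed.

Let cw : {for s, continuous (fun x => w (r x) (z x))}.
Proof. exact: continuous_kinetic. Qed.

Let cwr : {for s, continuous (fun x => force_r beta ecc (r x) (z x))}.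
Proof. exact: continuous_force_r. Qed.

Let cwz : {for s, continuous (fun x => force_z beta (r x) (z x))}.
Proof. exact: continuous_force_z. Qed.

Let cv : {for s, continuous (fun x => speed beta ecc (r x) (z x))}.
Proof. exact: continuous_speed. Qed.

Ltac flux_step := lazymatch goal with
  | |- {for _, continuous (fun x => fun_of_matrix (lam _) _ ?i)} => exact: (cl i)
  | |- {for _, continuous (fun x => jac _ ?j ?i _)} => exact: (cg j i)
  | |- {for _, continuous (fun x => kinetic _ _ _ _)} => exact: cw
  | |- {for _, continuous (fun x => force_r _ _ _ _)} => exact: cwr
  | |- {for _, continuous (fun x => force_z _ _ _)} => exact: cwz
  | |- {for _, continuous (fun x => speed _ _ _ _)} => exact: cv
  | _ => continuous_step
  end.

Let cang : {for s, continuous (fun x => angular beta ecc lam (t x) (r x) (z x))}.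
Proof. by rewrite /angular; repeat flux_step. Qed.

Let crad : {for s, continuous (fun x => radial beta ecc lam (t x) (r x) (z x))}.
Proof. by rewrite /radial; repeat flux_step. Qed.

Let cang_jac i : {for s, continuous (fun x => angular_jac beta ecc lam i (t x) (r x) (z x))}.
Proof. by rewrite /angular_jac; repeat flux_step. Qed.

Let crad_jac i : {for s, continuous (fun x => radial_jac beta ecc lam i (t x) (r x) (z x))}.
Proof. by rewrite /radial_jac; repeat flux_step. Qed.

Local Notation cont f := {for s, continuous (fun x => f (t x) (r x) (z x))}.

Ltac flux_step2 := lazymatch goal with
  | |- {for _, continuous (fun x => angular _ _ _ _ _ _)} => exact: cang
  | |- {for _, continuous (fun x => radial _ _ _ _ _ _)} => exact: crad
  | |- {for _, continuous (fun x => angular_jac _ _ _ ?i _ _ _)} => exact: (cang_jac i)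
  | |- {for _, continuous (fun x => radial_jac _ _ _ ?i _ _ _)} => exact: (crad_jac i)
  | _ => flux_step
  end.

Lemma continuous_pot_t : cont (pot_t beta ecc lam).
Proof. by rewrite /pot_t; repeat flux_step2. Qed.

Lemma continuous_pot_r : cont (pot_r beta ecc lam).
Proof. by rewrite /pot_r; repeat flux_step2. Qed.

Lemma continuous_pot_z : cont (pot_z beta ecc lam).
Proof. by rewrite /pot_z; repeat flux_step2. Qed.

Lemma continuous_flux_t : cont (flux_t beta ecc lam).
Proof. by rewrite /flux_t; repeat flux_step2. Qed.

Lemma continuous_flux_r : cont (flux_r beta ecc lam).
Proof. by rewrite /flux_r; repeat flux_step2. Qed.

Lemma continuous_flux_z : cont (flux_z beta ecc lam).
Proof. by rewrite /flux_z; repeat flux_step2. Qed.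

End FluxContinuity.

(** * Compactness of the chart domain *)

Section Domain.
Variable R : realType.
Variables beta ecc : R.
Hypotheses (hbeta : 0 < beta < 1) (hecc : 0 < ecc < 1).
Hypothesis hreg : beta ^+ 2 + ecc ^+ 2 < 1.

Local Notation w := (kinetic beta ecc).
Local Notation D := (chart_dom beta ecc).

Lemma chart_domP t r z : D (t, r, z) <-> [/\ 0 < t < 2 * pi, 0 < r & 0 < w r z].
Proof. by rewrite /chart_dom/= /kinetic subr_gt0; split=> -[]. Qed.

(** Adds to the chart domain the zero velocity curve and the angles 0 and 2 pi. Fluxes and
    potentials are continuous there, which gives the bounds for Fubini and the values at the ends of
    sections. *)
Definition closed_dom : set (R * R * R) :=
  [set y : R * R * R | [/\ 0 <= y.1.1 <= 2 * pi, 0 < y.1.2 & 0 <= w y.1.2 y.2]].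

Lemma chart_dom_closed_dom : D `<=` closed_dom.
Proof.
by move=> [[t r] z] /chart_domP[/andP[t0 t1] r0 w0]; split; rewrite ?ltW//= ltW.
Qed.

Let continuous_t (y : R * R * R) : {for y, continuous (fun x : R * R * R => x.1.1)}.
Proof. by continuous_tac. Qed.
Let continuous_r (y : R * R * R) : {for y, continuous (fun x : R * R * R => x.1.2)}.
Proof. by continuous_tac. Qed.
Let continuous_z (y : R * R * R) : {for y, continuous (fun x : R * R * R => x.2)}.
Proof. by continuous_tac. Qed.
Let continuous_w (y : R * R * R) : 0 < y.1.2 ->
  {for y, continuous (fun x : R * R * R => w x.1.2 x.2)}.
Proof.
move=> y0; have c1 := @continuous_r y; have c2 := @continuous_z y.
by apply: continuous_kinetic.
Qed.

Lemma open_pos_preimage (T : topologicalType) (f : T -> R) x :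
  {for x, continuous f} -> 0 < f x -> \forall y \near x, 0 < f y.
Proof. by move=> fx f0; exact: (fx _ (lt_nbhsr f0)). Qed.

Lemma chart_dom_open : open D.
Proof.
rewrite openE => -[[t r] z] /chart_domP[/andP[t0 t1] r0 w0].
have h1 := open_pos_preimage (@continuous_t (t, r, z)) t0.
have h2 := open_pos_preimage (@continuous_r (t, r, z)) r0.
have h3 := open_pos_preimage (@continuous_w (t, r, z) r0) w0.
have c4 : {for (t, r, z), continuous (fun x : R * R * R => 2 * pi - x.1.1)}.
  by continuous_tac.
have h4 : 0 < 2 * pi - (t, r, z).1.1 by rewrite subr_gt0.
have {}h4 := open_pos_preimage c4 h4.
refine (filterS _ (filterI (filterI h1 h2) (filterI h3 h4))).
move=> -[[t' r'] z'] /= [[t0' r0'] [w0' t1']]; apply/chart_domP.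
by split => //; rewrite t0' -subr_gt0.
Qed.

Definition dom_box : set (R * R * R) :=
  `[0, 2 * pi] `*` `[r_min beta ecc, r_max beta ecc]
    `*` `[- z_max beta ecc, z_max beta ecc].

Lemma closed_dom_box : closed_dom `<=` dom_box.
Proof.
move=> [[t r] z] [/= t0 r0 w0]; split; [split|]; rewrite /= in_itv/=.
- exact: t0.
- exact: (region_r_closed hbeta hecc r0 w0).
- by rewrite -ler_norml; exact: (region_z hbeta hecc hreg r0 w0).
Qed.

(** The condition r > 0 is not closed, but it survives limits because the set lies in a box with r
    >= [r_min] > 0. *)
Lemma compact_closed_dom : compact closed_dom.
Proof.
have cB : compact dom_box.
  by apply: compact_setX; [apply: compact_setX|]; exact: segment_compact.
apply: (subclosed_compact _ cB closed_dom_box) => y cly.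
have [[ty ry] zy] : dom_box y.
  have /compact_closed cB' : compact dom_box by [].
  apply: (cB' _); first exact: (@norm_hausdorff R (R * R * R)%type).
  by move=> U /cly [x [/closed_dom_box]]; exists x.
have r0 : 0 < y.1.2.
  by move: ry; rewrite /= in_itv/= => /andP[+ _]; apply: lt_le_trans; exact: r_min_gt0.
split; [by move: ty; rewrite /= in_itv|exact: r0|].
rewrite leNgt; apply/negP => wy.
have cw : {for y, continuous (fun x : R * R * R => - w x.1.2 x.2)}.
  exact/continuous_opp/continuous_w.
have wy' : 0 < - w y.1.2 y.2 by rewrite oppr_gt0.
have [x [[_ _ wx]]] := cly _ (open_pos_preimage cw wy').
by rewrite /= oppr_gt0 ltNge wx.
Qed.

Lemma closed_dom_bounded (f : R * R * R -> R) :
  (forall y, closed_dom y -> {for y, continuous f}) ->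
  exists C, forall y, closed_dom y -> `|f y| <= C.
Proof.
move=> cf; have fw : {within closed_dom, continuous f}.
  by apply/continuous_in_subspaceT => x; rewrite inE; exact: cf.
have [C [_ hC]] := compact_bounded (continuous_compact fw compact_closed_dom).
exists (C + 1) => y Ky; apply: (hC (C + 1)); first by rewrite ltrDl.
by exists y.
Qed.

Lemma chart_dom_box_bound : exists B : R, forall y, D y ->
  [/\ `|y.1.1| <= B, `|y.1.2| <= B & `|y.2| <= B].
Proof.
have [B1 h1] := closed_dom_bounded (fun y _ => @continuous_t y).
have [B2 h2] := closed_dom_bounded (fun y _ => @continuous_r y).
have [B3 h3] := closed_dom_bounded (fun y _ => @continuous_z y).
exists (Num.max B1 (Num.max B2 B3)) => y /chart_dom_closed_dom Ky.
by split; rewrite !le_max; [rewrite h1|rewrite h2 ?orbT|rewrite h3 ?orbT].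
Qed.

Lemma closure_section (O : set R) (j : R -> R * R * R) a : continuous j ->
  (forall x, O x -> closed_dom (j x)) -> closure O a -> closed_dom (j a).
Proof.
move=> cj Oj; have cK : closed closed_dom.
  by apply: (compact_closed _ compact_closed_dom); exact: (@norm_hausdorff R (R * R * R)%type).
have cjK : closed (j @^-1` closed_dom) by apply: (closed_comp _ cK) => x _; exact: cj.
by rewrite closureE => h; exact: (h _ (conj cjK Oj)).
Qed.

End Domain.

(** * Vanishing of the flux integrals *)

Section FluxIntegrals.
Variable R : realType.
Variables beta ecc : R.
Variable lam : 'rV[R]_4 -> 'rV[R]_4.
Hypotheses (hbeta : 0 < beta < 1) (hecc : 0 < ecc < 1).
Hypothesis hreg : beta ^+ 2 + ecc ^+ 2 < 1.
Hypothesis hlam : adapted_contact_form beta ecc lam.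

Local Notation w := (kinetic beta ecc).
Local Notation D := (chart_dom beta ecc).
Local Notation K := (closed_dom beta ecc).
Local Notation mu := (@lebesgue_measure R).
Local Notation mu3 := ((mu \x mu) \x mu)%E.

Definition on_triple (f : R -> R -> R -> R) (y : R * R * R) : R := f y.1.1 y.1.2 y.2.

Lemma continuous_pair (T : topologicalType) (U V : topologicalType) (f : T -> U) (g : T -> V) x :
  {for x, continuous f} -> {for x, continuous g} -> {for x, continuous (fun y => (f y, g y))}.
Proof. by move=> fx gx; apply: cvg_pair. Qed.

Lemma continuous_flux f : f = flux_t beta ecc lam \/ f = flux_r beta ecc lam \/ f = flux_z beta ecc lam ->
  forall y, K y -> {for y, continuous (on_triple f)}.
Proof.
move=> fE [[t r] z] [/= t0 r0 w0].
have c1 : {for (t, r, z), continuous (fun x : R * R * R => x.1.1)} by continuous_tac.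
have c2 : {for (t, r, z), continuous (fun x : R * R * R => x.1.2)} by continuous_tac.
have c3 : {for (t, r, z), continuous (fun x : R * R * R => x.2)} by continuous_tac.
by move: fE => [->|[->|->]]; rewrite /on_triple;
  [apply: continuous_flux_t|apply: continuous_flux_r|apply: continuous_flux_z].
Qed.

Let open_section (j : R -> R * R * R) : continuous j -> open (j @^-1` D).
Proof. by move=> cj; apply: open_comp; [move=> x _; exact: cj|exact: chart_dom_open]. Qed.

(** For fixed [t] and [r] the admissible [z] form an open interval, and [pot_z] has the factor [w],
    which is 0 at its ends. *)
Lemma integral_flux_z : (\int[mu3]_(y in D) (on_triple (flux_z beta ecc lam) y)%:E = 0)%E.
Proof.
have cf := continuous_flux (or_intror (or_intror (erefl (flux_z beta ecc lam)))).
have [C hC] := closed_dom_bounded hbeta hecc hreg cf.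
have [B hB] := chart_dom_box_bound hbeta hecc hreg.
have DK := @chart_dom_closed_dom R beta ecc.
rewrite (integral_box_z (chart_dom_open hbeta) hB (fun y Dy => cf y (DK y Dy))
  (fun y Dy => hC y (DK y Dy))).
apply: integral0_eq => -[t r] _.
have cj : continuous (fun z : R => (t, r, z)).
  by move=> z; apply: continuous_pair; [exact: cvg_cst|exact: cvg_id].
apply: (@integral_section_derivative R [set z | D (t, r, z)] B
  (fun z => flux_z beta ecc lam t r z) (fun z => pot_z beta ecc lam t r z)).
- exact: open_section cj.
- move=> x y /chart_domP[ht r0 wx] /chart_domP[_ _ wy] z xzy; apply/chart_domP.
  by split => //; exact: (region_z_convex hbeta r0 wx wy xzy).
- by move=> z /hB[].
- move=> a cla; have Ka := closure_section hbeta hecc hreg cj (fun x h => DK _ h) cla.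
  have [/= _ r0 wa] := Ka.
  have c1 : {for a, continuous (fun=> t)} by exact: cst_continuous_for.
  have c2 : {for a, continuous (fun=> r)} by exact: cst_continuous_for.
  have c3 : {for a, continuous (fun x : R => x)} by exact: cvg_id.
  split.
  + exact: (continuous_flux_z hbeta hlam r0 wa c1 c2 c3).
  + exact: (continuous_pot_z hbeta hlam r0 wa c1 c2 c3).
  + have [x [/chart_domP[ht _ _] _]] := cla _ filterT.
    (* The angle and the radius are admissible at [a], so lying outside the domain can only mean w =
       0. *)
    move=> nDa; rewrite /pot_z; suff -> : w r a = 0 by rewrite mulr0 mul0r.
    apply/eqP; rewrite eq_le wa andbT leNgt; apply/negP => wa'.
    by apply: nDa; apply/chart_domP.
- by move=> z /chart_domP[_ r0 wz]; apply: derive_pot_z.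
Qed.

Lemma integral_flux_r : (\int[mu3]_(y in D) (on_triple (flux_r beta ecc lam) y)%:E = 0)%E.
Proof.
have cf := continuous_flux (or_intror (or_introl (erefl (flux_r beta ecc lam)))).
have [C hC] := closed_dom_bounded hbeta hecc hreg cf.
have [B hB] := chart_dom_box_bound hbeta hecc hreg.
have DK := @chart_dom_closed_dom R beta ecc.
rewrite (integral_box_r (chart_dom_open hbeta) hB (fun y Dy => cf y (DK y Dy))
  (fun y Dy => hC y (DK y Dy))).
apply: integral0_eq => z _; apply: integral0_eq => t _.
have cj : continuous (fun r : R => (t, r, z)).
  move=> r; apply: continuous_pair; last exact: cvg_cst.
  by apply: continuous_pair; [exact: cvg_cst|exact: cvg_id].
apply: (@integral_section_derivative R [set r | D (t, r, z)] B
  (fun r => flux_r beta ecc lam t r z) (fun r => pot_r beta ecc lam t r z)).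
- exact: open_section cj.
- move=> x y /chart_domP[ht x0 wx] /chart_domP[_ y0 wy] r xry; apply/chart_domP.
  split => //; first by case/andP: xry => xr _; exact: lt_le_trans xr.
  exact: (region_r_convex hbeta x0 wx y0 wy xry).
- by move=> r /hB[].
- move=> a cla; have Ka := closure_section hbeta hecc hreg cj (fun x h => DK _ h) cla.
  have [/= _ r0 wa] := Ka.
  have c1 : {for a, continuous (fun=> t)} by exact: cst_continuous_for.
  have c2 : {for a, continuous (fun=> z)} by exact: cst_continuous_for.
  have c3 : {for a, continuous (fun x : R => x)} by exact: cvg_id.
  split.
  + exact: (continuous_flux_r hbeta hlam r0 wa c1 c3 c2).
  + exact: (continuous_pot_r hbeta hlam r0 wa c1 c3 c2).
  + have [x [/chart_domP[ht _ _] _]] := cla _ filterT.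
    move=> nDa; rewrite /pot_r; suff -> : w a z = 0 by rewrite mulr0 mul0r.
    apply/eqP; rewrite eq_le wa andbT leNgt; apply/negP => wa'.
    by apply: nDa; apply/chart_domP.
- by move=> r /chart_domP[_ r0 wz]; apply: derive_pot_r.
Qed.

(** Here the potential does not vanish at the ends; its values at 0 and 2 pi agree because both
    angles give the same point of the surface. *)
Lemma integral_flux_t : (\int[mu3]_(y in D) (on_triple (flux_t beta ecc lam) y)%:E = 0)%E.
Proof.
have cf := continuous_flux (or_introl (erefl (flux_t beta ecc lam))).
have [C hC] := closed_dom_bounded hbeta hecc hreg cf.
have [B hB] := chart_dom_box_bound hbeta hecc hreg.
have DK := @chart_dom_closed_dom R beta ecc.
rewrite (integral_box_t (chart_dom_open hbeta) hB (fun y Dy => cf y (DK y Dy))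
  (fun y Dy => hC y (DK y Dy))).
apply: integral0_eq => z _; apply: integral0_eq => r _.
have [[r0 w0]|nrw] := pselect (0 < r /\ 0 < w r z); last first.
  rewrite (_ : [set t | _] = set0) ?integral_set0// -subset0 => t /chart_domP[_ r0 w0].
  exact: nrw.
have pi2 : 0 < 2 * pi :> R by rewrite mulr_gt0// pi_gt0.
rewrite (_ : [set t | _] = `]0, 2 * pi[%classic); last first.
  by apply/seteqP; split=> t; rewrite /= in_itv/= => h; [case/chart_domP: h|apply/chart_domP].
have c2 a : {for a, continuous (fun _ : R => r)} by exact: cst_continuous_for.
have c3 a : {for a, continuous (fun _ : R => z)} by exact: cst_continuous_for.
have c1 a : {for a, continuous (fun x : R => x)} by exact: cvg_id.
have cF a : {for a, continuous (fun t => pot_t beta ecc lam t r z)}.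
  exact: (continuous_pot_t hbeta hlam r0 (ltW w0) (c1 a) (c2 a) (c3 a)).
have cf' a : {for a, continuous (fun t => flux_t beta ecc lam t r z)}.
  exact: (continuous_flux_t hbeta hlam r0 (ltW w0) (c1 a) (c2 a) (c3 a)).
refine (etrans (integral_FTC_oo pi2 (fun t _ => cf' t)
  (fun t _ => derive_pot_t hlam t r0 (ltW w0)) (cF 0) (cF (2 * pi))) _).
have c2pi : cos (2 * pi) = 1 :> R by rewrite mulr_natl cos2pi.
have s2pi : sin (2 * pi) = 0 :> R by rewrite mulr_natl sin2pi.
by rewrite /pot_t /radial !chartE c2pi s2pi cos0 sin0 subrr.

Qed.

End FluxIntegrals.

Section Primitive.
Variable R : realType.
Local Notation mu := (@lebesgue_measure R).

(** The derivative is obtained inside the interval only; users take an interval larger than the one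
    over which they integrate, to be differentiable at its ends too. *)
Lemma primitive_exists (f : R -> R) (a b : R) :
  (forall t, a <= t <= b -> {for t, continuous f}) ->
  exists F : R -> R, forall t, a < t < b -> is_derive t (1 : R) F (f t).
Proof.
move=> fc; have fw : {within `[a, b], continuous f}.
  by apply/continuous_in_subspaceT => x; rewrite inE/= in_itv/=; exact: fc.
have fi : mu.-integrable `[a, b] (EFin \o f).
  by apply: continuous_compact_integrable => //; exact: segment_compact.
exists (fun x => \int[mu]_(t in `[a, x]) f t) => t /andP[at_ tb].
have ft : {for t, continuous f} by apply: fc; rewrite !ltW.
by have [dF F'] := continuous_FTC1_closed tb fi at_ ft; split; [exact: dF|rewrite -derive1E; exact: F'].
Qed.

Lemma Rintegral_scale (f : R -> R) (c a b : R) : 0 < c -> 0 < a -> a < b ->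
  (forall t, 0 < t -> {for t, continuous f}) ->
  \int[mu]_(t in `[c * a, c * b]) f t = c * \int[mu]_(t in `[a, b]) f (c * t).
Proof.
move=> c0 a0 ab fc.
have [|F dF] := @primitive_exists f (c * a / 2) (c * b * 2).
  by move=> t /andP[at_ _]; apply: fc; apply: lt_le_trans at_; rewrite divr_gt0 ?mulr_gt0.
have ca0 : 0 < c * a by rewrite mulr_gt0.
have cab : c * a < c * b by rewrite ltr_pM2l.
have dF' t : c * a <= t <= c * b -> is_derive t (1 : R) F (f t).
  by move=> /andP[t1 t2]; apply: dF; apply/andP; split; lra.
have dG t : a <= t <= b -> is_derive t (1 : R) (fun x => F (c * x) / c) (f (c * t)).
  move=> /andP[t1 t2]; have d1 : is_derive t (1 : R) (fun x => c * x) c by derive_tac; ring.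
  have d2 : is_derive (c * t) (1 : R) F (f (c * t)).
    by apply: dF'; rewrite !ler_pM2l// t1 t2.
  have := derive_comp1 d2 d1 => d3; derive_tac; field; rewrite gt_eqF//.
have E1 : \int[mu]_(t in `[c * a, c * b]) f t = F (c * b) - F (c * a).
  apply: Rintegral_FTC => //.
  - by move=> t /andP[t1 _]; apply: fc; exact: lt_le_trans t1.
  - by move=> t /andP[t1 t2]; apply: dF'; rewrite !ltW.
  - by apply: (is_derive_continuous (dF' _ _)); rewrite lexx ltW.
  - by apply: (is_derive_continuous (dF' _ _)); rewrite lexx ltW.
have E2 : \int[mu]_(t in `[a, b]) f (c * t) = F (c * b) / c - F (c * a) / c.
  apply: (@Rintegral_FTC R (fun t => f (c * t)) (fun x => F (c * x) / c)) => //.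
  - move=> t /andP[t1 _]; apply: (@continuous_comp1 R _ t f (fun x => c * x)).
      by apply: fc; rewrite mulr_gt0//; exact: lt_le_trans t1.
    by continuous_tac.
  - by move=> t /andP[t1 t2]; apply: dG; rewrite !ltW.
  - by apply: (is_derive_continuous (dG _ _)); rewrite lexx ltW.
  - by apply: (is_derive_continuous (dG _ _)); rewrite lexx ltW.
by rewrite E1 E2; field; rewrite gt_eqF.
Qed.

End Primitive.

Section Volume.
Variable R : realType.
Variables beta ecc : R.
Variable lam : 'rV[R]_4 -> 'rV[R]_4.
Hypotheses (hbeta : 0 < beta < 1) (hecc : 0 < ecc < 1).
Hypothesis hreg : beta ^+ 2 + ecc ^+ 2 < 1.
Hypothesis hlam : adapted_contact_form beta ecc lam.

Local Notation w := (kinetic beta ecc).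
Local Notation D := (chart_dom beta ecc).
Local Notation K := (closed_dom beta ecc).
Local Notation mu := (@lebesgue_measure R).
Local Notation mu3 := ((mu \x mu) \x mu)%E.

Let continuous_integrable (g : R * R * R -> R) :
  (forall y, K y -> {for y, continuous g}) -> mu3.-integrable D (EFin \o g).
Proof.
move=> cg; have [C hC] := closed_dom_bounded hbeta hecc hreg cg.
have [B hB] := chart_dom_box_bound hbeta hecc hreg.
have DK := @chart_dom_closed_dom R beta ecc.
exact: (box_integrable (chart_dom_open hbeta) hB (fun y Dy => cg y (DK y Dy))
  (fun y Dy => hC y (DK y Dy))).
Qed.

Lemma continuous_energy y : K y -> {for y, continuous (on_triple (fun _ r z => 2 * w r z))}.
Proof.
move: y => [[t r] z] [/= t0 r0 w0].
have c2 : {for (t, r, z), continuous (fun x : R * R * R => x.1.2)} by continuous_tac.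
have c3 : {for (t, r, z), continuous (fun x : R * R * R => x.2)} by continuous_tac.
have cw : {for (t, r, z), continuous (fun x : R * R * R => w x.1.2 x.2)}.
  by apply: continuous_kinetic.
by rewrite /on_triple; continuous_tac.
Qed.

(** The density is |F| with F equal to 2 w plus a divergence of integral 0, and the integral of [F]
    is at most that of |F|. *)
Lemma contact_volume_ge :
  \int[mu3]_(y in D) on_triple (fun _ r z => 2 * w r z) y <= contact_volume beta ecc lam.
Proof.
pose Ft := on_triple (flux_t beta ecc lam).
pose Fr := on_triple (flux_r beta ecc lam).
pose Fz := on_triple (flux_z beta ecc lam).
pose E := on_triple (fun _ r z => 2 * w r z).
have cFt y (Ky : K y) : {for y, continuous Ft}.
  by apply: (continuous_flux hbeta hlam) => //; left.
have cFr y (Ky : K y) : {for y, continuous Fr}.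
  by apply: (continuous_flux hbeta hlam) => //; right; left.
have cFz y (Ky : K y) : {for y, continuous Fz}.
  by apply: (continuous_flux hbeta hlam) => //; right; right.
have mD : measurable (D : set (measurableTypeR R * measurableTypeR R * measurableTypeR R)).
  exact: open_measurable3 (chart_dom_open hbeta).
have iFt := continuous_integrable cFt; have iFr := continuous_integrable cFr.
have iFz := continuous_integrable cFz; have iE := continuous_integrable continuous_energy.
pose F y := (E y + Ft y) + (Fz y - Fr y).
have iF : mu3.-integrable D (EFin \o F).
  by apply: continuous_integrable => y Ky; apply: continuous_add;
    [apply: continuous_add; [exact: continuous_energy|exact: cFt]
    |apply: continuous_add; [exact: cFz|exact/continuous_opp/cFr]].
have -> : contact_volume beta ecc lam = \int[mu3]_(y in D) `|F y|.
  rewrite /contact_volume; apply: eq_Rintegral => -[[t r] z]; rewrite inE => Dy.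
  have /chart_domP[ht r0 w0] := Dy.
  rewrite /= (wedge_chart hbeta hlam t r0 w0) normrN; congr (`|_|).
  have := form_flow_divergence hbeta hlam t r0 (ltW w0).
  by rewrite /F /E /Ft /Fz /Fr /on_triple/=; lra.
have zero (G : R * R * R -> R) : (\int[mu3]_(y in D) (G y)%:E = 0)%E ->
    \int[mu3]_(y in D) G y = 0 by rewrite /Rintegral => ->.
have -> : \int[mu3]_(y in D) E y = \int[mu3]_(y in D) F y.
  have iEF : mu3.-integrable D (EFin \o (fun y => E y + Ft y)).
    by apply: continuous_integrable => y Ky; apply: continuous_add;
      [exact: continuous_energy|exact: cFt].
  have iFF : mu3.-integrable D (EFin \o (fun y => Fz y - Fr y)).
    by apply: continuous_integrable => y Ky; apply: continuous_add;
      [exact: cFz|exact/continuous_opp/cFr].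
  have zt := zero Ft (integral_flux_t hbeta hecc hreg hlam).
  have zr := zero Fr (integral_flux_r hbeta hecc hreg hlam).
  have zz := zero Fz (integral_flux_z hbeta hecc hreg hlam).
  have E1 := RintegralD mD iEF iFF.
  have E2 := RintegralD mD iE iFt; have E3 := RintegralB mD iFz iFr.
  apply/esym; refine (etrans E1 _).
  refine (etrans (congr2 +%R (etrans E2 (congr1 (+%R _) zt))
    (etrans E3 (congr2 (fun a b => a - b) zz zr))) _).
  by rewrite subrr !addr0.
by apply: le_trans (ler_norm _) _; exact: le_normr_Rintegral.
Qed.

End Volume.

(** * The integral of the kinetic energy *)

Section Energy.
Variable R : realType.
Variables beta ecc : R.
Hypotheses (hbeta : 0 < beta < 1) (hecc : 0 < ecc < 1).
Hypothesis hreg : beta ^+ 2 + ecc ^+ 2 < 1.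

Local Notation w := (kinetic beta ecc).
Local Notation D := (chart_dom beta ecc).
Local Notation K := (closed_dom beta ecc).
Local Notation mu := (@lebesgue_measure R).
Local Notation mu3 := ((mu \x mu) \x mu)%E.
Local Notation G := (barrier beta ecc).
Local Notation C := (pull beta).
Local Notation rmin := (r_min beta ecc).
Local Notation rmax := (r_max beta ecc).

(** The ratio of [r] to [C / G r], the value of [dist] at which the kinetic energy vanishes. It is 1
    at the turning points [r_min] and [r_max]. *)
Definition aperture (r : R) : R := r * G r / C.

Lemma aperture_itv r : rmin < r < rmax -> 0 < aperture r < 1.
Proof.
move=> /andP[r1 r2]; have r0 : 0 < r by apply: lt_trans r1; exact: r_min_gt0.
have G0 : 0 < G r.
  by apply: lt_le_trans (gap_le_barrier hbeta hecc hreg r0); exact: gap_gt0.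
have C0 := pull_gt0 hbeta.
apply/andP; split; first by apply: divr_gt0 => //; apply: mulr_gt0.
suff : r * G r < 1 * C by rewrite -ltr_pdivrMr.
rewrite mul1r mulrC -ltr_pdivlMr// -subr_gt0 (barrier_factor hbeta hecc r0).
by rewrite divr_gt0 ?exprn_gt0// mulr_gt0// subr_gt0.
Qed.

(** The slice is the interval ]-Z, Z[ whose ends satisfy dist = L. There 1 / dist has the
    logarithmic primitive in [F], and evaluation at the two ends produces [cap]. *)
Lemma integral_kinetic_z r : rmin < r < rmax ->
  (\int[mu]_(z in [set z | (0 < w r z)%R]) (2 * w r z)%:E =
   (4 * C / Num.sqrt (stretch beta) * cap (aperture r))%:E)%E.
Proof.
move=> hr; have /andP[q0 q1] := aperture_itv hr.
have r0 : 0 < r by case/andP: hr => r1 _; apply: lt_trans r1; exact: r_min_gt0.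
have G0 : 0 < G r.
  by apply: lt_le_trans (gap_le_barrier hbeta hecc hreg r0); exact: gap_gt0.
have C0 := pull_gt0 hbeta; have k0 := stretch_gt0 hbeta.
pose sk := Num.sqrt (stretch beta); have sk0 : 0 < sk by rewrite sqrtr_gt0.
have sk2 : sk ^+ 2 = stretch beta by rewrite sqr_sqrtr// ltW.
pose q := aperture r; pose L := C / G r; have L0 : 0 < L by rewrite divr_gt0.
have rE : r = q * L.
  by rewrite /q /aperture /L; field; rewrite !gt_eqF.
pose s := Num.sqrt (1 - q ^+ 2); have s0 : 0 < 1 - q ^+ 2 by rewrite subr_gt0 exprn_ilt1 ?ltW.
have s2 : s ^+ 2 = 1 - q ^+ 2 by rewrite sqr_sqrtr// ltW.
have sp : 0 < s by rewrite sqrtr_gt0.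
pose Z := L * s / sk; have Z0 : 0 < Z by apply: divr_gt0 => //; apply: mulr_gt0.
have sqr_lt (a b : R) : 0 < a -> 0 < b -> (a < b) = (a ^+ 2 < b ^+ 2).
  by move=> a0 b0; rewrite ltr_pXn2r// nnegrE ltW.
have wZ z : (0 < w r z) = (z ^+ 2 < Z ^+ 2).
  rewrite kineticE// subr_gt0 ltr_pdivlMr ?dist_gt0// mulrC -ltr_pdivlMr// -/L.
  rewrite (sqr_lt _ _ (dist_gt0 hbeta z r0) L0) dist_sqr// -sk2 [in LHS]rE.
  have -> : Z ^+ 2 = (L ^+ 2 - (q * L) ^+ 2) / sk ^+ 2 by rewrite /Z; field: s2; rewrite gt_eqF.
  by rewrite ltr_pdivlMr ?exprn_gt0// ltrBrDl [z ^+ 2 * _]mulrC.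
have ZE : [set z | 0 < w r z] = `]- Z, Z[%classic.
  apply/seteqP; split => z; rewrite /= wZ in_itv/= => h.
    by apply/andP; split; rewrite ltNge; apply/negP => h'; nra.
  by case/andP: h => h1 h2; nra.
have lnp z : 0 < sk * z + dist beta r z.
  have d0 := dist_gt0 hbeta z r0; have d2 := dist_sqr hbeta z r0.
  rewrite ltNge; apply/negP => h.
  have : dist beta r z ^+ 2 <= sk ^+ 2 * z ^+ 2 by nra.
  by rewrite d2 sk2 gerDr leNgt exprn_gt0.
pose F z := 2 * (C / sk * ln (sk * z + dist beta r z) - G r * z).
have c1 z : {for z, continuous (fun _ : R => r)} by exact: cst_continuous_for.
have c2 z : {for z, continuous (fun x : R => x)} by exact: cvg_id.
have cd z : {for z, continuous (fun x : R => dist beta r x)}.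
  exact: (continuous_dist (c1 z) (c2 z)).
have dF z : is_derive z (1 : R) F (2 * w r z).
  have d0 := dist_gt0 hbeta z r0; have d2 := dist_sqr hbeta z r0.
  have dd : is_derive z (1 : R) (fun x => dist beta r x) (stretch beta * z / dist beta r z).
    rewrite /dist; derive_tac; first by rewrite dist_arg_gt0.
    by rewrite -/(dist beta r z); field; rewrite gt_eqF.
  have lz := lnp z; have wE : 2 * w r z = 2 * (C / dist beta r z - G r) by rewrite kineticE.
  rewrite wE.
  clear - dd d0 d2 lz sk0 sk2 r0; rewrite /F; derive_tac => //.
  move: (dist beta r z) d0 d2 lz => d d0 d2 lz.
  by rewrite -sk2; field; rewrite !gt_eqF.
have cw z : {for z, continuous (fun x : R => 2 * w r x)}.
  have cw : {for z, continuous (fun x : R => w r x)}.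
    exact: (@continuous_kinetic R beta ecc hbeta _ _ _ z r0 (c1 z) (c2 z)).
  by continuous_tac.
have ZZ : - Z < Z by rewrite gtrN.
rewrite ZE; refine (etrans (integral_FTC_oo ZZ (fun z _ => cw z) (fun z _ => dF z)
  (is_derive_continuous (dF _)) (is_derive_continuous (dF _))) _).
congr (_%:E); rewrite /F.
have dZ z : z ^+ 2 = Z ^+ 2 -> dist beta r z = L.
  move=> zZ; rewrite /dist zZ -sk2.
  have -> : r ^+ 2 + sk ^+ 2 * Z ^+ 2 = L ^+ 2 by rewrite rE /Z; field: s2; rewrite gt_eqF.
  by rewrite sqrtr_sqr ger0_norm// ltW.
rewrite (dZ Z erefl) (dZ (- Z) (sqrrN _)).
have -> : sk * Z = L * s by rewrite /Z; field; rewrite gt_eqF.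
have -> : sk * - Z = - (L * s) by rewrite /Z; field; rewrite gt_eqF.
have -> : L * s + L = L * q * ((1 + s) / q) by field; rewrite gt_eqF.
have s1 : s < 1 by rewrite (sqr_lt _ _ sp ltr01) s2 expr1n gtrDl oppr_lt0 exprn_gt0.
have e1 : 0 < (1 + s) / q by rewrite divr_gt0// addr_gt0.
(* As (1 - s) (1 + s) = q^2, the two arguments are L q times (1 + s) / q and its inverse; the
   difference of logarithms is 2 ln ((1 + s) / q). *)
have -> : - (L * s) + L = L * q / ((1 + s) / q).
  have q2 : q ^+ 2 = 1 - s ^+ 2 by rewrite s2; ring.
  by field: q2; rewrite !gt_eqF// addr_gt0.
have Lq : 0 < L * q by rewrite mulr_gt0.
have -> : ln (L * q * ((1 + s) / q)) = ln (L * q) + ln ((1 + s) / q) by rewrite lnM.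
have -> : ln (L * q / ((1 + s) / q)) = ln (L * q) - ln ((1 + s) / q) by rewrite ln_div.
rewrite /cap -/q -/s -/sk.
have -> : G r = C / L by rewrite /L; field; rewrite !gt_eqF.
by rewrite /Z; field; rewrite !gt_eqF.
Qed.

End Energy.

Section EnergyIntegral.
Variable R : realType.
Variables beta ecc : R.
Hypotheses (hbeta : 0 < beta < 1) (hecc : 0 < ecc < 1).
Hypothesis hreg : beta ^+ 2 + ecc ^+ 2 < 1.

Local Notation w := (kinetic beta ecc).
Local Notation D := (chart_dom beta ecc).
Local Notation K := (closed_dom beta ecc).
Local Notation RM := (measurableTypeR R).
Local Notation mu := (@lebesgue_measure R).
Local Notation mu3 := ((mu \x mu) \x mu)%E.
Local Notation C := (pull beta).
Local Notation rmin := (r_min beta ecc).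
Local Notation rmax := (r_max beta ecc).

Lemma r_min_lt_r_max : rmin < rmax.
Proof.
have /andP[e0 e1] := hecc; have /andP[b0 b1] := hbeta.
by rewrite /r_min /r_max ltr_pM2r ?invr_gt0 ?mulr_gt0//; lra.
Qed.

Let m (r : R) : R := 4 * C / Num.sqrt (stretch beta) * cap (aperture beta ecc r).

Lemma continuous_cap_aperture r : 0 < r -> {for r, continuous (fun x => cap (aperture beta ecc x))}.
Proof.
move=> r0; have C0 := pull_gt0 hbeta; have G0 : 0 < barrier beta ecc r.
  by apply: lt_le_trans (gap_le_barrier hbeta hecc hreg r0); exact: gap_gt0.
apply: continuous_capE; first by apply: divr_gt0 => //; apply: mulr_gt0.
rewrite /aperture /barrier; continuous_tac; rewrite ?mulf_neq0 ?expf_neq0 ?pnatr_eq0 ?gt_eqF//.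
Qed.

Let cm r : 0 < r -> {for r, continuous m}.
Proof.
by move=> r0; apply: continuous_mul; [exact: cst_continuous_for|exact: continuous_cap_aperture].
Qed.

Let A : set (R * R) := `]0, 2 * pi[ `*` `]rmin, rmax[.

Let oA : open A.
Proof.
rewrite openE => -[t r] [ht hr]; exists (`]0, 2 * pi[%classic, `]rmin, rmax[%classic) => //.
by split; apply: open_nbhs_nbhs; split => //; exact: interval_open.
Qed.

Let section_z (p : R * R) : (\int[mu]_(z in [set z | D (p, z)])
    (on_triple (fun _ r z => 2 * w r z) (p, z))%:E =
  ((fun p => (m p.2)%:E) \_ A) p)%E.
Proof.
move: p => [t r]; rewrite patchE; case: ifPn => [|/negP]; rewrite inE.
  move=> [/=]; rewrite !in_itv/= => t0 hr.
  have r0 : 0 < r by case/andP: hr => r1 _; apply: lt_trans r1; exact: r_min_gt0.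
  rewrite (_ : [set z | _] = [set z | (0 < w r z)%R]); last first.
    by apply/seteqP; split => z; [case/chart_domP|move=> ?; apply/chart_domP].
  exact: integral_kinetic_z.
move=> nA; rewrite (_ : [set z | _] = set0) ?integral_set0// -subset0 => z.
move=> /chart_domP[t0 r0 wz]; apply: nA.
by split; rewrite /= in_itv/=; [exact: t0|exact: (region_r hbeta hecc r0 wz)].
Qed.

(** Read off from the integral that [m] represents; it is what Tonelli's theorem requires. *)
Let m_ge0 r : rmin < r < rmax -> 0 <= m r.
Proof.
move=> hr; rewrite -lee_fin -integral_kinetic_z//; apply: integral_ge0 => z /=.
by move=> wz; rewrite lee_fin mulr_ge0// ltW.
Qed.

Lemma energy_integral : \int[mu3]_(y in D) on_triple (fun _ r z => 2 * w r z) y =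
  2 * pi * \int[mu]_(r in `[rmin, rmax]) m r.
Proof.
have mr0 := r_min_gt0 hbeta hecc; have rr := r_min_lt_r_max.
have pi2 : 0 < 2 * pi :> R by rewrite mulr_gt0// pi_gt0.
have ce := fun y => @continuous_energy R beta ecc hbeta y.
have [C1 hC] := closed_dom_bounded hbeta hecc hreg ce.
have [B hB] := chart_dom_box_bound hbeta hecc hreg.
have DK := @chart_dom_closed_dom R beta ecc.
have cm' r : rmin <= r <= rmax -> {for r, continuous m}.
  by move=> /andP[r1 _]; apply: cm; exact: lt_le_trans r1.
have mi : mu.-integrable `[rmin, rmax] (EFin \o m) := continuous_itv_integrable cm'.
have mcE : (\int[mu]_(r in `]rmin, rmax[) (m r)%:E
    = (\int[mu]_(r in `[rmin, rmax]) m r)%:E)%E.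
  rewrite -(@integral_itv_bndoo _ _ _ _ true false); last first.
    apply/measurable_EFinP; apply: open_continuous_measurable_fun.
      exact: interval_open.
    by move=> x; rewrite inE/= in_itv/= => /andP[ax xb]; apply: cm'; rewrite !ltW.
  by rewrite /Rintegral fineK// integrable_fin_num.
rewrite [LHS]/Rintegral (integral_box_z (chart_dom_open hbeta) hB (fun y Dy => ce y (DK y Dy))
  (fun y Dy => hC y (DK y Dy))).
have -> : (\int[@plane_measure R]_p \int[mu]_(z in [set z | D (p, z)])
    (on_triple (fun _ r z => 2 * w r z) (p, z))%:E =
    \int[mu \x mu]_p ((fun p => (m p.2)%:E) \_ A) p)%E.
  by apply: eq_integral => p _; exact: section_z.
have mA : measurable_fun setT (((fun p => (m p.2)%:E) \_ A) : RM * RM -> \bar R).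
  apply/(measurable_restrictT _ (open_measurable2 oA))/measurable_EFinP.
  apply: continuous_measurable2 => // -[t r] [_ /=]; rewrite in_itv/= => /andP[r1 r2].
  apply: (@continuous_comp1 R _ _ m (fun p : R * R => p.2)).
    by apply: cm; exact: lt_trans r1.
  by continuous_tac.
have A_ge0 p : (0 <= ((fun p => (m p.2)%:E) \_ A) p)%E.
  rewrite patchE; case: ifPn => // /set_mem [_ /=]; rewrite in_itv/= => hr.
  by rewrite lee_fin m_ge0.
rewrite (fubini_tonelli1 _ mA A_ge0) /fubini_F.
pose c : R := \int[mu]_(r in `[rmin, rmax]) m r.
have -> : (\int[mu]_t \int[mu]_r ((fun p => (m p.2)%:E) \_ A) (t, r) =
    \int[mu]_(t in `]0%R, (2 * pi)%R[) (cst c%:E) t)%E.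
  rewrite [RHS]integral_mkcond; apply: eq_integral => t _.
  rewrite [RHS]patchE; case: ifPn => [/set_mem ht|nt].
    rewrite /= /c -mcE [RHS]integral_mkcond; apply: eq_integral => r _.
    rewrite !patchE; have -> : ((t, r) \in A) = (r \in `]rmin, rmax[%classic).
      by apply/idP/idP => /set_mem h; apply/mem_set; [case: h|split].
    by case: ifP.
  apply: integral0_eq => r _; rewrite patchE; case: ifPn => // /set_mem [ht _].
  by move: nt; rewrite notin_setE.
rewrite integral_cst//= lebesgue_measure_itv/= lte_fin pi2 sube0 -EFinM/=.
by rewrite mulrC.
Qed.

Lemma energy_integral_cap : \int[mu3]_(y in D) on_triple (fun _ r z => 2 * w r z) y =
  8 * pi * C / Num.sqrt (stretch beta) *
  \int[mu]_(r in `[rmin, rmax]) cap (aperture beta ecc r).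
Proof.
rewrite energy_integral /m RintegralZl//.
  have : 0 < Num.sqrt (stretch beta) by rewrite sqrtr_gt0 stretch_gt0.
  move: (Num.sqrt _) (pull beta) => s c s0.
  by rewrite !mulrA; congr (_ * _); field; rewrite gt_eqF.
apply: continuous_itv_integrable => r /andP[r1 _].
by apply: continuous_cap_aperture; apply: lt_le_trans r1; exact: r_min_gt0.
Qed.

(** The substitution r = x / beta gives the ellipse semi-major axis 1/2; beta then survives only in
    the factor 1 / (1 - beta), the scaling treated for [cap]. *)
Lemma aperture_scaled x : 0 < x -> aperture beta ecc (beta^-1 * x) =
  1 - (1 - apex (Num.sqrt (1 - ecc ^+ 2)) x) / (1 - beta).
Proof.
move=> x0; have /andP[b0 b1] := hbeta; have /andP[e0 e1] := hecc.
have k2 : Num.sqrt (1 - ecc ^+ 2) ^+ 2 = 1 - ecc ^+ 2.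
  by rewrite sqr_sqrtr// subr_ge0 exprn_ile1 ?ltW.
rewrite /aperture /barrier /apex k2 varpi_sqr// /pull.
by field; rewrite !gt_eqF ?subr_gt0.
Qed.

Lemma energy_integral_gt :
  2 * pi ^+ 2 * (1 - Num.sqrt (1 - ecc ^+ 2)) ^+ 2 / (beta ^+ 2 * Num.sqrt (1 + 7 * beta)) <
  \int[mu3]_(y in D) on_triple (fun _ r z => 2 * w r z) y.
Proof.
have /andP[b0 b1] := hbeta; have /andP[e0 e1] := hecc.
pose k := Num.sqrt (1 - ecc ^+ 2); rewrite -/k.
have e2 : 0 < 1 - ecc ^+ 2 by rewrite subr_gt0 exprn_ilt1 ?ltW.
have k2 : k ^+ 2 = 1 - ecc ^+ 2 by rewrite sqr_sqrtr// ltW.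
have k0 : 0 < k by rewrite sqrtr_gt0.
(* Squared, this is the condition beta^2 + ecc^2 < 1. *)
have bk : 1 - (1 - beta) < k.
  rewrite opprB addrC subrK -(@ltr_pXn2r _ 2) ?nnegrE ?ltW//.
  by rewrite k2; have := hreg; lra.
have u01 : 0 < 1 - beta < 1 by apply/andP; split; lra.
have ke : k ^+ 2 + ecc ^+ 2 = 1 by rewrite k2; ring.
have := integral_cap_scaled_gt k0 e0 ke u01 bk.
rewrite energy_integral_cap.
have -> : rmin = beta^-1 * ((1 - ecc) / 2) by rewrite /r_min; field; rewrite gt_eqF.
have -> : rmax = beta^-1 * ((1 + ecc) / 2) by rewrite /r_max; field; rewrite gt_eqF.
rewrite Rintegral_scale ?invr_gt0//; [|lra|lra|by move=> r r0; exact: continuous_cap_aperture].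
have -> : \int[mu]_(t in `[(1 - ecc) / 2, (1 + ecc) / 2]) cap (aperture beta ecc (beta^-1 * t))
  = \int[mu]_(t in `[(1 - ecc) / 2, (1 + ecc) / 2]) cap (1 - (1 - apex k t) / (1 - beta)).
  apply: eq_Rintegral => x; rewrite inE/= in_itv/= => /andP[x1 _].
  by rewrite aperture_scaled//; lra.
move: (Rintegral _ _ _) => J HJ.
have s0 : 0 < 1 + 7 * beta by lra.
have -> : Num.sqrt (stretch beta) = Num.sqrt (1 + 7 * beta) / Num.sqrt (1 - beta).
  by rewrite stretchE// sqrtrM ?sqrtrV ?ltW//; lra.
rewrite /pull; have : 0 < Num.sqrt (1 + 7 * beta) by rewrite sqrtr_gt0.
have : 0 < Num.sqrt (1 - beta) by rewrite sqrtr_gt0; lra.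
move: HJ; move: (Num.sqrt (1 - beta)) (Num.sqrt (1 + 7 * beta)) => su sk HJ su0 sk0.
have p0 := @pi_gt0 R.
(* [pull] contributes 1 - beta and [stretch] its square root, which together form the weight u sqrt
   u; beta^2 comes from [pull] and the substitution. *)
have -> : 8 * pi * ((1 - beta) / beta) / (sk / su) * (beta^-1 * J) =
    8 * pi / (beta ^+ 2 * sk) * ((1 - beta) * su * J) by field; rewrite !gt_eqF.
have -> : 2 * pi ^+ 2 * (1 - k) ^+ 2 / (beta ^+ 2 * sk) =
    8 * pi / (beta ^+ 2 * sk) * (pi * (1 - k) ^+ 2 / 4) by field; rewrite !gt_eqF.
by rewrite ltr_pM2l// divr_gt0 ?mulr_gt0 ?exprn_gt0.
Qed.

End EnergyIntegral.

(** * The Kepler orbit *)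

Section KeplerEquation.
Variable R : realType.
Variable ecc : R.
Hypothesis hecc : 0 < ecc < 1.

(** Kepler's equation: the mean anomaly, proportional to time, as a function of the eccentric
    anomaly. Its inverse [anomaly] is not elementary and is obtained by choice from surjectivity. *)
Definition kepler (x : R) : R := x - ecc * sin x.

Lemma kepler_derivative_gt0 x : 0 < 1 - ecc * cos x.
Proof.
have /andP[e0 e1] := hecc; have c1 := cos_le1 x.
have : ecc * cos x <= ecc * 1 by rewrite ler_pM2l.
lra.
Qed.

Lemma derive_kepler x : is_derive x (1 : R) kepler (1 - ecc * cos x).
Proof. by rewrite /kepler; derive_tac; ring. Qed.

Lemma kepler_lt x y : x < y -> kepler x < kepler y.
Proof.
move=> xy; apply: (@derive_gt0_lt R kepler (fun x => 1 - ecc * cos x)) => [//||].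
- by move=> t _; exact: is_derive_continuous (derive_kepler t).
- by move=> t _; exact: kepler_derivative_gt0.
Qed.

Lemma kepler_inj : injective kepler.
Proof.
move=> x y E; case: (ltgtP x y) => // /kepler_lt; by rewrite E ltxx.
Qed.

Lemma kepler_onto t : exists x, kepler x = t.
Proof.
have /andP[e0 e1] := hecc.
(* Since ecc < 1, [kepler x] differs from [x] by less than 1, so t - 1 and t + 1 bracket a
   solution. *)
have [s1 s2] : -1 <= sin (t - 1) /\ sin (t + 1) <= 1 by rewrite sin_geN1 sin_le1.
have h1 : ecc * -1 <= ecc * sin (t - 1) by rewrite ler_pM2l.
have h2 : ecc * sin (t + 1) <= ecc * 1 by rewrite ler_pM2l.
have tt : t - 1 <= t + 1 by lra.
have [|||x _ xt] := @IVT R kepler (t - 1) (t + 1) t.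
- exact: tt.
- apply/continuous_in_subspaceT => x _.
  exact: is_derive_continuous (derive_kepler x).
- rewrite /kepler ge_min le_max; apply/andP; split; apply/orP; [left|right]; lra.
by exists x.
Qed.

Definition anomaly (t : R) : R := projT1 (cid (kepler_onto t)).

Lemma anomalyK t : kepler (anomaly t) = t.
Proof. by rewrite /anomaly; case: cid. Qed.

Lemma keplerK x : anomaly (kepler x) = x.
Proof. by apply: kepler_inj; rewrite anomalyK. Qed.

Lemma derive_anomaly t : is_derive t (1 : R) anomaly (1 - ecc * cos (anomaly t))^-1.
Proof.
rewrite -{1}(anomalyK t); apply: (@is_derive_inverse R kepler).
- by near=> x; exact: keplerK.
- by near=> x; exact: is_derive_continuous (derive_kepler x).
- by rewrite gt_eqF// kepler_derivative_gt0.
Unshelve. all: by end_near. Qed.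

Lemma anomaly0 : anomaly 0 = 0.
Proof. by apply: kepler_inj; rewrite anomalyK /kepler sin0; ring. Qed.

Lemma anomalyN t : anomaly (- t) = - anomaly t.
Proof.
by apply: kepler_inj; rewrite anomalyK -{1}(anomalyK t) /kepler sinN; ring.
Qed.

Lemma anomalyD2pi t : anomaly (t + 2 * pi) = anomaly t + 2 * pi.
Proof.
apply: kepler_inj; rewrite anomalyK -{1}(anomalyK t) /kepler mulr_natl sinD2pi; ring.
Qed.

End KeplerEquation.

Section KeplerOrbit.
Variable R : realType.
Variables beta ecc : R.
Hypotheses (hbeta : 0 < beta < 1) (hecc : 0 < ecc < 1).
Local Notation M := (surface beta ecc).
Local Notation H := (@Ham R beta ecc).

(** On z = 0 the two attractions add up to -1 / (beta r), a Kepler problem with parameter mu = 1 /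
    beta. At energy -1 its semi-major axis is a = mu / 2, its mean motion sqrt (mu / a^3) = sqrt 2 /
    a, and the radius is a (1 - ecc cos E). *)
Definition semi_axis : R := (2 * beta)^-1.
Definition mean_motion : R := Num.sqrt 2 / semi_axis.
Definition ecc_anomaly (t : R) : R := anomaly hecc (mean_motion * t).
Definition orbit_r (t : R) : R := semi_axis * (1 - ecc * cos (ecc_anomaly t)).
Definition orbit_p (t : R) : R :=
  Num.sqrt 2 * ecc * sin (ecc_anomaly t) / (1 - ecc * cos (ecc_anomaly t)).
Definition kepler_period : R := Num.sqrt 2 * pi * semi_axis.
Definition kepler_orbit (t : R) : 'rV[R]_4 := vec4 (orbit_p t) 0 (orbit_r t) 0.

Lemma semi_axis_gt0 : 0 < semi_axis.
Proof. by have /andP[b0 b1] := hbeta; rewrite invr_gt0 mulr_gt0. Qed.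

Lemma sqrt2_gt0 : 0 < Num.sqrt 2 :> R.
Proof. by rewrite sqrtr_gt0. Qed.

Lemma sqr_sqrt2 : Num.sqrt 2 ^+ 2 = 2 :> R.
Proof. by rewrite sqr_sqrtr. Qed.

Lemma orbit_r_gt0 t : 0 < orbit_r t.
Proof. by rewrite mulr_gt0 ?semi_axis_gt0 ?(kepler_derivative_gt0 hecc). Qed.

Lemma kepler_period_gt0 : 0 < kepler_period.
Proof. by rewrite !mulr_gt0 ?pi_gt0 ?semi_axis_gt0 ?sqrt2_gt0. Qed.

Lemma derive_ecc_anomaly t :
  is_derive t (1 : R) ecc_anomaly (mean_motion / (1 - ecc * cos (ecc_anomaly t))).
Proof.
have d1 : is_derive t (1 : R) (fun s => mean_motion * s) mean_motion by derive_tac; ring.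
have := derive_comp1 (derive_anomaly hecc (mean_motion * t)) d1.
by rewrite -/(ecc_anomaly t) mulrC.
Qed.

Lemma ecc_anomaly0 : ecc_anomaly 0 = 0.
Proof. by rewrite /ecc_anomaly mulr0 anomaly0. Qed.

Lemma ecc_anomalyN t : ecc_anomaly (- t) = - ecc_anomaly t.
Proof. by rewrite /ecc_anomaly mulrN anomalyN. Qed.

Lemma ecc_anomalyD t : ecc_anomaly (t + kepler_period) = ecc_anomaly t + 2 * pi.
Proof.
rewrite /ecc_anomaly mulrDr -anomalyD2pi; congr anomaly; congr (_ + _).
have a0 := semi_axis_gt0; have := sqr_sqrt2; rewrite /mean_motion /kepler_period.
by move: (Num.sqrt 2) => s s2; field: s2; rewrite gt_eqF.
Qed.

Lemma derive_orbit_r t : is_derive t (1 : R) orbit_r (orbit_p t).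
Proof.
have a0 := semi_axis_gt0; have q0 := kepler_derivative_gt0 hecc (ecc_anomaly t).
have de := derive_ecc_anomaly t; rewrite /orbit_r; derive_tac.
by rewrite /orbit_p /mean_motion; field; rewrite !gt_eqF.
Qed.

Lemma dist_z0 (r : R) : 0 < r -> dist beta r 0 = r.
Proof. by move=> r0; rewrite /dist expr0n/= mulr0 addr0 sqrtr_sqr gtr0_norm. Qed.

Lemma force_z_z0 (r : R) : force_z beta r 0 = 0.
Proof. by rewrite /force_z mulr0 mul0r oppr0. Qed.

Lemma derive_orbit_p t : is_derive t (1 : R) orbit_p (force_r beta ecc (orbit_r t) 0).
Proof.
have /andP[b0 b1] := hbeta.
have a0 := semi_axis_gt0; have q0 := kepler_derivative_gt0 hecc (ecc_anomaly t).
have de := derive_ecc_anomaly t; have r0 := orbit_r_gt0 t.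
rewrite /orbit_p; derive_tac; rewrite ?gt_eqF//.
rewrite /force_r dist_z0// varpi_sqr// /orbit_r /mean_motion /semi_axis /pull.
have := cos2Dsin2 (ecc_anomaly t); have := sqr_sqrt2; move: q0.
move: (cos _) (sin _) (Num.sqrt 2) => c s w q0 w2 cs.
have {}cs : s ^+ 2 = 1 - c ^+ 2 by lra.
by field: w2 cs; rewrite !gt_eqF.
Qed.

Lemma orbit_p_sqr t : orbit_p t ^+ 2 = 2 * kinetic beta ecc (orbit_r t) 0.
Proof.
have /andP[b0 b1] := hbeta; have r0 := orbit_r_gt0 t.
have a0 := semi_axis_gt0; have q0 := kepler_derivative_gt0 hecc (ecc_anomaly t).
rewrite kineticE// dist_z0// /barrier varpi_sqr// /orbit_p /orbit_r /semi_axis /pull.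
have := cos2Dsin2 (ecc_anomaly t); have := sqr_sqrt2; move: q0.
move: (cos _) (sin _) (Num.sqrt 2) => c s w q0 w2 cs.
have {}cs : s ^+ 2 = 1 - c ^+ 2 by lra.
by field: w2 cs; rewrite !gt_eqF.
Qed.

Lemma orbit_rD t : orbit_r (t + kepler_period) = orbit_r t.
Proof. by rewrite /orbit_r ecc_anomalyD mulr_natl cosD2pi. Qed.

Lemma orbit_pD t : orbit_p (t + kepler_period) = orbit_p t.
Proof. by rewrite /orbit_p ecc_anomalyD mulr_natl cosD2pi sinD2pi. Qed.

Lemma orbit_rN t : orbit_r (- t) = orbit_r t.
Proof. by rewrite /orbit_r ecc_anomalyN cosN. Qed.

Lemma orbit_pN t : orbit_p (- t) = - orbit_p t.
Proof. by rewrite /orbit_p ecc_anomalyN cosN sinN mulrN mulNr. Qed.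

Lemma kepler_orbit_periodic : periodic_orbit beta ecc kepler_orbit kepler_period.
Proof.
split => [|t|t|t]; first exact: kepler_period_gt0.
- apply/surfaceE => //; rewrite !vec4E expr0n/= addr0; split; first exact: orbit_r_gt0.
  exact: orbit_p_sqr.
- rewrite ham_fieldE// !vec4E; last exact: orbit_r_gt0.
  rewrite force_z_z0; notypeclasses refine (derive_vec4 _ _ _ _).
  + exact: derive_orbit_p.
  + exact: derive_const.
  + exact: derive_orbit_r.
  + exact: derive_const.
- by rewrite /kepler_orbit orbit_pD orbit_rD.
Qed.

End KeplerOrbit.

(** * The action of the Kepler orbit *)

Section Rectangle.
Variable R : realType.
Notation RM := (measurableTypeR R).
Notation mu := (@lebesgue_measure R).
Notation mu2 := (@plane_measure R).
Variables (a b c d : R).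

Lemma rectangle_bounded (f : R * R -> R) : (forall p, {for p, continuous f}) ->
  exists C, forall p, a <= p.1 <= b -> c <= p.2 <= d -> `|f p| <= C.
Proof.
move=> fc; have K : compact (`[a, b] `*` `[c, d] : set (R * R)).
  by apply: compact_setX; exact: segment_compact.
have fK : {within (`[a, b] `*` `[c, d] : set (R * R)), continuous f}.
  by apply/continuous_in_subspaceT => p _; exact: fc.
have [M [_ MC]] := compact_bounded (continuous_compact fK K).
exists (M + 1) => p p1 p2; apply: (MC (M + 1)); first by rewrite ltrDl.
by exists p => //; split; rewrite /= in_itv.
Qed.

Lemma rectangle_exchange (f : R * R -> R) : (forall p, {for p, continuous f}) ->
  (\int[mu]_(x in `]a, b[) \int[mu]_(y in `]c, d[) (f (x, y))%:E =
   \int[mu]_(y in `]c, d[) \int[mu]_(x in `]a, b[) (f (x, y))%:E)%E.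
Proof.
move=> fc; pose S : set (RM * RM) := `]a, b[ `*` `]c, d[.
have mS : measurable S by apply: measurableX; exact: measurable_itv.
have itv_fin (x y : R) : (mu `]x, y[ < +oo)%E.
  by rewrite lebesgue_measure_itv/= -EFinD; case: ifP; rewrite ltry.
have S_fin : ((mu \x mu)%E S < +oo)%E.
  rewrite /S product_measure1E; [|exact: measurable_itv|exact: measurable_itv].
  apply: lte_mul_pinfty => //; last exact: itv_fin.
  by rewrite ge0_fin_numE// itv_fin.
have mf : measurable_fun S f.
  apply: (@measurable_funS _ _ _ _ setT) => //.
  by apply: continuous_measurable2 => [|p _]; [exact: openT|exact: fc].
pose G : RM * RM -> R := f \_ S.
have mG : measurable_fun setT G by exact/(measurable_restrictT _ mS).
have [C fC] := rectangle_bounded fc.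
have GC p : `|G p| <= Num.max C 0.
  rewrite /G patchE; case: ifPn => [|_]; last by rewrite normr0 le_max lexx orbT.
  rewrite inE => -[/=]; rewrite !in_itv/= => /andP[x1 x2] /andP[y1 y2].
  by rewrite le_max fC// ?(ltW x1) ?(ltW x2) ?(ltW y1) ?(ltW y2).
have iG : (mu \x mu)%E.-integrable setT (EFin \o G).
  apply: (@bounded_support_integrable _ (RM * RM)%type R (mu \x mu)%E S G
    (Num.max C 0)) => // p Sp.
  by rewrite /G patchE; case: ifPn => //; rewrite inE.
have GE x y : G (x, y) = if (x \in `]a, b[%classic) && (y \in `]c, d[%classic) then f (x, y) else 0.
  by rewrite /G patchE /S in_setX.
have Fub := @Fubini _ _ RM RM R mu mu _ iG.
rewrite integral_mkcond [RHS]integral_mkcond.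
transitivity (\int[mu]_x \int[mu]_y (G (x, y))%:E)%E.
  apply: eq_integral => x _; rewrite patchE; case: ifPn => xI.
    rewrite integral_mkcond; apply: eq_integral => y _.
    by rewrite patchE GE xI/=; case: ifP.
  by apply/esym; under eq_integral => y _ do rewrite GE (negbTE xI)/=; rewrite integral0.
refine (etrans Fub _); apply/esym.
apply: eq_integral => y _; rewrite patchE; case: ifPn => yI.
  rewrite integral_mkcond; apply: eq_integral => x _.
  by rewrite patchE /= GE yI andbT; case: ifP.
by apply/esym; under eq_integral => x _ do rewrite /= GE (negbTE yI) andbF; rewrite integral0.
Qed.

(** Stokes' theorem for a closed 1-form on a rectangle: [A] and [G] are its coefficients, and
    closedness is the existence of a common mixed derivative [D]. Fubini for [D] leaves the four
    boundary integrals. *)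
Lemma rectangle_green (A G D : R -> R -> R) : a < b -> c < d ->
  (forall p : R * R, {for p, continuous (fun p => D p.1 p.2)}) ->
  (forall t s, is_derive s (1 : R) (A t) (D t s)) ->
  (forall t s, is_derive t (1 : R) (fun t => G t s) (D t s)) ->
  (\int[mu]_(t in `]a, b[) (A t d - A t c)%:E =
   \int[mu]_(s in `]c, d[) (G b s - G a s)%:E)%E.
Proof.
move=> ab cd Dc dA dG.
have := rectangle_exchange Dc => /= E.
have cr (t s : R) : {for s, continuous (fun s => (t, s))}.
  apply: (@cvg_pair _ _ _ (nbhs s) (nbhs t) (nbhs s) _ _ _ (fun=> t) (fun s => s)).
    exact: cst_continuous_for.
  exact: cvg_id.
have cl (s t : R) : {for t, continuous (fun t => (t, s))}.
  apply: (@cvg_pair _ _ _ (nbhs t) (nbhs t) (nbhs s) _ _ _ (fun t => t) (fun=> s)).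
    exact: cvg_id.
  exact: cst_continuous_for.
have E1 t : (\int[mu]_(s in `]c, d[) (D t s)%:E = (A t d - A t c)%:E)%E.
  apply: integral_FTC_oo => //.
  - by move=> s _; exact: (@continuous_comp _ _ _ (fun s => (t, s)) _ s (cr t s) (Dc _)).
  - exact: is_derive_continuous (dA t c).
  - exact: is_derive_continuous (dA t d).
have E2 s : (\int[mu]_(t in `]a, b[) (D t s)%:E = (G b s - G a s)%:E)%E.
  apply: (@integral_FTC_oo R (fun t => D t s) (fun t => G t s)) => //.
  - by move=> t _; exact: (@continuous_comp _ _ _ (fun t => (t, s)) _ t (cl s t) (Dc _)).
  - exact: is_derive_continuous (dG a s).
  - exact: is_derive_continuous (dG b s).
transitivity (\int[mu]_(t in `]a, b[) \int[mu]_(s in `]c, d[) (D t s)%:E)%E.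
  by apply: eq_integral => t _; rewrite E1.
by rewrite E; apply: eq_integral => s _; rewrite E2.
Qed.

End Rectangle.

Section PeriodicPrimitive.
Variable R : realType.

(** Both increments are integrals of [f] over [x, y], since [F] shifted by a period is again a
    primitive of [f]. *)
Lemma periodic_primitive (f F : R -> R) (a b T x y : R) :
  (forall t, {for t, continuous f}) -> (forall t, f (t + T) = f t) ->
  (forall t, a < t < b -> is_derive t (1 : R) F (f t)) ->
  0 < T -> a < x -> x < y -> y + T < b -> F (y + T) - F (x + T) = F y - F x.
Proof.
move=> fc fT dF T0 ax xy yb.
have dF' t : x <= t <= y -> is_derive t (1 : R) F (f t).
  by move=> /andP[xt ty]; apply: dF; apply/andP; split; lra.
have dG t : x <= t <= y -> is_derive t (1 : R) (fun t => F (t + T)) (f t).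
  move=> /andP[xt ty].
  have d1 : is_derive t (1 : R) (fun t => t + T) 1 by derive_tac; ring.
  have d2 : is_derive (t + T) (1 : R) F (f (t + T)) by apply: dF; apply/andP; split; lra.
  by have := @derive_comp1 R t F (fun t => t + T) _ _ d2 d1; rewrite fT mulr1.
have W t : x < t < y -> x <= t <= y by move=> /andP[? ?]; rewrite !ltW.
have I1 := @Rintegral_FTC R f F x y xy (fun t _ => fc t) (fun t ht => dF' t (W t ht)).
have I2 := @Rintegral_FTC R f (fun t => F (t + T)) x y xy (fun t _ => fc t)
  (fun t ht => dG t (W t ht)).
have hx : x <= x <= y by rewrite lexx ltW.
have hy : x <= y <= y by rewrite lexx ltW.
rewrite -I1; [rewrite -I2//|exact: is_derive_continuous (dF' _ hx)|
  exact: is_derive_continuous (dF' _ hy)].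
- exact: is_derive_continuous (dG _ hx).
- exact: is_derive_continuous (dG _ hy).
Qed.

End PeriodicPrimitive.

(** * The integral of [p_r ^+ 2] along the ellipse *)

Section KineticPrimitive.
Variable R : realType.
Variables beta ecc : R.
Hypotheses (hbeta : 0 < beta < 1) (hecc : 0 < ecc < 1).

Local Notation kap := (Num.sqrt (1 - ecc ^+ 2)).
Local Notation E := (ecc_anomaly beta hecc).
Local Notation T := (kepler_period beta).

(** With ecc = sin(phi) this is tan(phi / 2), whence the rational expressions for [ecc] and [kap] in
    [focal_bounds]. *)
Definition focal : R := (1 - kap) / ecc.

(* The antiderivative of [e^2 sin^2 E / (1 - e cos E)] is elementary because
   [1 - e cos E] is proportional to [|1 - b exp(i E)|^2] with [b = (1 - kap) / e]. *)
Definition kinetic_primitive (t : R) : R :=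
  Num.sqrt 2 * semi_axis beta * (E t + ecc * sin (E t) - kap *
    (E t + 2 * atan (focal * sin (E t) / (1 - focal * cos (E t))))).

Lemma focal_bounds : 0 < focal < 1 /\
  ecc = 2 * focal / (1 + focal ^+ 2) /\ kap = (1 - focal ^+ 2) / (1 + focal ^+ 2).
Proof.
have /andP[e0 e1] := hecc.
have q : 0 < 1 - ecc ^+ 2 by rewrite subr_gt0 expr_lt1// ltW.
have k0 : 0 < kap by rewrite sqrtr_gt0.
have k2 : kap ^+ 2 = 1 - ecc ^+ 2 by rewrite sqr_sqrtr// ltW.
rewrite /focal; move: k0 k2; move: (Num.sqrt _) => k k0 k2.
have k1 : k < 1 by rewrite -(@ltr_pXn2r _ 2)// ?nnegrE ?ltW// expr1n k2; have := exprn_gt0 2 e0; lra.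
have ek : 1 - k < ecc by rewrite -(@ltr_pXn2r _ 2)// ?nnegrE ?ltW ?subr_gt0//; nra.
have s : 1 + ((1 - k) / ecc) ^+ 2 = 2 * (1 - k) / ecc ^+ 2.
  by have e2 : ecc ^+ 2 = 1 - k ^+ 2 by [lra]; field: e2; rewrite gt_eqF.
have hk : 1 - k != 0 by rewrite subr_eq0 eq_sym lt_eqF.
rewrite s; split; first by rewrite divr_gt0 ?subr_gt0//= ltr_pdivrMr// mul1r.
have e2 : ecc ^+ 2 = 1 - k ^+ 2 by lra.
by split; field: e2; rewrite hk gt_eqF.
Qed.

(** The bracket multiplied by [kap] is the true anomaly, whose derivative in E is kap / (1 - e cos
    E). What remains is 1 + e cos E - kap^2 / (1 - e cos E) = e^2 sin^2 E / (1 - e cos E). *)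
Lemma derive_kinetic_primitive t :
  is_derive t (1 : R) kinetic_primitive (orbit_p beta hecc t ^+ 2).
Proof.
have [/andP[b0 b1] [eE kE]] := focal_bounds.
have q0 := kepler_derivative_gt0 hecc (E t).
have a0 := semi_axis_gt0 hbeta.
have p0 : 0 < 1 - focal * cos (E t).
  by have := kepler_derivative_gt0 (introT andP (conj b0 b1)) (E t).
have de := derive_ecc_anomaly beta hecc t.
rewrite /kinetic_primitive; derive_tac; first by rewrite gt_eqF.
rewrite /orbit_p /mean_motion kE.
have cs := cos2Dsin2 (E t); move: q0 p0 cs sqrt2_gt0 (sqr_sqrt2 R).
move: (cos _) (sin _) (Num.sqrt 2) focal b0 b1 eE => c s w b b0 b1 eE q0 p0 cs w0 w2.
have {}cs : s ^+ 2 = 1 - c ^+ 2 by lra.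
have {}w2 : w ^+ 2 = 2 by [].
have f0 : 0 < 1 + b ^+ 2 by rewrite ltr_pwDl ?sqr_ge0.
have f1 : 0 < 1 - 2 * b * c + b ^+ 2.
  have := mulr_gt0 f0 q0; rewrite eE (_ : _ * (1 - _) = 1 - 2 * b * c + b ^+ 2)//.
  by field; rewrite gt_eqF.
have u2 : 1 + (b * s / (1 - b * c)) ^+ 2 = (1 - 2 * b * c + b ^+ 2) / (1 - b * c) ^+ 2.
  by field: cs; rewrite gt_eqF.
have q1 : 1 - ecc * c = (1 - 2 * b * c + b ^+ 2) / (1 + b ^+ 2).
  by rewrite eE; field; rewrite gt_eqF.
rewrite u2 q1; move: (E t) (atan _) => x y; rewrite eE.
by field: w2 cs; rewrite !gt_eqF// exprn_gt0.
Qed.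

(** Over a period E grows by 2 pi, while the sine and the arctangent return to 0. *)
Lemma kinetic_primitive_period : kinetic_primitive T - kinetic_primitive 0 =
  Num.sqrt 2 * pi * (1 - kap) / beta.
Proof.
have /andP[b0 b1] := hbeta.
have ET : E T = 2 * pi by rewrite -[T in E T]add0r ecc_anomalyD// ecc_anomaly0 add0r.
rewrite /kinetic_primitive ET ecc_anomaly0 sin0 (_ : sin (2 * pi) = 0); last first.
  by rewrite mulr_natl sin2pi.
by rewrite !mulr0 !mul0r atan0 /semi_axis; field; rewrite gt_eqF.
Qed.

End KineticPrimitive.

Section KeplerAction.
Variable R : realType.
Variables beta ecc : R.
Variable lam : 'rV[R]_4 -> 'rV[R]_4.
Hypotheses (hbeta : 0 < beta < 1) (hecc : 0 < ecc < 1).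
Hypothesis hlam : adapted_contact_form beta ecc lam.

Local Notation mu := (@lebesgue_measure R).
Local Notation M := (surface beta ecc).
Local Notation P := (orbit_p beta hecc).
Local Notation r := (orbit_r beta hecc).
Local Notation T := (kepler_period beta).
Local Notation g := (kepler_orbit beta hecc).
Local Notation kap := (Num.sqrt (1 - ecc ^+ 2)).

(* Rotating the momentum of the planar orbit by the angle [s] sweeps a disc in
   the energy surface bounded by the orbit and its time reversal. *)
Definition swept (t s : R) : 'rV[R]_4 := vec4 (P t * cos s) (P t * sin s) (r t) 0.

Definition accel (t : R) : R := force_r beta ecc (r t) 0.

(** [swept_t] and [swept_s] are the values of [lam] on the two coordinate vectors of the disc;
    [swept_mixed] is the derivative of [swept_s] in [t]. *)
Definition swept_t (t s : R) : R :=
  lam (swept t s) 0 ipr * (accel t * cos s) + lam (swept t s) 0 ipz * (accel t * sin s)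
  + lam (swept t s) 0 ir * P t.

Definition swept_s (t s : R) : R :=
  P t * (cos s * lam (swept t s) 0 ipz - sin s * lam (swept t s) 0 ipr).

Definition swept_jac (t s : R) i : R :=
  accel t * cos s * jac lam ipr i (swept t s) + accel t * sin s * jac lam ipz i (swept t s)
  + P t * jac lam ir i (swept t s) + 0 * jac lam iz i (swept t s).

Definition swept_mixed (t s : R) : R :=
  accel t * (cos s * lam (swept t s) 0 ipz - sin s * lam (swept t s) 0 ipr)
  + P t * (cos s * swept_jac t s ipz - sin s * swept_jac t s ipr).

Lemma swept_surface t s : M (swept t s).
Proof.
apply/surfaceE; rewrite !vec4E; split; first exact: orbit_r_gt0.
rewrite -(orbit_p_sqr hbeta) // -[RHS]mulr1 -(cos2Dsin2 s); ring.
Qed.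

Lemma derive_swept_t t s : is_derive t (1 : R) (fun t => swept t s)
  (vec4 (accel t * cos s) (accel t * sin s) (P t) 0).
Proof.
have dP := derive_orbit_p hbeta hecc t; have dr := derive_orbit_r hbeta hecc t.
rewrite -/(accel t) in dP; notypeclasses refine (derive_vec4 _ _ _ _).
- by derive_tac; ring.
- by derive_tac; ring.
- exact: dr.
- exact: derive_const.
Qed.

Lemma derive_swept_s t s : is_derive s (1 : R) (swept t)
  (vec4 (- (P t * sin s)) (P t * cos s) 0 0).
Proof.
rewrite /swept; notypeclasses refine (derive_vec4 _ _ _ _).
- by derive_tac; ring.
- by derive_tac; ring.
- exact: derive_const.
- exact: derive_const.
Qed.

Lemma derive_swept_s_in_t t s :
  is_derive t (1 : R) (fun t => swept_s t s) (swept_mixed t s).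
Proof.
have key (p l1 l2 : R -> R) (p' a b : R) : is_derive t (1 : R) p p' ->
    is_derive t (1 : R) l1 a -> is_derive t (1 : R) l2 b ->
    is_derive t (1 : R) (fun t => p t * (cos s * l2 t - sin s * l1 t))
      (p' * (cos s * l2 t - sin s * l1 t) + p t * (cos s * b - sin s * a)).
  by move=> dp d1 d2; derive_tac; ring.
have dl i := @derive_form_comp R beta ecc lam hlam (fun t => swept t s) t _ _ _ _ i
  (swept_surface t s) (derive_swept_t t s).
exact: (key _ _ _ _ _ _ (derive_orbit_p hbeta hecc t) (dl ipr) (dl ipz)).
Qed.

(** On the coordinate vectors of the disc omega equals P^2 sin s, so subtracting P^2 cos s from
    [swept_t] makes the 1-form closed, as [rectangle_green] requires. *)
Lemma derive_swept_t_in_s t s : is_derive s (1 : R)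
  (fun s => swept_t t s - P t ^+ 2 * cos s) (swept_mixed t s).
Proof.
have dl i := @derive_form_comp R beta ecc lam hlam (swept t) s _ _ _ _ i
  (swept_surface t s) (derive_swept_s t s).
have E1 : swept t s 0 ipr * (accel t * cos s) + swept t s 0 ipz * (accel t * sin s)
  - force_r beta ecc (swept t s 0 ir) (swept t s 0 iz) * P t
  - force_z beta (swept t s 0 ir) (swept t s 0 iz) * 0 = 0.
  have cs : sin s ^+ 2 = 1 - cos s ^+ 2 by have := cos2Dsin2 s; lra.
  by rewrite !vec4E -/(accel t); ring: cs.
have E2 : swept t s 0 ipr * (- (P t * sin s)) + swept t s 0 ipz * (P t * cos s)
  - force_r beta ecc (swept t s 0 ir) (swept t s 0 iz) * 0
  - force_z beta (swept t s 0 ir) (swept t s 0 iz) * 0 = 0 by rewrite !vec4E; ring.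
have := @adapted_closed_coord R beta ecc lam hbeta hlam _ _ _ _ _ _ _ _ _
  (swept_surface t s) E1 E2.
have d1 := dl ipr; have d2 := dl ipz; have d3 := dl ir; move: d1 d2 d3 => {dl E1 E2}.
rewrite /swept_t /swept_mixed /swept_jac.
generalize (jac lam ipr ipr (swept t s)) (jac lam ipr ipz (swept t s)) (jac lam ipr ir (swept t s))
  (jac lam ipr iz (swept t s)) (jac lam ipz ipr (swept t s)) (jac lam ipz ipz (swept t s))
  (jac lam ipz ir (swept t s)) (jac lam ipz iz (swept t s)) (jac lam ir ipr (swept t s))
  (jac lam ir ipz (swept t s)) (jac lam ir ir (swept t s)) (jac lam ir iz (swept t s))
  (jac lam iz ipr (swept t s)) (jac lam iz ipz (swept t s)) (jac lam iz ir (swept t s))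
  (jac lam iz iz (swept t s)).
move=> j11 j12 j13 j14 j21 j22 j23 j24 j31 j32 j33 j34 j41 j42 j43 j44 d1 d2 d3 C.
derive_tac.
have cs := cos2Dsin2 s.
move: C cs; generalize (accel t) (P t) (cos s) (sin s) (lam (swept t s) 0 ipr)
  (lam (swept t s) 0 ipz) (lam (swept t s) 0 ir).
move=> F p c q l1 l2 l3 C cs; apply/eqP; rewrite -subr_eq0; apply/eqP.
move/eqP: C; rewrite -subr_eq0 => /eqP C.
rewrite -[RHS]oppr0 -[in RHS]C.
have {}cs : q ^+ 2 = 1 - c ^+ 2 by lra.
by ring: cs.
Qed.

Lemma continuous_orbit_p t : {for t, continuous P}.
Proof. exact: is_derive_continuous (derive_orbit_p hbeta hecc t). Qed.

Lemma continuous_orbit_r t : {for t, continuous r}.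
Proof. exact: is_derive_continuous (derive_orbit_r hbeta hecc t). Qed.

Lemma continuous_accel t : {for t, continuous accel}.
Proof.
apply: (@continuous_force_r R beta ecc hbeta _ r (fun=> 0)).
- exact: orbit_r_gt0.
- exact: continuous_orbit_r.
- exact: cst_continuous_for.
Qed.

Lemma continuous_swept (p : R * R) : {for p, continuous (fun p => swept p.1 p.2)}.
Proof.
have cP := @continuous_comp1 R _ p P fst (@continuous_orbit_p p.1) (@continuous_fst1 _ p R R (fun p => p) (@cvg_id _ _)).
have cr := @continuous_comp1 R _ p r fst (@continuous_orbit_r p.1) (@continuous_fst1 _ p R R (fun p => p) (@cvg_id _ _)).
have cs : {for p, continuous (fun p : R * R => sin p.2)} by continuous_tac.
have cc : {for p, continuous (fun p : R * R => cos p.2)} by continuous_tac.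
apply: continuous_vec4.
- exact: continuous_mul cP cc.
- exact: continuous_mul cP cs.
- exact: cr.
- exact: cst_continuous_for.
Qed.

Lemma continuous_swept_mixed (p : R * R) :
  {for p, continuous (fun p => swept_mixed p.1 p.2)}.
Proof.
have cP := @continuous_comp1 R _ p P fst (@continuous_orbit_p p.1) (@continuous_fst1 _ p R R (fun p => p) (@cvg_id _ _)).
have cF := @continuous_comp1 R _ p accel fst (@continuous_accel p.1) (@continuous_fst1 _ p R R (fun p => p) (@cvg_id _ _)).
have cl i := @continuous_form_comp R beta ecc lam hlam _ (fun p : R * R => swept p.1 p.2) p i
  (swept_surface p.1 p.2) (@continuous_swept p).
have cj j i := @continuous_jac_comp R beta ecc lam hlam _ (fun p : R * R => swept p.1 p.2) p j i
  (swept_surface p.1 p.2) (@continuous_swept p).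
have cs : {for p, continuous (fun p : R * R => sin p.2)} by continuous_tac.
have cc : {for p, continuous (fun p : R * R => cos p.2)} by continuous_tac.
have cJ i : {for p, continuous (fun p => swept_jac p.1 p.2 i)}.
  rewrite /swept_jac.
  apply: continuous_add; last exact: continuous_mul (@cst_continuous_for _ _ _ _) (cj _ _).
  apply: continuous_add; last exact: continuous_mul cP (cj _ _).
  apply: continuous_add.
    exact: continuous_mul (continuous_mul cF cc) (cj _ _).
  exact: continuous_mul (continuous_mul cF cs) (cj _ _).
have rot (u v : R * R -> R) : {for p, continuous u} -> {for p, continuous v} ->
  {for p, continuous (fun p : R * R => cos p.2 * u p - sin p.2 * v p)}.
  by move=> cu cv; apply: continuous_add; [exact: continuous_mul cc cu|
    exact: continuous_opp (continuous_mul cs cv)].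
apply: continuous_add.
- exact: continuous_mul cF (rot _ _ (cl ipz) (cl ipr)).
- exact: continuous_mul cP (rot _ _ (cJ ipz) (cJ ipr)).
Qed.

End KeplerAction.

Section OrbitAction.
Variable R : realType.
Variables beta ecc : R.
Variable lam : 'rV[R]_4 -> 'rV[R]_4.
Hypotheses (hbeta : 0 < beta < 1) (hecc : 0 < ecc < 1).
Hypothesis hlam : adapted_contact_form beta ecc lam.

Local Notation mu := (@lebesgue_measure R).
Local Notation M := (surface beta ecc).
Local Notation H := (@Ham R beta ecc).

Lemma orbit_velocity (c : R -> 'rV[R]_4) T t : periodic_orbit beta ecc c T ->
  derive1 c t = ham_field H (c t).
Proof. by move=> [_ _ dc _]; rewrite derive1E; have [_ ->] := dc t. Qed.

Lemma continuous_action_density (c : R -> 'rV[R]_4) T t : periodic_orbit beta ecc c T ->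
  {for t, continuous (fun t => pairing (lam (c t)) (derive1 c t))}.
Proof.
move=> hc; have [_ Mc dc _] := hc.
have cc : {for t, continuous c}.
  by have [cd _] := dc t; exact/differentiable_continuous/derivable1_diffP.
have cx i : {for t, continuous (fun t => c t 0 i)}.
  by apply: (@continuous_comp _ _ _ c (fun N : 'rV[R]_4 => N 0 i)) => //; exact: coord_continuous.
have r0 : 0 < c t 0 ir by case: (Mc t).
rewrite (_ : (fun t => _) = fun t =>
  lam (c t) 0 ipr * force_r beta ecc (c t 0 ir) (c t 0 iz)
  + lam (c t) 0 ipz * force_z beta (c t 0 ir) (c t 0 iz)
  + lam (c t) 0 ir * c t 0 ipr + lam (c t) 0 iz * c t 0 ipz); last first.
  apply/funext => s; have s0 : 0 < c s 0 ir by case: (Mc s).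
  by rewrite pairingE (orbit_velocity _ hc) ham_fieldE// !vec4E.
have cl i := @continuous_form_comp R beta ecc lam hlam _ c t i (Mc t) cc.
have cr := @continuous_force_r R beta ecc hbeta _ (fun t => c t 0 ir) (fun t => c t 0 iz)
  t r0 (cx _) (cx _).
have cz := @continuous_force_z R beta hbeta _ (fun t => c t 0 ir) (fun t => c t 0 iz)
  t r0 (cx _) (cx _).
apply: continuous_add; last exact: continuous_mul (cl _) (cx _).
apply: continuous_add; last exact: continuous_mul (cl _) (cx _).
by apply: continuous_add; [exact: continuous_mul (cl _) cr|exact: continuous_mul (cl _) cz].
Qed.

Lemma action_density_periodic (c : R -> 'rV[R]_4) T t : periodic_orbit beta ecc c T ->
  pairing (lam (c (t + T))) (derive1 c (t + T)) = pairing (lam (c t)) (derive1 c t).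
Proof.
by move=> hc; rewrite !(orbit_velocity _ hc); have [_ _ _ ->] := hc.
Qed.

Lemma action_primitive (c : R -> 'rV[R]_4) T F a b : periodic_orbit beta ecc c T ->
  a < 0 -> T < b ->
  (forall t, a < t < b -> is_derive t (1 : R) F (pairing (lam (c t)) (derive1 c t))) ->
  action lam c T = F T - F 0.
Proof.
move=> hc a0 Tb dF; have [T0 _ _ _] := hc; have ab : a < b by lra.
apply: Rintegral_FTC => //.
- by move=> t _; exact: continuous_action_density hc.
- by move=> t /andP[t0 tT]; apply: dF; apply/andP; split; lra.
- by apply: (is_derive_continuous (dF _ _)); apply/andP; split; lra.
- by apply: (is_derive_continuous (dF _ _)); apply/andP; split; lra.
Qed.

Lemma periodic_orbit_double (c : R -> 'rV[R]_4) T :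
  periodic_orbit beta ecc c T -> periodic_orbit beta ecc c (2 * T).
Proof.
move=> [T0 Mc dc pc]; split => // [|t]; first by rewrite mulr_gt0.
by rewrite (_ : t + 2 * T = t + T + T) ?pc//; ring.
Qed.

Lemma action_double (c : R -> 'rV[R]_4) T :
  periodic_orbit beta ecc c T -> action lam c (2 * T) = 2 * action lam c T.
Proof.
move=> hc; have hc2 := periodic_orbit_double hc; have [T0 _ _ _] := hc.
have cf t := @continuous_action_density c T t hc.
have [F dF] := @primitive_exists R _ (-1) (2 * T + 1) (fun t _ => cf t).
have b1 : 2 * T < 2 * T + 1 by rewrite ltrDl.
have b2 : T < 2 * T + 1 by lra.
have n0 : (-1 : R) < 0 by rewrite ltrN10.
rewrite (action_primitive hc2 n0 b1 dF) (action_primitive hc n0 b2 dF).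
have b3 : T + T < 2 * T + 1 by lra.
have := @periodic_primitive R _ F _ _ T 0 T cf (fun t => action_density_periodic t hc)
  dF T0 n0 T0 b3.
by rewrite add0r (_ : T + T = 2 * T); [lra|ring].
Qed.

Local Notation P := (orbit_p beta hecc).
Local Notation r := (orbit_r beta hecc).
Local Notation K := (kepler_period beta).
Local Notation g := (kepler_orbit beta hecc).
Local Notation kap := (Num.sqrt (1 - ecc ^+ 2)).

Let f (t : R) : R := pairing (lam (g t)) (derive1 g t).

Let fE t : f t = lam (g t) 0 ipr * accel beta hecc t + lam (g t) 0 ir * P t.
Proof.
have hg := kepler_orbit_periodic hbeta hecc; have [_ Mg _ _] := hg.
have r0 : 0 < g t 0 ir by case: (Mg t).
by rewrite /f pairingE (orbit_velocity _ hg) ham_fieldE// !vec4E force_z_z0 !mulr0 !addr0.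
Qed.

Let swept_t_0 t : swept_t beta lam hecc t 0 = f t.
Proof.
rewrite fE /swept_t /swept cos0 sin0 !mulr1 !mulr0 addr0.
by rewrite -/(kepler_orbit beta hecc t).
Qed.

(** At s = pi the momentum is reversed. As the radius is even and the momentum odd in time, this is
    the orbit run backwards. *)
Let swept_t_pi t : swept_t beta lam hecc t pi = - f (- t).
Proof.
rewrite fE /swept_t /swept cospi sinpi !mulr0 !mulrN1 addr0 /kepler_orbit.
by rewrite /accel orbit_rN orbit_pN; ring.
Qed.

Lemma kepler_action : action lam g K = Num.sqrt 2 * pi * (1 - kap) / beta.
Proof.
have hg := kepler_orbit_periodic hbeta hecc; have T0 := kepler_period_gt0 hbeta.
have cf t : {for t, continuous f} by exact: continuous_action_density hg.
(* The interval is symmetric, because the side s = pi of the rectangle involves [f] at negative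
   times. *)
have [F dF] := @primitive_exists R f (- K - 1) (K + 1) (fun t _ => cf t).
have a0 : - K - 1 < 0 by lra.
have b0 : K < K + 1 by rewrite ltrDl.
have AE := action_primitive hg a0 b0 dF.
have a1 : - K - 1 < - K by lra.
have n0 : - K < 0 by lra.
have c1 : 0 + K < K + 1 by lra.
have := @periodic_primitive R f F _ _ K (- K) 0 cf (fun t => action_density_periodic t hg)
  dF T0 a1 n0 c1.
rewrite add0r addNr => FE.
have dB t := derive_kinetic_primitive hbeta hecc t.
have G := @rectangle_green R 0 K 0 pi
  (fun t s => swept_t beta lam hecc t s - P t ^+ 2 * cos s) (swept_s beta lam hecc)
  (swept_mixed beta lam hecc) T0 (pi_gt0 R) (@continuous_swept_mixed R beta ecc lam hbeta hecc hlam)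
  (derive_swept_t_in_s hbeta hecc hlam) (derive_swept_s_in_t hbeta hecc hlam).
have [PK rK] : P K = P 0 /\ r K = r 0.
  by rewrite -[K in P K]add0r -[K in r K]add0r orbit_pD// orbit_rD.
(* The sides t = 0 and t = K coincide by periodicity, so the right-hand side of Green's identity
   vanishes. *)
have Z s : swept_s beta lam hecc K s - swept_s beta lam hecc 0 s = 0.
  by rewrite /swept_s /swept PK rK subrr.
(* Over one period this primitive increases by twice the difference between the integral of P^2 and
   the action. *)
have dQ t : - K - 1 < t < K + 1 ->
    is_derive t (1 : R) (fun t => F (- t) - F t + 2 * kinetic_primitive beta hecc t)
    (swept_t beta lam hecc t pi - P t ^+ 2 * cos pi - (swept_t beta lam hecc t 0 - P t ^+ 2 * cos 0)).
  move=> ht; have d1 := dF t ht; have d2 := dB t.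
  have ht' : - K - 1 < - t < K + 1 by move/andP: ht => -[t1 t2]; apply/andP; split; lra.
  have d3 : is_derive t (1 : R) (fun t => - t) (-1) by derive_tac; ring.
  have d4 := @derive_comp1 R t F (fun t => - t) _ _ (dF _ ht') d3.
  rewrite swept_t_pi swept_t_0 cospi cos0; move: d1 d2 d4.
  move: (f t) (f (- t)) (P t) => x y p d1 d2 d4; derive_tac; ring.
have cQ t : {for t, continuous (fun t => swept_t beta lam hecc t pi - P t ^+ 2 * cos pi
    - (swept_t beta lam hecc t 0 - P t ^+ 2 * cos 0))}.
  rewrite (_ : (fun t => _) = fun t => - f (- t) - f t + 2 * P t ^+ 2); last first.
    by apply/funext => s; rewrite swept_t_pi swept_t_0 cospi cos0;
      move: (f s) (f (- s)) (P s) => x y p; ring.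
  have cP := @continuous_orbit_p R beta ecc hbeta hecc t.
  have cN : {for t, continuous (fun t : R => - t)} by continuous_tac.
  have cfN := @continuous_comp1 R _ t f (fun t => - t) (@cf (- t)) cN.
  apply: continuous_add; first exact: continuous_add (continuous_opp cfN) (continuous_opp (@cf t)).
  exact: continuous_mul (@cst_continuous_for _ _ _ _) (continuous_sqr cP).
have in0 : - K - 1 < 0 < K + 1 by apply/andP; split; lra.
have inK : - K - 1 < K < K + 1 by apply/andP; split; lra.
have I := @integral_FTC_oo R _ _ 0 K T0 (fun t _ => cQ t)
  (fun t ht => dQ t (let: conj h1 h2 := andP ht in introT andP (conj (lt_trans a0 h1) (lt_trans h2 b0))))
  (is_derive_continuous (dQ 0 in0)) (is_derive_continuous (dQ K inK)).
move: G; rewrite I; under eq_integral => s _ do rewrite Z; rewrite integral0 => -[].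
have := kinetic_primitive_period hbeta hecc.
rewrite oppr0 AE; lra.
Qed.

End OrbitAction.

(* Either [A] is unbounded below, and then [inf A] is the junk value [0], or a
   negative element could be doubled below the infimum. *)
Lemma inf_double_closed (R : realType) (A : set R) (x : R) :
  (forall a, A a -> A (2 * a)) -> A x -> 0 <= x -> 0 <= inf A <= x.
Proof.
move=> dA Ax x0; have [lA|nA] := pselect (has_lbound A); last first.
  by rewrite inf_out ?lexx// => -[_ /nA].
rewrite (ge_inf lA Ax) andbT leNgt; apply/negP => m0.
have [||a Aa am] := @inf_lt R A (inf A / 2).
- by exists x.
- by move: m0; lra.
by have := ge_inf lA (dA _ Aa); move: am; lra.
Qed.

(** * The systolic bound *)

Section SystolicBound.
Variable R : realType.
Variables beta ecc : R.
Variable lam : 'rV[R]_4 -> 'rV[R]_4.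
Hypotheses (hbeta : 0 < beta < 1) (hecc : 0 < ecc < 1).
Hypothesis hlam : adapted_contact_form beta ecc lam.

Lemma Tmin_le_kepler :
  0 <= Tmin beta ecc lam <= Num.sqrt 2 * pi * (1 - Num.sqrt (1 - ecc ^+ 2)) / beta.
Proof.
have /andP[b0 b1] := hbeta; have /andP[e0 e1] := hecc.
rewrite /Tmin; apply: inf_double_closed => [a [c [T [hc ->]]]||].
- by exists c, (2 * T); split; [exact: periodic_orbit_double|rewrite (action_double hbeta hlam)].
- exists (kepler_orbit beta hecc), (kepler_period beta).
  by split; [exact: kepler_orbit_periodic|rewrite (kepler_action hbeta hecc hlam)].
- rewrite divr_ge0 ?(ltW b0)// !mulr_ge0 ?sqrtr_ge0 ?pi_ge0//.
  by rewrite subr_ge0 -[leRHS]sqrtr1 ler_wsqrtr// gerBl sqr_ge0.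
Qed.

End SystolicBound.

Theorem corollary1p4 (R : realType) (beta ecc : R)
    (hbeta : 0 < beta < 1) (hecc : 0 < ecc < 1)
    (hreg : beta ^+ 2 + ecc ^+ 2 < 1) :
  (forall lam : 'rV[R]_4 -> 'rV[R]_4, adapted_contact_form beta ecc lam ->
     systolic_ratio beta ecc lam < Num.sqrt (1 + 7 * beta)) /\
  Num.sqrt (1 + 7 * beta) < 2 * Num.sqrt 2.
Proof.
have /andP[b0 b1] := hbeta.
have s0 : 0 < 1 + 7 * beta by lra.
split=> [lam hlam|]; last first.
  rewrite -(@ltr_pXn2r _ 2)// ?nnegrE ?mulr_ge0 ?sqrtr_ge0// exprMn sqr_sqrt2.
  by rewrite sqr_sqrtr; lra.
have S0 : 0 < Num.sqrt (1 + 7 * beta) by rewrite sqrtr_gt0.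
have vol := lt_le_trans (energy_integral_gt hbeta hecc hreg)
  (contact_volume_ge hbeta hecc hreg hlam).
have [t0 tK] := andP (Tmin_le_kepler hbeta hecc hlam).
rewrite /systolic_ratio.
move: vol t0 tK; move: (contact_volume _ _ _) (Tmin _ _ _) (Num.sqrt (1 + 7 * beta)) S0
  (Num.sqrt (1 - _)) => V t S S0 k vol t0 tK.
(* A non-negative strict lower bound makes the volume positive, so the quotient can be cleared. *)
have c0 : 0 <= 2 * pi ^+ 2 * (1 - k) ^+ 2 / (beta ^+ 2 * S).
  apply: divr_ge0; first exact: mulr_ge0 (mulr_ge0 (ler0n _ _) (sqr_ge0 _)) (sqr_ge0 _).
  exact: mulr_ge0 (sqr_ge0 _) (ltW S0).
have V0 : 0 < V by exact: le_lt_trans vol.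
rewrite ltr_pdivrMr//.
have t2 : t ^+ 2 <= (Num.sqrt 2 * pi * (1 - k) / beta) ^+ 2 by rewrite ler_pXn2r// nnegrE ?(le_trans t0).
apply: (le_lt_trans t2); rewrite -(ltr_pM2l S0) in vol.
(* The square of the Kepler action equals [S] times the lower bound of the volume exactly. *)
apply: le_lt_trans vol; rewrite le_eqVlt; apply/orP; left; apply/eqP.
have w2 := sqr_sqrt2 R; move: (Num.sqrt 2) w2 => w w2.
by field: w2; rewrite !gt_eqF.
Qed.
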